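(* Suppose that the ODE $\dot x=A(t)x$, $x\in\mathbb{R}^n$, admits an exponential dichotomy on the whole line $\mathbb{R}$ with exponent $\alpha>0$ and bound $K>0$. Let $M>0$ and put $\zeta(\alpha):=Me^{4\alpha}(4KM+\alpha)$ and $\varepsilon_0:=\min\{1,\alpha/\zeta(\alpha)\}>0$. Then for any $r\in(0,\varepsilon_0)$ and $\beta\in(0,\alpha-\zeta(\alpha)r]$, and any kernel $\eta$ satisfying the standing assumptions in the context with delay $r$, the condition $\eta(t,\theta)=-A(t)$ for all $\theta\le -r$ and $t\in\mathbb{R}$, and $\sup_{t\in\mathbb{R}}\|L(t)\|\le M$, the delay equation $\dot x(t)=L(t)x_t=\int_{-r}^0 d_\theta\eta(t,\theta)x(t+\theta)$ admits an exponential dichotomy on the whole line $\mathbb{R}$ with exponent $\beta$.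
   Context: $\mathbb{R}^n$ carries the norm $|\cdot|$ induced by the inner product; $C([-r,0],\mathbb{R}^n)$ is the Banach space of continuous functions with the supremum norm; $x_t(\theta)=x(t+\theta)$ for $\theta\in[-r,0]$. Standing assumptions with delay $r$. $\eta$ is an $n\times n$ matrix-valued function on $\mathbb{R}\times\mathbb{R}$ and $L(t)\phi=\int_{-r}^0 d_\theta\eta(t,\theta)\phi(\theta)$ for $\phi\in C([-r,0],\mathbb{R}^n)$, where: $\eta$ is measurable in $(t,\theta)$, continuous from the left in $\theta$ on $(-r,0)$, $\eta(t,\theta)=0$ for $\theta\ge 0$ and $\eta(t,\theta)=\eta(t,-r)$ for $\theta\le -r$; $\eta(t,\cdot)$ has bounded variation on $[-r,0]$ for each $t$; $L(t)\phi$ is measurable in $t$ for each $\phi$; and $\|L(t)\|$ is locally integrable. (Under $\sup_t\|L(t)\|\le M$ one has $\sup_t\frac{1}{r_0}\int_t^{t+r_0}\|L(u)\|du\le M$ for every $r_0>0$.) Evolution operators. For $s\in\mathbb{R}$, $\phi\in C([-r,0],\mathbb{R}^n)$ there is a unique continuous $x:[s-r,\infty)\to\mathbb{R}^n$ with $x_s=\phi$, locally absolutely continuous on $[s,\infty)$ and satisfying $\dot x(t)=L(t)x_t$ for a.e. $t\ge s$; set $T(t,s)\phi=x_t$ for $t\ge s$. Exponential dichotomy. The delay equation admits an exponential dichotomy on $\mathbb{R}$ with exponent $\alpha>0$ and bound $K>0$ if there are projections $P(t)$ on $C([-r,0],\mathbb{R}^n)$, $t\in\mathbb{R}$, such that: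 $T(t,s)P(s)=P(t)T(t,s)$ for $t\ge s$; $T(t,s)|_{\mathcal{N}(P(s))}$ is an isomorphism from the kernel $\mathcal{N}(P(s))$ onto $\mathcal{N}(P(t))$ for $t\ge s$, with inverse denoted $T(s,t)$; and $\|T(t,s)P(s)\|\le Ke^{-\alpha(t-s)}$ for $t\ge s$, $\|T(t,s)(Id-P(s))\|\le Ke^{-\alpha(s-t)}$ for $s\ge t$. ''With exponent $\beta$'' means with exponent $\beta$ and some bound. For the ODE the definition is the same, with $\mathbb{R}^n$ in place of $C([-r,0],\mathbb{R}^n)$ and the evolution operator of the ODE in place of $T(t,s)$. *)

(* Defs.v *)
From HB Require Import structures.
From mathcomp Require Import all_boot all_order all_algebra.
From mathcomp Require Import all_classical all_reals all_analysis.
From mathcomp Require Import measurable_realfun.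

Set Implicit Arguments.
Unset Strict Implicit.
Unset Printing Implicit Defensive.

Import Order.TTheory GRing.Theory Num.Theory.
Import numFieldTopology.Exports numFieldNormedType.Exports.

Local Open Scope classical_set_scope.
Local Open Scope ring_scope.

(* The vector space structure on the continuous maps X -> V, inherited from
   the pointwise structure on X -> V. *)
Section continuous_lmodType.
Context (R : numFieldType) (X : topologicalType) (V : normedModType R).

Definition cont_pred : {pred X -> V} := mem [set f | continuous f].

Lemma cont_pred_submod_closed : submod_closed cont_pred.
Proof.
split=> [|a f g /set_mem fc /set_mem gc]; apply/mem_set => x.
  exact: cvg_cst.
by apply: cvgD; [apply: cvgZl_tmp; exact: fc|exact: gc].
Qed.

HB.instance Definition _ :=
  GRing.isSubmodClosed.Build R (X -> V) cont_pred cont_pred_submod_closed.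

Definition cont_Sub (f : X -> V) (fP : f \in cont_pred) : continuousType X V :=
  mkcts (set_mem fP).

Lemma cont_rect (K : continuousType X V -> Type) :
  (forall f (fP : f \in cont_pred), K (cont_Sub fP)) -> forall u, K u.
Proof.
move=> KSub u; have uP : (u : X -> V) \in cont_pred.
  exact/mem_set/(@cts_fun _ _ u).
suff -> : u = cont_Sub uP by exact: KSub.
exact/continuousEP.
Qed.

Lemma cont_SubK f (fP : f \in cont_pred) : cont_Sub fP = f :> (X -> V).
Proof. by []. Qed.

HB.instance Definition _ :=
  isSub.Build (X -> V) cont_pred (continuousType X V) cont_rect cont_SubK.
HB.instance Definition _ :=
  [SubChoice_isSubLmodule of continuousType X V by <:].

End continuous_lmodType.

Section norms.
Context (R : realType).

(* The norm of the library on matrices is the sup norm; the norm of R^n is the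
   Euclidean one. *)
Definition enorm n (v : 'cV[R]_n) : R := Num.sqrt (\sum_i v i ord0 ^+ 2).

(* The norms are passed explicitly. The value is extended real, so that an
   unbounded operator has norm +oo. *)
Definition opnorm (V W : Type) (NV : V -> R) (NW : W -> R) (f : V -> W) :
    \bar R :=
  ereal_sup [set (NW (f v))%:E | v in [set v | NV v <= 1]].

End norms.

Definition delay_itv (R : realType) (r : R) : set R := `[- r, 0].

Notation Cspace r n := (continuousType (delay_itv r) 'cV_n).

Definition supnorm (R : realType) (r : R) n (phi : Cspace r n) : R :=
  sup (range (fun theta => enorm (phi theta))).

Section dichotomy.
Context (R : realType) (V : lmodType R) (N : V -> R) (T : R -> R -> V -> V).
Local Open Scope ereal_scope.

Definition ker (P : V -> V) : set V := [set v | P v = 0%R].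

Definition bounded_projection (P : V -> V) :=
  opnorm N N P < +oo /\ forall v, P (P v) = P v.

(* For t <= s, the inverse of the bijection T s t from ker (P t) onto
   ker (P s). *)
Definition backward (P : R -> {linear V -> V}) (t s : R) : V -> V :=
  'pinv_(fun=> 0%R) (ker (P t)) (T s t).

Definition dichotomy_with (P : R -> {linear V -> V}) (alpha K : R) :=
  [/\ forall t, bounded_projection (P t),
      forall t s, (s <= t)%R -> forall v, T t s (P s v) = P t (T t s v),
      forall t s, (s <= t)%R -> set_bij (ker (P s)) (ker (P t)) (T t s),
      forall t s, (s <= t)%R ->
        opnorm N N (fun v => T t s (P s v)) <=
          (K * expR (- alpha * (t - s)))%:E &
      forall t s, (t <= s)%R ->
        opnorm N N (fun v => backward P t s (v - P s v)%R) <=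
          (K * expR (- alpha * (s - t)))%:E ].

Definition exp_dichotomy (alpha K : R) :=
  exists P : R -> {linear V -> V}, dichotomy_with P alpha K.

End dichotomy.

Section measurability.
Context (R : realType).

(* The line with the sigma-algebra of Lebesgue measurable sets, and the plane
   with the completion of its Borel sigma-algebra. *)
Definition lebesgueR : measurableType _ :=
  caratheodory_type ((@wlength R idfun)^*)%mu.

Definition lebesgueR2 : measurableType _ :=
  g_sigma_algebraType
    (completed_algebra_gen (@lebesgue_measure R \x @lebesgue_measure R)%E).

Definition locally_lebesgue_integrable (f : R -> \bar R) :=
  forall a b : R,
    (@completed_lebesgue_measure R).-integrable `[a, b] (f : lebesgueR -> \bar R).

End measurability.

Section caratheodory_solutions.
Context (R : realType) (n : nat).
Implicit Types (x g : R -> 'cV[R]_n) (s : R).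

Definition abs_continuous (a b : R) x :=
  forall e, 0 < e -> exists2 d, 0 < d &
    forall (m : nat) (u v : 'I_m -> R),
      (forall i, [/\ a <= u i, u i <= v i & v i <= b]) ->
      (forall i j, i != j -> v i <= u j \/ v j <= u i) ->
      \sum_i (v i - u i) < d ->
      \sum_i enorm (x (v i) - x (u i)) < e.

Definition solves_from s x g :=
  (forall b, abs_continuous s b x) /\
  {ae @lebesgue_measure R, forall t, s <= t -> is_derive t 1 x (g t)}.

End caratheodory_solutions.

Section ode.
Context (R : realType) (n : nat) (A : R -> 'M[R]_n).

(* The value at time t of the solution with value v at time s; only used for
   s <= t, as solutions are only required to solve the equation on [s, +oo[. *)
Definition ode_evolution (t s : R) (v : 'cV[R]_n) : 'cV[R]_n :=
  xget 0 [set w | exists x : R -> 'cV[R]_n,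
    [/\ x s = v, solves_from s x (fun u => A u *m x u) & w = x t]].

End ode.

Section stieltjes.
Context (R : realType) (r : R) (n : nat).
Implicit Types (G : R -> 'M[R]_n) (phi : delay_itv r -> 'cV[R]_n).
Implicit Types (p : seq R) (xi : nat -> delay_itv r).

(* A partition of [-r, 0] is given, as in itv_partition, by the list p of its
   points other than -r; xi i is the tag of its i-th interval. *)
Definition tagged_partition p xi :=
  itv_partition (- r) 0 p /\
  forall i, (i < size p)%N ->
    nth 0 (- r :: p) i <= \val (xi i) <= nth 0 p i.

Definition mesh_lt p (d : R) :=
  forall i, (i < size p)%N -> nth 0 p i - nth 0 (- r :: p) i < d.

Definition stieltjes_sum G phi p xi : 'cV[R]_n :=
  \sum_(i < size p) (G (nth 0 p i) - G (nth 0 (- r :: p) i)) *m phi (xi i).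

Definition is_stieltjes_integral G phi (I : 'cV[R]_n) :=
  forall e, 0 < e -> exists2 d, 0 < d &
    forall p xi, tagged_partition p xi -> mesh_lt p d ->
      enorm (stieltjes_sum G phi p xi - I) < e.

(* 0 when the integral does not exist. *)
Definition stieltjes_integral G phi : 'cV[R]_n :=
  xget 0 (is_stieltjes_integral G phi).

End stieltjes.

Section delay_equation.
Context (R : realType) (r : R) (n : nat) (eta : R -> R -> 'M[R]_n).

Definition delayL (t : R) (phi : delay_itv r -> 'cV[R]_n) : 'cV[R]_n :=
  stieltjes_integral (eta t) phi.

Definition normL (t : R) : \bar R :=
  opnorm (@supnorm R r n) (@enorm R n) (fun phi : Cspace r n => delayL t phi).

Record standing_assumptions : Prop := {
  eta_measurable : forall i j,
    measurable_fun [set: lebesgueR2 R]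
      ((fun z => eta z.1 z.2 i j) : lebesgueR2 R -> R) ;
  eta_left_continuous : forall t theta, - r < theta < 0 ->
    eta t theta' @[theta' --> theta^'-] --> eta t theta ;
  eta_right : forall t theta, 0 <= theta -> eta t theta = 0 ;
  eta_left : forall t theta, theta <= - r -> eta t theta = eta t (- r) ;
  eta_bounded_variation : forall t i j,
    bounded_variation (- r) 0 (fun theta => eta t theta i j) ;
  delayL_measurable : forall (phi : Cspace r n) i,
    measurable_fun [set: lebesgueR R]
      ((fun t => delayL t phi i ord0) : lebesgueR R -> R) ;
  normL_locally_integrable : locally_lebesgue_integrable normL
}.

Definition segment (x : R -> 'cV[R]_n) (t : R) : delay_itv r -> 'cV[R]_n :=
  fun theta => x (t + \val theta).

Definition delay_solution (s : R) (phi : Cspace r n) (x : R -> 'cV[R]_n) :=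
  [/\ {within `[s - r, +oo[, continuous x},
      segment x s = phi &
      solves_from s x (fun t => delayL t (segment x t))].

(* The segment x_t of the solution x with x_s = phi; only used for s <= t. *)
Definition delay_evolution (t s : R) (phi : Cspace r n) : Cspace r n :=
  xget 0 [set psi : Cspace r n |
    exists2 x, delay_solution s phi x & segment x t = psi].

End delay_equation.

(* Main.v *)
Require Import Defs.
From HB Require Import structures.
From mathcomp Require Import all_boot all_order all_algebra.
From mathcomp Require Import all_classical all_reals all_analysis.
From mathcomp Require Import measurable_realfun ring lra.

Set Implicit Arguments.
Unset Strict Implicit.
Unset Printing Implicit Defensive.

Import Order.TTheory GRing.Theory Num.Theory.
Import numFieldTopology.Exports numFieldNormedType.Exports.

Local Open Scope classical_set_scope.
Local Open Scope ring_scope.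

(** Let [N x t = L(t) x_t - A(t) x(t)] be the defect of the delay functional. Since
    [eta t] is [0] at [0] and [- A t] at [- r], the functional [L(t)] takes the
    value [A(t) v] at the constant function [v]. So [N x t] only depends on the
    oscillation of [x] over [[t - r, t]], and is at most [M r] times a bound for
    the derivative of [x] there. The delay equation is the equation
    [x' = A(t) x + N x], and it is a small perturbation of the ordinary equation
    on bounded solutions of forced equations, because these have bounded
    derivatives.

    The dichotomy of the ordinary equation gives for every forcing [g] with
    [|g t| <= c exp (- b |t - s|)], [0 < b < alpha], a unique bounded solution of
    [w' = A(t) w + g]; it is at most [2 K c / (alpha - b) exp (- b |t - s|)]
    ([a_priori], [ode_green]). Sending [g] to [f + N w] is then a contraction with
    the constant [rate b], which is less than [1] because the delay is small
    ([rate_lt1]). Its fixed point yields a solution of [w' = L(t) w_t + f] that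
    decays at rate [b] away from [s] if [f] does ([delay_solvable]); the same
    estimate with [b = 0] shows that the homogeneous delay equation has no bounded
    solution on the whole line except [0] ([delay_bounded_zero]).

    These two facts give the dichotomy. Let [x] be the solution with initial
    function [phi] at time [s]. Replace it by a curve [z] that is [0] before [s],
    affine on [[s, s + r]] and equal to [x] afterwards; it solves the delay
    equation with a forcing supported in [[s, s + 2 r]] ([truncate_history]). If
    [w] is the decaying solution with this forcing, then [z - w] is a homogeneous
    solution on the whole line that decays at rate [b] in the past, and [x] minus
    this solution decays at rate [b] in the future ([splitting]). Hence every
    [phi] is the sum of a function whose solution is bounded in the future and of
    the segment of a solution bounded in the past; such a decomposition is unique
    since there are no nonzero bounded solutions, it is preserved by the
    evolution, and the estimates of the dichotomy are those of the splitting
    ([exp_dichotomy_delay]).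

    Equations hold almost everywhere, for absolutely continuous curves. They are
    used through one inequality: if the derivative of such a curve is bounded
    almost everywhere by that of an increasing function [H], then its increments
    are bounded by those of [H] ([abs_continuous_increment], proved by
    subdividing the interval into short pieces). *)

(** * The Euclidean norm *)

Section euclidean_norm.
Context (R : realType) (n : nat).
Implicit Types (v w : 'cV[R]_n) (a : R).

Lemma enorm_ge0 v : 0 <= enorm v.
Proof. exact: sqrtr_ge0. Qed.

Lemma sqr_enorm v : enorm v ^+ 2 = \sum_i v i ord0 ^+ 2.
Proof. by rewrite sqr_sqrtr// sumr_ge0// => i _; exact: sqr_ge0. Qed.

Lemma enorm_le_sqr v a : 0 <= a -> \sum_i v i ord0 ^+ 2 <= a ^+ 2 ->
  enorm v <= a.
Proof. by move=> a0 h; rewrite -(@ler_pXn2r _ 2)// ?nnegrE ?enorm_ge0// sqr_enorm. Qed.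

Lemma enorm0 : enorm (0 : 'cV[R]_n) = 0.
Proof.
by rewrite /enorm big1 ?sqrtr0// => i _; rewrite mxE expr0n.
Qed.

Lemma enormZ a v : enorm (a *: v) = `|a| * enorm v.
Proof.
rewrite /enorm -sqrtr_sqr -sqrtrM ?sqr_ge0// mulr_sumr.
by congr Num.sqrt; apply: eq_bigr => i _; rewrite mxE exprMn.
Qed.

Lemma enormN v : enorm (- v) = enorm v.
Proof. by rewrite -scaleN1r enormZ normrN1 mul1r. Qed.

Lemma enormBC v w : enorm (v - w) = enorm (w - v).
Proof. by rewrite -enormN opprB. Qed.

Lemma enorm_coord v i : `|v i ord0| <= enorm v.
Proof.
rewrite -sqrtr_sqr ler_wsqrtr// (bigD1 i)//= lerDl sumr_ge0// => j _.
exact: sqr_ge0.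
Qed.

Lemma enorm_le_sum v : enorm v <= \sum_i `|v i ord0|.
Proof.
apply: enorm_le_sqr; first exact: sumr_ge0.
rewrite expr2 mulr_suml; apply: ler_sum => i _.
rewrite -real_normK ?num_real// expr2 ler_wpM2l//.
by rewrite (bigD1 i)//= lerDl sumr_ge0.
Qed.

Lemma enorm_eq0 v : enorm v <= 0 -> v = 0.
Proof.
move=> v0; apply/matrixP => i j; rewrite ord1 mxE; apply/eqP.
by rewrite -normr_le0 (le_trans (enorm_coord _ _)).
Qed.

Lemma normr_le_enorm v : `|v| <= enorm v.
Proof.
rewrite /Num.norm/= mx_normrE; apply: bigmax_le; first exact: enorm_ge0.
by move=> [i j] _ /=; rewrite (ord1 j); exact: enorm_coord.
Qed.

Lemma enorm_le_normr v : enorm v <= n%:R * `|v|.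
Proof.
apply: le_trans (enorm_le_sum v) _.
rewrite -[X in X%:R]card_ord -sum1_card natr_sum mulr_suml.
apply: ler_sum => i _; rewrite mul1r [X in _ <= X]mx_normrE.
exact: (le_bigmax _ (fun x : 'I_n * 'I_1 => `|v x.1 x.2|) (i, ord0)).
Qed.

Lemma cauchy_schwarz v w :
  \sum_i v i ord0 * w i ord0 <= enorm v * enorm w.
Proof.
have [v0|v0] := leP (enorm v) 0.
  by rewrite (enorm_eq0 v0) enorm0 mul0r big1// => i _; rewrite mxE mul0r.
have [w0|w0] := leP (enorm w) 0.
  by rewrite (enorm_eq0 w0) enorm0 mulr0 big1// => i _; rewrite mxE mulr0.
set s := (X in X <= _).
have : 0 <= \sum_i (enorm w * v i ord0 - enorm v * w i ord0) ^+ 2.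
  by rewrite sumr_ge0// => i _; exact: sqr_ge0.
have -> : \sum_i (enorm w * v i ord0 - enorm v * w i ord0) ^+ 2 =
   2 * (enorm v * enorm w) * (enorm v * enorm w - s).
  transitivity (enorm w ^+ 2 * enorm v ^+ 2 + enorm v ^+ 2 * enorm w ^+ 2
     - 2 * (enorm v * enorm w) * s); last by ring.
  have -> : enorm w ^+ 2 * enorm v ^+ 2 =
      \sum_i enorm w ^+ 2 * v i ord0 ^+ 2 by rewrite -mulr_sumr -sqr_enorm.
  have -> : enorm v ^+ 2 * enorm w ^+ 2 =
      \sum_i enorm v ^+ 2 * w i ord0 ^+ 2 by rewrite -mulr_sumr -sqr_enorm.
  rewrite /s mulr_sumr -big_split/= -sumrB.
  by apply: eq_bigr => i _; ring.
by rewrite pmulr_rge0 ?subr_ge0// !mulr_gt0.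
Qed.

Lemma enormD v w : enorm (v + w) <= enorm v + enorm w.
Proof.
apply: enorm_le_sqr; first by rewrite addr_ge0 ?enorm_ge0.
have -> : (enorm v + enorm w) ^+ 2 =
  enorm v ^+ 2 + enorm w ^+ 2 + 2 * (enorm v * enorm w) by ring.
rewrite !sqr_enorm.
have := cauchy_schwarz v w.
rewrite -(ler_pM2l (ltr0n _ 2)) => /(lerD (lexx
  (\sum_i v i ord0 ^+ 2 + \sum_i w i ord0 ^+ 2))); apply: le_trans.
rewrite mulr_sumr -!big_split/= le_eqVlt; apply/orP; left; apply/eqP.
by apply: eq_bigr => i _; rewrite mxE; ring.
Qed.

Lemma enormB v w : enorm (v - w) <= enorm v + enorm w.
Proof. by rewrite -[enorm w]enormN enormD. Qed.

Lemma enorm_dist u v w : enorm (v - w) <= enorm (v - u) + enorm (u - w).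
Proof. by rewrite (_ : v - w = (v - u) + (u - w)) ?enormD// addrA subrK. Qed.

Lemma enorm_sum (I : Type) (s : seq I) (F : I -> 'cV[R]_n) :
  enorm (\sum_(i <- s) F i) <= \sum_(i <- s) enorm (F i).
Proof.
elim: s => [|i s IH]; first by rewrite !big_nil enorm0.
by rewrite !big_cons (le_trans (enormD _ _))// lerD2l.
Qed.

End euclidean_norm.

(** Convergence can be tested with the Euclidean norm, which is equivalent to
    the sup norm that defines the topology of ['cV_n]. *)
Section continuity.
Context (R : realType) (n : nat).
Implicit Types (x : R -> 'cV[R]_n).

Lemma cvg_enorm (T : Type) (F : set_system T) (FF : Filter F)
    (f : T -> 'cV[R]_n) l :
  (forall e, 0 < e -> \forall t \near F, enorm (f t - l) < e) <-> f @ F --> l.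
Proof.
split=> [h|/cvgrPdist_lt h e e0].
  apply/cvgrPdist_lt => e e0; apply: filterS (h e e0) => t.
  by apply: le_lt_trans; rewrite distrC normr_le_enorm.
have n0 : 0 < n%:R + 1 :> R by rewrite ltr_wpDl.
have := h (e / (n%:R + 1)); rewrite divr_gt0// => /(_ isT).
apply: filterS => t; rewrite distrC ltr_pdivlMr// => h1.
apply: le_lt_trans (enorm_le_normr _) (le_lt_trans _ h1).
by rewrite mulrC ler_wpM2l// lerDl.
Qed.

Lemma continuous_enormP x :
  continuous x <-> forall t e, 0 < e -> exists2 d, 0 < d &
    forall u, `|u - t| < d -> enorm (x u - x t) < e.
Proof.
split=> [h t e e0|h t].
  have /cvg_enorm/(_ e e0)/nbhs_ballP[d /= d0 hd] := h t.
  by exists d => // u ud; apply: hd; rewrite /ball/= distrC.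
apply/cvg_enorm => e e0; have [d d0 hd] := h t e e0.
by apply/nbhs_ballP; exists d => //= u; rewrite /ball/= distrC => /hd.
Qed.

Lemma enorm_continuous : continuous (@enorm R n).
Proof.
move=> v; have FF : Filter (nbhs v) by exact: nbhs_filter.
apply/cvgrPdist_lt => e e0.
have /cvg_enorm/(_ e e0) : id @ v --> v by exact: cvg_id.
apply: filterS => w; apply: le_lt_trans.
have := enormD (w - v) v; have := enormD (v - w) w.
rewrite !subrK (enormBC v w) => h1 h2.
by rewrite ler_norml lerBlDr lerBrDl; apply/andP; split; lra.
Qed.

End continuity.

(** * Increments of absolutely continuous functions *)

Section cousin.
Context (R : realType).

(** A property of subintervals that is additive and holds for the short
    intervals around each point holds for the whole interval: the supremum of
    the good right endpoints is good, and cannot be less than [b]. *)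
Lemma cousin (P : R -> R -> Prop) a b : a <= b ->
  (forall u v w, a <= u -> u <= v -> v <= w -> w <= b ->
     P u v -> P v w -> P u w) ->
  (forall t, a <= t <= b -> exists2 d, 0 < d &
     forall u v, a <= u -> u <= t -> t <= v -> v <= b -> v - u < d -> P u v) ->
  P a b.
Proof.
move=> ab Padd Ploc; pose S := [set t | a <= t <= b /\ P a t].
have Sa : S a.
  split; first by rewrite lexx.
  by have [|d d0] := Ploc a; rewrite ?lexx//; apply; rewrite ?lexx// subrr.
have Sub : has_ubound S by exists b => t [/andP[]].
have Ssup : has_sup S by split => //; exists a.
pose c := sup S.
have ac : a <= c by exact: ub_le_sup.
have cb : c <= b by apply: ge_sup; [exists a|move=> t [/andP[]]].
have [|d d0 Pc] := Ploc c; first by rewrite ac.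
have d20 : 0 < d / 2 by rewrite divr_gt0.
have [s [/andP[as_ sb] Pas] cs] := sup_adherent d20 Ssup.
have sc : s <= c by apply: ub_le_sup => //; split; rewrite ?as_.
have Pac : P a c.
  by apply: (Padd a s c) => //; apply: Pc => //; rewrite -/c in cs; lra.
have [cb'|bc] := ltP c b; last by have <- : c = b by apply/le_anti; rewrite cb.
pose v := Num.min b (c + d / 2).
have cv : c < v by rewrite lt_min cb' ltrDl.
have vb : v <= b by rewrite ge_min lexx.
have vd : v <= c + d / 2 by rewrite ge_min lexx orbT.
suff : v <= c by rewrite leNgt cv.
apply: ub_le_sup => //; split; first by rewrite vb andbT; lra.
by apply: (Padd a c v) => //; [exact: ltW|apply: Pc => //; lra].
Qed.

End cousin.

Section mean_value.
Context (R : realType) (n : nat).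
Implicit Types (x : R -> 'cV[R]_n) (H : R -> R).
Notation mu := (@lebesgue_measure R).

Definition disjoint_subintervals (a b : R) (s : seq (R * R)) :=
  all (fun p => [&& a <= p.1, p.1 <= p.2 & p.2 <= b]) s /\
  pairwise (fun p q => p.2 <= q.1) s.

Lemma disjoint_subintervals_cat a c b s t : a <= c -> c <= b ->
  disjoint_subintervals a c s -> disjoint_subintervals c b t ->
  disjoint_subintervals a b (s ++ t).
Proof.
move=> ac cb [/allP s1 s2] [/allP t1 t2]; split.
  apply/allP => p; rewrite mem_cat => /orP[/s1|/t1] /and3P[h1 h2 h3].
    by rewrite h1 h2 (le_trans h3).
  by rewrite h2 h3 (le_trans ac).
rewrite pairwise_cat s2 t2 !andbT; apply/allrelP => p q /s1 + /t1.
by move=> /and3P[_ _ pc] /and3P[cq _ _]; exact: le_trans pc cq.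
Qed.

Lemma abs_continuous_seq a b x : abs_continuous a b x ->
  forall e, 0 < e -> exists2 d, 0 < d & forall s, disjoint_subintervals a b s ->
    \sum_(p <- s) (p.2 - p.1) < d -> \sum_(p <- s) enorm (x p.2 - x p.1) < e.
Proof.
move=> ax e /ax[d d0 h]; exists d => // s [/allP s1 s2] sd.
have := h (size s) (fun i => (nth (0, 0) s i).1) (fun i => (nth (0, 0) s i).2).
rewrite !(big_nth (0, 0)) !big_mkord in sd *; apply => // [i|i j ij].
  by have /s1/and3P[] := mem_nth (0, 0) (ltn_ord i).
have h2 (k l : 'I_(size s)) : (k < l)%N ->
    (nth (0, 0) s k).2 <= (nth (0, 0) s l).1.
  by move=> kl; apply: (pairwiseP (0, 0) s2); rewrite ?inE.
by move: ij; rewrite neq_ltn => /orP[/h2|/h2]; [left|right].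
Qed.

Let len (U : set R) (u v : R) := fine (mu (U `&` `[u, v[)).

Let mu_fin (U : set R) u v : open U -> u <= v -> (mu (U `&` `[u, v[) <= (v - u)%:E)%E.
Proof.
move=> oU uv; have mU : measurable U by exact: open_measurable.
apply: (@le_trans _ _ (mu `[u, v[)).
  by apply: le_measure; rewrite ?inE//; (exact: measurableI || exact: subIsetr).
rewrite lebesgue_measure_itv/= lte_fin; case: ifPn => // _.
by rewrite lee_fin subr_ge0.
Qed.

Let lenE (U : set R) u v : open U -> u <= v ->
  mu (U `&` `[u, v[) = (len U u v)%:E.
Proof.
move=> oU uv; rewrite /len fineK// ge0_fin_numE//.
by apply: le_lt_trans (mu_fin oU uv) _; rewrite ltry.
Qed.

Let len_add (U : set R) u v w : open U -> u <= v -> v <= w ->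
  len U u w = len U u v + len U v w.
Proof.
move=> oU uv vw; apply: EFin_inj; rewrite EFinD -!lenE ?(le_trans uv)//.
have mU : measurable U by exact: open_measurable.
rewrite -measureU//; [|exact: measurableI|exact: measurableI|].
  congr mu; rewrite -setIUr; congr (_ `&` _).
  rewrite (@itv_bndbnd_setU _ _ _ (BLeft v))//= bnd_simp//.
apply/seteqP; split => // t [[_ +] [_]] /=; rewrite !in_itv/=.
by move=> /andP[_ tv] /andP[vt _]; move: (le_lt_trans vt tv); rewrite ltxx.
Qed.

Let len_itv (U : set R) u v : open U -> u <= v -> `[u, v] `<=` U ->
  len U u v = v - u.
Proof.
move=> oU uv UV; apply: EFin_inj; rewrite -lenE//.
rewrite (_ : U `&` _ = `[u, v[%classic); last first.
  apply/seteqP; split; first exact: subIsetr.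
  move=> t /= ut; split => //; apply: UV; move: ut.
  by rewrite /= !in_itv/= => /andP[-> /ltW].
rewrite lebesgue_measure_itv/= lte_fin; case: ifPn => //.
rewrite -leNgt => vu; have -> : u = v by apply/le_anti; rewrite uv vu.
by rewrite subrr.
Qed.

(** Tag each point outside the null set by an interval on which the increment
    of [x] is controlled by that of [H], and each point of the null set by an
    interval inside an open set [U] of small measure. By Cousin's lemma finitely
    many of these intervals make up [[a, b]], and those inside [U] contribute
    little because [x] is absolutely continuous. *)
Lemma abs_continuous_increment a b x H (N : set R) : a <= b ->
  abs_continuous a b x -> mu.-negligible N ->
  {in `[a, b] &, {homo H : u v / u <= v}} ->
  (forall t, a <= t <= b -> ~ N t -> forall e, 0 < e -> exists2 d, 0 < d &
    forall u v, a <= u -> u <= t -> t <= v -> v <= b -> v - u < d ->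
      enorm (x v - x u) <= H v - H u + e * (v - u)) ->
  enorm (x b - x a) <= H b - H a.
Proof.
move=> ab ax [A [mA A0 NA]] Hmono Hloc; apply/ler_addgt0Pr => e e0.
(* Half of [e] is spent outside [N], at the rate [k], and half inside [U]. *)
pose k := e / (2 * (b - a + 1)).
have ba1 : 0 < b - a + 1 by rewrite ltr_wpDl ?subr_ge0.
have k0 : 0 < k by rewrite divr_gt0// mulr_gt0.
have [d d0 hd] := abs_continuous_seq ax (divr_gt0 e0 (ltr0n _ 2)).
have [|U [oU AU muU]] := lebesgue_regularity_outer mA _ d0.
  by apply: (@le_lt_trans _ _ 0%E); [rewrite le_eqVlt; apply/orP; left; apply/eqP; exact: A0|rewrite ltry].
have mU : measurable U by exact: open_measurable.
have muUd : (mu U < d%:E)%E.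
  rewrite -(setDUK AU) measureU//; last by rewrite setDIK.
    by apply: le_lt_trans muU; rewrite -[leRHS]add0e leeD2r//; rewrite le_eqVlt; apply/orP; left; apply/eqP; exact: A0.
  exact: measurableD.
(* [s] lists those intervals of a subdivision of [[u, v]] that lie in [U]. *)
pose P u v := exists s, [/\ disjoint_subintervals u v s,
  \sum_(p <- s) (p.2 - p.1) <= len U u v &
  enorm (x v - x u) <= H v - H u + k * (v - u) +
    \sum_(p <- s) enorm (x p.2 - x p.1)].
suff [s [s1 s2 s3]] : P a b.
  apply: le_trans s3 _; rewrite -addrA lerD2l.
  have h1 : \sum_(p <- s) enorm (x p.2 - x p.1) < e / 2.
    apply: hd => //; apply: le_lt_trans s2 _.
    rewrite -lte_fin -lenE//; apply: le_lt_trans muUd.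
    by apply: le_measure; rewrite ?inE//; (exact: measurableI || exact: subIsetl).
  have h2 : k * (b - a) <= e / 2.
    rewrite /k invfM mulrA -mulrA -[X in _ <= X]mulr1 ler_pM2l ?divr_gt0//.
    by rewrite ler_pdivrMl// mulr1 lerDl.
  lra.
apply: cousin => // [u v w au uv vw wb [s [s1 s2 s3]] [t [t1 t2 t3]]|t /[dup] tab /andP[at_ tb]].
  exists (s ++ t); split; first exact: (disjoint_subintervals_cat uv vw).
    by rewrite big_cat/= (len_add oU uv vw) lerD.
  rewrite big_cat/=; apply: le_trans (enorm_dist (x v) _ _) _; lra.
have [Nt|Nt] := pselect (N t); last first.
  have [r r0 hr] := Hloc t tab Nt k k0.
  exists r => // u v au ut tv vb vur; exists [::]; split => //.
    by rewrite big_nil fine_ge0.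
  by rewrite big_nil addr0; exact: hr.
have /nbhs_ballP[r /= r0 hr] : nbhs t U by apply: open_nbhs_nbhs; split; auto.
exists r => // u v au ut tv vb vur; exists [:: (u, v)]; split.
- by split; rewrite //= !lexx (le_trans ut).
- rewrite big_seq1/= len_itv ?(le_trans ut)// => z /=; rewrite in_itv/=.
  move=> /andP[uz zv]; apply: hr; rewrite /ball/= ltr_norml.
  by apply/andP; split; lra.
rewrite big_seq1/= lerDr addr_ge0//.
  by rewrite subr_ge0; apply: Hmono; rewrite ?in_itv/= ?(le_trans ut)// ?au ?vb ?(le_trans au) ?(le_trans ut) ?(le_trans tv).
by rewrite mulr_ge0 ?(ltW k0)// subr_ge0 (le_trans ut).
Qed.

End mean_value.

(** * Primitives of scalar functions *)

Section primitive.
Context (R : realType).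
Notation mu := (@lebesgue_measure R).

(** Lebesgue measurable sets differ from Borel sets by null sets, and countably
    many superlevel sets determine a function; so a Lebesgue measurable function
    becomes Borel measurable when it is set to [0] on a suitable null set. *)
Lemma borel_version (g : R -> R) :
  measurable_fun [set: lebesgueR R] (g : lebesgueR R -> R) ->
  exists N : set R, [/\ measurable N, mu N = 0%E &
    measurable_fun [set: R] (fun t => if t \in N then 0 else g t)].
Proof.
move=> mg.
have hq (q : rat) : exists AN : set R * set R, [/\ measurable AN.1,
    mu.-negligible AN.2 & [set t | ratr q < g t] = AN.1 `|` AN.2].
  have mq : (wlength idfun)^*%mu.-cara.-measurable [set t | ratr q < g t].
    have := mg measurableT `]ratr q, +oo[%classic (measurable_itv _).
    rewrite setTI (_ : g @^-1` _ = [set t | ratr q < g t])//.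
    by apply/seteqP; split => t /=; rewrite in_itv/= andbT.
  move: mq; rewrite -(@completed_caratheodory_measurable R).
  rewrite g_sigma_completed_algebra_genE => -[A mA [B nB AB]].
  by exists (A, B).
have [AN hAN] := choice hq.
have : mu.-negligible (\bigcup_(k in [set: nat])
    (if @unpickle rat k is Some q then (AN q).2 else set0)).
  apply: negligible_bigcup => k; case: unpickle => [q|].
    by have [] := hAN q.
  exact: negligible_set0.
move=> [N [mN N0 sN]]; exists N; split => //.
have subN q : (AN q).2 `<=` N.
  move=> t tq; apply: sN; exists (pickle q); first exact: I.
  by rewrite pickleK.
apply: (measurability _ (RGenOInfty.measurableE R)) => //.
move=> _ [_ [a ->] <-]; rewrite setTI.
rewrite (_ : _ @^-1` _ = (if a < 0 then N else set0) `|` (\bigcup_q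
       (if a <= ratr q then (AN q).1 `\` N else set0))); last first.
  apply/seteqP; split => t /=.
    rewrite in_itv/= andbT; case: ifPn => [/set_mem tN a0|tN agt].
      by left; rewrite a0.
    right; have [q] := @rat_in_itvoo R _ _ agt.
    rewrite in_itv/= => /andP[aq qgt]; exists q => //.
    rewrite (ltW aq); split; last by move/mem_set; exact/negP.
    have [_ _ /seteqP[/(_ t)]] := hAN q.
    move=> /(_ qgt)[//|/subN/mem_set]; by rewrite (negPf tN).
  rewrite in_itv/= andbT => -[|[q _]].
    by case: ifPn => // a0 /mem_set ->.
  case: ifPn => // aq [tq tN].
  rewrite ifN; last by apply/negP => /set_mem.
  apply: le_lt_trans aq _; have [_ _ /seteqP[_ /(_ t)]] := hAN q.
  by apply; left.
apply: measurableU; first by case: ifP.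
apply: bigcupT_measurable_rat => q; case: ifP => // _.
by apply: measurableD => //; have [] := hAN q.
Qed.

Lemma scalar_primitive (g : R -> R) s :
  measurable_fun [set: lebesgueR R] (g : lebesgueR R -> R) ->
  (forall b : R, exists c : R, forall t, `|t| <= b -> `|g t| <= c) ->
  exists F : R -> R, [/\ F s = 0,
    forall b : R, exists2 c : R, 0 <= c & forall u v, s <= u -> u <= v -> v <= b ->
      `|F v - F u| <= c * (v - u) &
    {ae mu, forall t, s < t -> is_derive t 1 F (g t)}].
Proof.
move=> mg bg; have [N [mN N0 mf]] := borel_version mg.
set f := (fun t => _) in mf.
have bf (b : R) : exists2 c : R, 0 <= c & forall t, `|t| <= b -> `|f t| <= c.
  have [c hc] := bg b; exists `|c| => // t /hc gc; rewrite /f.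
  by case: ifP => _; rewrite ?normr0// (le_trans gc)// ler_norm.
have intf u v : mu.-integrable `[u, v] (EFin \o f).
  apply: measurable_bounded_integrable => //.
  - by rewrite /= lebesgue_measure_itv/=; case: ifP => _; rewrite ?ltry// -EFinB ltry.
  - exact: measurable_funS mf.
  have [c c0 hc] := bf (`|u| + `|v|); exists c; split; first exact: num_real.
  move=> y cy t /=; rewrite in_itv/= => /andP[ut tv].
  apply: le_trans (ltW cy); apply: hc; rewrite ler_norml.
  have := ler_norm (- u); rewrite normrN => h1.
  have := ler_norm v; have := normr_ge0 u; have := normr_ge0 v => h2 h3 h4.
  by apply/andP; split; lra.
have lif : locally_integrable setT f.
  split => //; first exact: openT.
  move=> C _ cC; have [r [_ hr]] := compact_bounded cC.
  have [c c0 hc] := bf (r + 1).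
  apply: le_lt_trans (@integral_le_bound _ _ _ mu C (EFin \o f) c%:E _ _ _ _) _.
  - exact: compact_measurable.
  - apply/measurable_EFinP; exact: measurable_funS mf.
  - by rewrite lee_fin.
  - apply: aeW => t Ct; rewrite lee_fin; apply: hc.
    by apply: hr => //; rewrite ltrDl.
  by rewrite lte_mul_pinfty// compact_finite_measure.
pose F x := (\int[mu]_(t in [set` `[s, x]]) (f t))%R.
exists F; split.
- by rewrite /F set_itv1 Rintegral_set1.
- move=> b; have [c c0 hc] := bf (`|s| + `|b|); exists c => // u v su uv vb.
  rewrite /F Rintegral_itvB ?bnd_simp//.
  have intuv : mu.-integrable `]u, v] (EFin \o f).
    apply: integrableS (intf u v) => //; exact: subset_itv_oc_cc.
  apply: le_trans (le_normr_Rintegral _ intuv) _ => //.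
  rewrite -lee_fin /Rintegral fineK.
    apply: le_trans (@integral_le_bound _ _ _ mu `]u, v] (EFin \o f) c%:E _ _ _ _) _ => //.
    - by case/integrableP : intuv.
    - apply: aeW => t /=; rewrite in_itv/= => /andP[ut tv]; rewrite lee_fin.
      apply: hc; rewrite ler_norml.
      have := ler_norm (- s); rewrite normrN => h1.
      have := ler_norm b; have := normr_ge0 s; have := normr_ge0 b => h2 h3 h4.
      by apply/andP; split; lra.
    rewrite /= lebesgue_measure_itv/= lte_fin; case: ifPn => [_|_].
      by rewrite -EFinB -EFinM.
    by rewrite mule0 lee_fin mulr_ge0// subr_ge0.
  have /integrableP[mi] := intuv; rewrite ge0_fin_numE//.
  exact: integral_ge0.
have ae1 := FTC1 (fun y => intf s y) lif.
have ae2 : {ae mu, forall t, ~ N t}.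
  by exists N; split => // t /= /contrapT.
apply: (@filterS2 _ _ (ae_filter_ringOfSetsType mu) _ _ _ _ ae1 ae2).
move=> t dF Nt st; have [dFt F'] := dF st.
apply: DeriveDef => //; rewrite -derive1E F' /f ifN//.
by apply/negP => /set_mem.
Qed.

End primitive.

(** * Curves with a given derivative almost everywhere *)

Ltac vring := apply/matrixP => ? ?; rewrite !mxE; ring.

Lemma is_derive_approx (R : realType) (W : normedModType R) (x : R -> W) (t : R) (v : W) :
  is_derive t 1 x v -> forall e : R, 0 < e -> exists2 d : R, 0 < d &
    forall u, `|u - t| < d -> `|x u - x t - (u - t) *: v| <= e * `|u - t|.
Proof.
move=> [dx xv] e e0; move: dx; rewrite /derivable => /cvg_ex[l hl].
have lv : l = v by rewrite -xv; apply/esym/cvg_lim.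
move: hl; rewrite lv => /cvgrPdist_lt/(_ e e0).
rewrite near_withinE => /nbhs_ballP[d /= d0 hd].
exists d => // u utd; have [->|ut] := eqVneq u t.
  by rewrite !subrr scale0r subrr !normr0 mulr0.
have ut0 : u - t != 0 by rewrite subr_eq0.
have := hd (u - t); rewrite /ball/= sub0r normrN => /(_ utd ut0) /ltW.
rewrite -[_ *: 1]/(_ * 1) mulr1 subrK => h1.
have -> : x u - x t - (u - t) *: v = (u - t) *: ((u - t)^-1 *: (x u - x t) - v).
  by rewrite scalerBr scalerA divff// scale1r.
by rewrite normrZ mulrC ler_wpM2r// distrC.
Qed.

Section solutions.
Context (R : realType) (n : nat).
Implicit Types (x y g h : R -> 'cV[R]_n) (s t a b c e : R).
Notation mu := (@lebesgue_measure R).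

Lemma is_derive_cV x t (v : 'cV[R]_n) :
  (forall i, is_derive t 1 (fun u => x u i ord0) (v i ord0)) ->
  is_derive t 1 x v.
Proof.
move=> hx; have dx : derivable x t 1.
  by apply/derivable_mxP => i j; rewrite ord1; exact: ex_derive.
apply: DeriveDef => //; rewrite derive_mx//; apply/matrixP => i j.
by rewrite mxE ord1; exact: derive_val.
Qed.

Lemma is_derive_enorm x t (v : 'cV[R]_n) : is_derive t 1 x v ->
  forall e : R, 0 < e -> exists2 d : R, 0 < d & forall u, `|u - t| < d ->
    enorm (x u - x t - (u - t) *: v) <= e * `|u - t|.
Proof.
move=> dx e e0; have n0 : 0 < n%:R + 1 :> R by rewrite ltr_wpDl.
have [d d0 hd] := is_derive_approx dx (divr_gt0 e0 n0).
exists d => // u /hd h1; apply: le_trans (enorm_le_normr _) _.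
apply: (@le_trans _ _ ((n%:R + 1) * (e / (n%:R + 1) * `|u - t|))).
  by apply: ler_pM => //; rewrite lerDl.
by rewrite mulrA mulrCA divff ?gt_eqF// mulr1.
Qed.

Lemma nonneg_derivative_homo (H h : R -> R) :
  (forall t, is_derive t 1 H (h t)) -> (forall t, 0 <= h t) ->
  {homo H : u v / u <= v}.
Proof.
move=> dH h0 u v uv; have dd t : derivable H t 1 by exact: ex_derive.
apply: (@ger0_derive1_ndecr _ H u v) => // [t _|].
  by rewrite derive1E derive_val.
by apply: continuous_subspaceT => t; exact/differentiable_continuous/derivable1_diffP.
Qed.

(** The fundamental inequality behind all estimates: the increment of an
    absolutely continuous function is at most that of any primitive of a bound
    for its derivative. *)
Lemma solves_from_increment s a b x g (H h : R -> R) :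
  s <= a -> a <= b -> solves_from s x g ->
  (forall t, is_derive t 1 H (h t)) -> (forall t, 0 <= h t) ->
  (forall t, a <= t <= b -> enorm (g t) <= h t) ->
  enorm (x b - x a) <= H b - H a.
Proof.
move=> sa ab [ax [N [mN N0 sN]]] dH h0 gh.
apply: (@abs_continuous_increment _ _ a b x H N) => //.
- move=> e e0; have [d d0 hd] := ax b e e0; exists d => // m u v uv; apply: hd.
  by move=> i; have [au ? ?] := uv i; split => //; exact: le_trans au.
- by exists N; split => // t /= h1; apply: sN.
- by move=> u v _ _; exact: (nonneg_derivative_homo dH h0).
move=> t /[dup] tab /andP[at_ tb] Nt e e0.
have dxt : is_derive t 1 x (g t).
  by apply: contrapT => h1; apply/Nt/sN => /= h2; apply/h1/h2; exact: le_trans at_.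
have e20 : 0 < e / 2 by rewrite divr_gt0.
have [d1 d10 h1] := is_derive_enorm dxt e20.
have [d2 d20 h2] := is_derive_approx (dH t) e20.
rewrite /GRing.scale/= in h2.
exists (Num.min d1 d2); first by rewrite lt_min d10.
move=> u v au ut tv vb; rewrite lt_min => /andP[vu1 vu2].
have nu : `|u - t| = t - u by rewrite ler0_norm ?opprB// subr_le0.
have nv : `|v - t| = v - t by rewrite ger0_norm// subr_ge0.
have := h1 u; have := h1 v; have := h2 u; have := h2 v.
have tu : t - u <= v - u by rewrite lerD2r.
have vt : v - t <= v - u by rewrite lerD2l lerN2.
rewrite nu nv !(le_lt_trans tu)// !(le_lt_trans vt)//.
move=> /(_ isT) + /(_ isT) + /(_ isT) + /(_ isT).
rewrite !ler_norml => /andP[k1 _] /andP[_ k2] k3 k4.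
have -> : x v - x u = (x v - x t - (v - t) *: g t) - (x u - x t - (u - t) *: g t)
    + (v - u) *: g t.
  by vring.
apply: le_trans (enormD _ _) _; rewrite enormZ ger0_norm; last by lra.
apply: le_trans (lerD (enormB _ _) (lexx _)) _.
have gt := gh t tab.
have : (v - u) * enorm (g t) <= (v - u) * h t by rewrite ler_wpM2l//; lra.
rewrite [X in _ <= X -> _](_ : _ = (v - t) * h t - (u - t) * h t); last by ring.
move: k1 k2 k3 k4; move: ((v - t) * h t) ((u - t) * h t) => p q.
move: (enorm _) (enorm _) (_ * enorm _) => *.
lra.
Qed.

Lemma solves_fromD s x y g h c : solves_from s x g -> solves_from s y h ->
  solves_from s (fun t => x t + c *: y t) (fun t => g t + c *: h t).
Proof.
move=> [ax dx] [ay dy]; split=> [b e e0|].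
  have c0 : 0 < 2 * (`|c| + 1) by rewrite mulr_gt0// ltr_wpDl.
  have [d1 d10 h1] := ax b _ (divr_gt0 e0 (ltr0n _ 2)).
  have [d2 d20 h2] := ay b _ (divr_gt0 e0 c0).
  exists (Num.min d1 d2); first by rewrite lt_min d10.
  move=> m u v uv disj; rewrite lt_min => /andP[/(h1 m u v uv disj) k1].
  move=> /(h2 m u v uv disj) k2; apply: (@le_lt_trans _ _
    (\sum_i enorm (x (v i) - x (u i)) + `|c| * \sum_i enorm (y (v i) - y (u i)))).
    rewrite mulr_sumr -big_split/=; apply: ler_sum => i _.
    rewrite -enormZ (_ : x (v i) + _ - _ =
      (x (v i) - x (u i)) + c *: (y (v i) - y (u i))); first exact: enormD.
    by vring.
  have : `|c| * \sum_i enorm (y (v i) - y (u i)) <= e / 2.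
    apply: (@le_trans _ _ ((`|c| + 1) * (e / (2 * (`|c| + 1))))).
      apply: ler_pM; rewrite ?lerDl//; last exact: ltW.
      by rewrite sumr_ge0// => i _; exact: enorm_ge0.
    by rewrite [leLHS](_ : _ = e / 2)//; field; rewrite gt_eqF// ltr_wpDl.
  by lra.
apply: (@filterS2 _ _ (ae_filter_ringOfSetsType mu) _ _ _ _ dx dy).
by move=> t hx hy st; apply: is_deriveD; [exact: hx|apply: is_deriveZ; exact: hy].
Qed.

Lemma solves_fromS s s' x g : s <= s' -> solves_from s x g -> solves_from s' x g.
Proof.
move=> ss [ax dx]; split=> [b e e0|].
  have [d d0 hd] := ax b e e0; exists d => // m u v uv; apply: hd.
  by move=> i; have [? ? ?] := uv i; split => //; exact: le_trans ss _.
by apply: (@filterS _ _ (ae_filter_ringOfSetsType mu) _ _ _ dx) => t h /(le_trans ss).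
Qed.

Lemma eq_solves_from s x y g h : (forall t, s <= t -> x t = y t) ->
  (forall t, s <= t -> g t = h t) -> solves_from s x g -> solves_from s y h.
Proof.
move=> xy gh [ax dx]; split=> [b e e0|].
  have [d d0 hd] := ax b e e0; exists d => // m u v uv disj uvd.
  rewrite (eq_bigr (fun i => enorm (x (v i) - x (u i)))); first exact: hd.
  by move=> i _; have [su uiv _] := uv i; rewrite !xy// (le_trans su).
have ns : {ae mu, forall t, t != s}.
  exists [set s]; split => //; first exact: lebesgue_measure_set1.
  by move=> t /= /negP; rewrite negbK => /eqP.
apply: (@filterS2 _ _ (ae_filter_ringOfSetsType mu) _ _ _ _ dx ns).
move=> t hx ts st; rewrite -gh//; apply: near_eq_is_derive (hx st).
have st' : s < t by rewrite lt_neqAle eq_sym ts.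
apply/nbhs_ballP; exists (t - s); first by rewrite /= subr_gt0.
by move=> u; rewrite /ball/= ltr_norml => /andP[_ h1]; apply: xy; lra.
Qed.

End solutions.

(** * The integral of a locally bounded function *)

Section integral.
Context (R : realType) (n : nat).
Implicit Types (x y g h : R -> 'cV[R]_n) (s t a b c e : R).
Notation mu := (@lebesgue_measure R).

Definition lmeasurable g := forall i, measurable_fun [set: lebesgueR R]
  ((fun t => g t i ord0) : lebesgueR R -> R).

Definition locally_bounded g := forall b, exists c,
  forall t, `|t| <= b -> enorm (g t) <= c.

(** Local boundedness is enough for every function that is integrated below,
    and makes the integrals locally Lipschitz. *)
Definition integrand g := lmeasurable g /\ locally_bounded g.

Lemma lmeasurableD g h c : lmeasurable g -> lmeasurable h ->
  lmeasurable (fun t => g t + c *: h t).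
Proof.
move=> mg mh i; rewrite (_ : (fun t => _) =
  (fun t => g t i ord0) \+ (cst c \* (fun t => h t i ord0))); last first.
  by apply/funext => t; rewrite !mxE.
exact: measurable_funD (mg i) (measurable_funM (measurable_cst _) (mh i)).
Qed.

Lemma locally_boundedD g h c : locally_bounded g -> locally_bounded h ->
  locally_bounded (fun t => g t + c *: h t).
Proof.
move=> bg bh b; have [c1 h1] := bg b; have [c2 h2] := bh b.
exists (c1 + `|c| * c2) => t tb; apply: le_trans (enormD _ _) _.
by rewrite enormZ lerD ?h1// ler_wpM2l// h2.
Qed.

Lemma integrandD g h c : integrand g -> integrand h ->
  integrand (fun t => g t + c *: h t).
Proof.
by move=> [mg bg] [mh bh]; split; [exact: lmeasurableD|exact: locally_boundedD].
Qed.

Lemma integrand_cst (v : 'cV[R]_n) : integrand (fun=> v).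
Proof.
split=> [i|b]; first exact: measurable_cst.
by exists (enorm v) => t _.
Qed.

Lemma primitive_exists g s : integrand g ->
  exists G, G s = 0 /\ solves_from s G g.
Proof.
move=> [mg bg].
have hF i : exists F : R -> R, [/\ F s = 0,
    forall b : R, exists2 c : R, 0 <= c & forall u v, s <= u -> u <= v -> v <= b ->
      `|F v - F u| <= c * (v - u) &
    {ae mu, forall t, s < t -> is_derive t 1 F (g t i ord0)}].
  apply: scalar_primitive => // b; have [c hc] := bg b.
  by exists c => t /hc; apply: le_trans; exact: enorm_coord.
have [F hFi] := choice hF; exists (fun t => \col_i F i t).
split; first by apply/matrixP => i j; rewrite !mxE; have [] := hFi i.
split=> [b e e0|].
  have lip i : exists c, 0 <= c /\ forall u v, s <= u -> u <= v -> v <= b ->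
      `|F i v - F i u| <= c * (v - u).
    by have [_ /(_ b)[c c0 hc] _] := hFi i; exists c.
  have [c hc] := choice lip.
  pose C := \sum_i c i + 1.
  have C0 : 0 < C by rewrite ltr_wpDl// sumr_ge0// => i _; have [] := hc i.
  exists (e / C); first exact: divr_gt0.
  move=> m u v uv _ sd; apply: (@le_lt_trans _ _ (C * \sum_i (v i - u i))).
    rewrite mulr_sumr; apply: ler_sum => j _; have [su ujv vb] := uv j.
    apply: le_trans (enorm_le_sum _) _.
    apply: (@le_trans _ _ (\sum_i c i * (v j - u j))).
      by apply: ler_sum => i _; rewrite !mxE; apply: (hc i).2.
    by rewrite -mulr_suml ler_wpM2r ?subr_ge0// lerDl.
  by rewrite mulrC -ltr_pdivlMr.
have ns : {ae mu, forall t, t != s}.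
  exists [set s]; split => //; first exact: lebesgue_measure_set1.
  by move=> t /= /negP; rewrite negbK => /eqP.
have aeF : {ae mu, forall t, forall i, s < t -> is_derive t 1 (F i) (g t i ord0)}.
  pose P k t := if insub k is Some i then
    s < t -> is_derive t 1 (F i) (g t i ord0) else True.
  have : {ae mu, forall t, forall k, P k t}.
    apply/ae_foralln => k; rewrite /P; case: insubP => [i _ _|_].
      by have [] := hFi i.
    exact: aeW.
  apply: (@filterS _ _ (ae_filter_ringOfSetsType mu)) => t h i.
  by have := h i; rewrite /P valK.
apply: (@filterS2 _ _ (ae_filter_ringOfSetsType mu) _ _ _ _ aeF ns).
move=> t dF ts st; apply: is_derive_cV => i.
rewrite (_ : (fun u => _) = F i); first by apply: dF; rewrite lt_neqAle eq_sym ts.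
by apply/funext => u; rewrite mxE.
Qed.

(** For [s <= t] this is the Lebesgue integral of [g] over [[s, t]]; it is taken
    as the primitive that vanishes at [s], in the sense in which solutions of
    the equations are defined. *)
Definition integ g s : R -> 'cV[R]_n :=
  xget (fun=> 0) [set G | G s = 0 /\ solves_from s G g].

Lemma integ_spec g s : integrand g ->
  integ g s s = 0 /\ solves_from s (integ g s) g.
Proof.
move=> /(primitive_exists s)[G hG]; rewrite /integ; case: xgetP => [F _ //|].
by move=> /(_ G).
Qed.

Lemma integ_refl g s : integrand g -> integ g s s = 0.
Proof. by case/(integ_spec s). Qed.

Lemma solves_from_unique s x y g : x s = y s ->
  solves_from s x g -> solves_from s y g -> forall t, s <= t -> x t = y t.
Proof.
move=> xys hx hy t st; have h1 := solves_fromD (-1) hx hy.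
apply/eqP; rewrite -subr_eq0; apply/eqP/enorm_eq0.
have := solves_from_increment (lexx s) st h1 (H := cst 0) (h := cst 0).
rewrite !scaleN1r xys subrr subr0 subrr; apply => // [u _].
by rewrite scaleN1r subrr enorm0.
Qed.

Lemma solves_from_integ s x g : integrand g ->
  solves_from s x g <-> forall t, s <= t -> x t - x s = integ g s t.
Proof.
move=> gi; have [J0 Js] := integ_spec s gi; split=> [hx t st|hx].
  apply: (@solves_from_unique s (fun t => x t - x s) (integ g s) g) => //.
    by rewrite subrr.
  split; last first.
    case: hx => _; apply: (@filterS _ _ (ae_filter_ringOfSetsType mu)) => u hu su.
    rewrite -[g u]subr0; apply: is_deriveB; exact: hu.
  case: hx => ax _ b e /(ax b)[d d0 hd]; exists d => // m u v uv disj uvd.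
  rewrite (eq_bigr (fun i => enorm (x (v i) - x (u i)))); first exact: hd.
  by move=> i _; congr enorm; vring.
have : solves_from s (fun t => integ g s t + 1 *: x s) (fun t => g t + 1 *: 0).
  by apply: solves_fromD => //; split=> [b e e0|]; [exists 1 => // m u v _ _ _;
    rewrite big1// => i _; rewrite subrr enorm0|apply: aeW => t _; exact: is_derive_cst].
apply: eq_solves_from => t st; first by rewrite -hx// scale1r subrK.
by rewrite scaler0 addr0.
Qed.

Lemma integ_chasles g a b c : integrand g -> a <= b -> b <= c ->
  integ g a c = integ g a b + integ g b c.
Proof.
move=> gi ab bc; have [J0 Js] := integ_spec a gi.
have /(solves_from_integ _ _ gi) <- // := solves_fromS ab Js.
by rewrite addrC subrK.
Qed.

Lemma integD g h c s t : integrand g -> integrand h -> s <= t ->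
  integ (fun t => g t + c *: h t) s t = integ g s t + c *: integ h s t.
Proof.
move=> gi hi st; have [g0 gs] := integ_spec s gi; have [h0 hs] := integ_spec s hi.
have /(solves_from_integ _ _ (integrandD c gi hi)) <- // := solves_fromD c gs hs.
by rewrite g0 h0 scaler0 addr0 subr0.
Qed.

Lemma integ_le g (H h : R -> R) s t : integrand g -> s <= t ->
  (forall t, is_derive t 1 H (h t)) -> (forall t, 0 <= h t) ->
  (forall u, s <= u <= t -> enorm (g u) <= h u) ->
  enorm (integ g s t) <= H t - H s.
Proof.
move=> gi st dH h0 gh; have [g0 gs] := integ_spec s gi.
by rewrite -[integ g s t]subr0 -g0; exact: (solves_from_increment (lexx s) st gs dH).
Qed.

Lemma integ_le_cst g c s t : integrand g -> s <= t -> 0 <= c ->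
  (forall u, s <= u <= t -> enorm (g u) <= c) ->
  enorm (integ g s t) <= c * (t - s).
Proof.
move=> gi st c0 gc; rewrite mulrBr.
apply: (@integ_le g ( *%R c) (cst c)) => // u.
by rewrite -[X in is_derive _ _ _ X]mulr1; apply: is_deriveZ.
Qed.

Lemma eq_integ g h s t : integrand g -> integrand h -> s <= t ->
  (forall u, s <= u <= t -> g u = h u) -> integ g s t = integ h s t.
Proof.
move=> gi hi st gh; apply/eqP; rewrite -subr_eq0 -scaleN1r -integD//.
apply/eqP/enorm_eq0; rewrite -(mul0r (t - s)).
apply: integ_le_cst => //; first exact: integrandD.
by move=> u /gh ->; rewrite scaleN1r subrr enorm0.
Qed.

Lemma integ_cst (v : 'cV[R]_n) s t : s <= t -> integ (fun=> v) s t = (t - s) *: v.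
Proof.
move=> st; have [_ h1] := integ_spec s (integrand_cst v).
pose x u := (u - s) *: v.
rewrite -(_ : x t - x s = (t - s) *: v); last by rewrite /x subrr scale0r subr0.
apply/esym; move: t st; apply/(solves_from_integ _ _ (integrand_cst v)).
split=> [b e e0|]; last first.
  apply: aeW => t _; apply: is_derive_cV => i.
  rewrite (_ : (fun u => _) = v i ord0 \*: (id - cst s : R -> R)); last first.
    by apply/funext => u; rewrite mxE mulrC.
  rewrite -[X in is_derive _ _ _ X]mulr1 -[X in _ * X]subr0.
  exact: is_deriveZ.
have v0 : 0 < enorm v + 1 by rewrite ltr_wpDl// enorm_ge0.
exists (e / (enorm v + 1)); first exact: divr_gt0.
move=> m u w uw _; rewrite ltr_pdivlMr// => uwd; apply: le_lt_trans uwd.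
rewrite mulr_suml; apply: ler_sum => i _; have [_ uiw _] := uw i.
rewrite (_ : x (w i) - x (u i) = (w i - u i) *: v); last by rewrite /x; vring.
by rewrite enormZ ger0_norm ?subr_ge0// ler_wpM2l ?subr_ge0// lerDl.
Qed.

End integral.

(** * Limits and fixed points in weighted norms *)

Section limits.
Context (R : realType) (n : nat).
Implicit Types (x y f g : R -> 'cV[R]_n) (W : R -> R) (s t a b c q e : R).

Lemma continuous_bounded x a b : continuous x ->
  exists2 c, 0 <= c & forall t, a <= t <= b -> enorm (x t) <= c.
Proof.
move=> cx; have [ab|ba] := leP a b; last first.
  by exists 0 => // t /andP[at_ tb]; move: (le_trans at_ tb); rewrite leNgt ba.
have [|m _ hm] := @EVT_max R (fun t => enorm (x t)) a b ab.
  apply: continuous_subspaceT => t; apply: continuous_comp; first exact: cx.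
  exact: enorm_continuous.
by exists (enorm (x m)); [exact: enorm_ge0|move=> t ht; apply: hm; rewrite in_itv].
Qed.

Lemma continuousDZ x y c : continuous x -> continuous y ->
  continuous (fun t => x t + c *: y t).
Proof.
move=> cx cy t; apply: cvgD; first exact: cx.
by apply: cvgZl_tmp; exact: cy.
Qed.

Lemma lipschitz_continuous x :
  (forall b, exists c, forall u v, `|u| <= b -> `|v| <= b ->
    u <= v -> enorm (x v - x u) <= c * (v - u)) -> continuous x.
Proof.
move=> lx; apply/continuous_enormP => t e e0.
have [c hc] := lx (`|t| + 1).
have c0 : 0 < `|c| + 1 by rewrite ltr_wpDl.
exists (Num.min 1 (e / (`|c| + 1))); first by rewrite lt_min ltr01 divr_gt0.
move=> u; rewrite lt_min => /andP[u1 u2].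
have tb : `|t| <= `|t| + 1 by rewrite lerDl.
have ub : `|u| <= `|t| + 1.
  by rewrite -[u](subrK t) (le_trans (ler_normD _ _))// addrC lerD2l ltW.
have key : enorm (x u - x t) <= c * `|u - t|.
  have [ut|tu] := leP u t.
    by rewrite enormBC ler0_norm ?subr_le0// opprB hc.
  by rewrite ger0_norm ?subr_ge0 ?(ltW tu)// hc// ltW.
apply: le_lt_trans key _.
move: u2; rewrite ltr_pdivlMr// mulrC; apply: le_lt_trans.
by rewrite ler_wpM2r// (le_trans (ler_norm c))// lerDl.
Qed.

Lemma integ_continuous (g : R -> 'cV[R]_n) s : integrand g ->
  continuous (fun t => integ g s (Num.max s t)).
Proof.
move=> gi; apply: lipschitz_continuous => b.
have [_ /(_ (`|b| + `|s|))[c hc]] := gi; exists `|c| => u v ub vb uv.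
have su : s <= Num.max s u by rewrite le_max lexx.
have muv : Num.max s u <= Num.max s v by rewrite ge_max !le_max lexx uv orbT.
rewrite (integ_chasles gi su muv) addrC addKr.
apply: le_trans (@integ_le_cst _ _ _ `|c| _ _ gi muv (normr_ge0 _) _) _.
  move=> w /andP[w1 w2]; apply: le_trans (hc w _) (ler_norm _).
  move: w1 w2; rewrite ge_max => /andP[sw _] w2.
  have {}w2 : w <= s \/ w <= v by move: w2; rewrite le_max => /orP.
  have := ler_norm s; have := ler_norm (- s); have := ler_norm v.
  rewrite normrN => h1 h2 h3; have h4 := ler_norm b.
  by rewrite ler_norml; apply/andP; split; [|case: w2]; move: (normr_ge0 b) (normr_ge0 s); lra.
by rewrite ler_wpM2l// /Num.max; case: (ltP s v) => ?; case: (ltP s u) => ?; lra.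
Qed.

(** The part of the integral near the left end point is small. *)
Lemma eq_integ_open (g h : R -> 'cV[R]_n) s t : integrand g -> integrand h ->
  s <= t -> (forall u, s < u -> u <= t -> g u = h u) -> integ g s t = integ h s t.
Proof.
move=> gi hi; rewrite le_eqVlt => /predU1P[<- _|st gh]; first by rewrite !integ_refl.
have di : integrand (fun u => g u + -1 *: h u) by exact: integrandD.
have [_ /(_ (`|s| + `|t|))[c hc]] := di.
apply/eqP; rewrite -subr_eq0 -scaleN1r -integD ?(ltW st)//.
apply/eqP/enorm_eq0/ler_addgt0Pr => e e0; rewrite add0r.
have c0 : 0 < `|c| + 1 by rewrite ltr_wpDl.
pose d := Num.min (t - s) (e / (`|c| + 1)).
have d0 : 0 < d by rewrite lt_min subr_gt0 st divr_gt0.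
have dt : s + d <= t.
  by rewrite -lerBrDl ge_min lexx.
have sd : s <= s + d by rewrite lerDl ltW.
rewrite (integ_chasles di sd dt); apply: le_trans (enormD _ _) _.
have : enorm (integ (fun u => g u + -1 *: h u) s (s + d)) <= (`|c| + 1) * (s + d - s).
  apply: (integ_le_cst di sd (ltW c0)).
  move=> u /andP[su ud]; apply: le_trans (hc u _) _.
    have := ler_norm t; have := ler_norm (- s); have := normr_ge0 t; have := normr_ge0 s.
    by rewrite normrN ler_norml => *; apply/andP; split; lra.
  by rewrite (le_trans (ler_norm _))// lerDl.
have : enorm (integ (fun u => g u + -1 *: h u) (s + d) t) <= 0 * (t - (s + d)).
  apply: integ_le_cst => // u /andP[du ut].
  by rewrite gh ?scaleN1r ?subrr ?enorm0//; lra.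
have : (`|c| + 1) * d <= e.
  by rewrite mulrC -ler_pdivlMr// ge_min lexx orbT.
by rewrite addrAC subrr add0r mul0r; lra.
Qed.

Lemma expr_small q c e : 0 <= q < 1 -> 0 < e ->
  exists K, forall k, (K <= k)%N -> c * q ^+ k < e.
Proof.
move=> /andP[q0 q1] e0.
have /cvgrPdist_lt : (geometric c q : R^nat) @ \oo --> 0.
  by apply: cvg_geometric; rewrite ger0_norm.
move=> /(_ e e0)[K _ hK]; exists K => k Kk.
by have /= := hK k Kk; rewrite sub0r normrN; apply: le_lt_trans; exact: ler_norm.
Qed.

Lemma geometric_limit (F : nat -> R -> 'cV[R]_n) W c q : 0 <= q < 1 ->
  0 <= c -> (forall t, 0 <= W t) ->
  (forall k t, enorm (F k.+1 t - F k t) <= c * q ^+ k * W t) ->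
  exists f, forall k t, enorm (f t - F k t) <= c / (1 - q) * q ^+ k * W t.
Proof.
move=> q01 c0 W0 hF; have /andP[q0 q1] := q01.
have hd k m t : enorm (F (k + m)%N t - F k t) <=
    c / (1 - q) * q ^+ k * W t * (1 - q ^+ m).
  elim: m => [|m IH]; first by rewrite addn0 subrr enorm0 expr0 subrr mulr0.
  rewrite addnS; apply: le_trans (enorm_dist (F (k + m)%N t) _ _) _.
  apply: le_trans (lerD (hF _ _) IH) _.
  rewrite le_eqVlt exprD exprS; apply/orP; left; apply/eqP; field.
  by rewrite subr_eq0 eq_sym lt_eqF.
have hd' k m t : enorm (F (k + m)%N t - F k t) <= c / (1 - q) * q ^+ k * W t.
  apply: le_trans (hd k m t) _; rewrite ler_piMr//.
    by rewrite !mulr_ge0// ?exprn_ge0// invr_ge0 subr_ge0 ltW.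
  by rewrite gerBl exprn_ge0.
have cvgF t : cvgn (F ^~ t).
  apply/cauchy_cvgP/cauchy_exP => e e0.
  have [K hK] := expr_small (c / (1 - q) * W t) q01 e0.
  exists (F K t); exists K => // k /= Kk.
  rewrite -[ball _ _ _]/(ball (F K t) e (F k t)) -ball_normE/= distrC.
  apply: le_lt_trans (normr_le_enorm _) _; rewrite -(subnKC Kk).
  by apply: le_lt_trans (hd' _ _ _) _; rewrite mulrAC hK.
exists (fun t => limn (F ^~ t)) => k t; apply/ler_addgt0Pr => e e0.
have /cvg_enorm/(_ e e0)[K _ hK] := cvgF t.
have := hK (maxn k K); rewrite /= leq_maxr => /(_ isT) => h1.
apply: le_trans (enorm_dist (F (maxn k K) t) _ _) _; rewrite enormBC addrC lerD//.
  by rewrite -(subnKC (leq_maxl k K)).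
exact: ltW.
Qed.

Lemma continuous_weighted_limit (F : nat -> R -> 'cV[R]_n) f W c q :
  0 <= q < 1 -> 0 <= c -> continuous W -> (forall k, continuous (F k)) ->
  (forall k t, enorm (f t - F k t) <= c * q ^+ k * W t) -> continuous f.
Proof.
move=> q01 c0 cW cF hF; apply/continuous_enormP => t e e0.
have e3 : 0 < e / 3 by rewrite divr_gt0.
have [K hK] := expr_small (c * (`|W t| + 1)) q01 e3.
have cq0 : 0 <= c * q ^+ K by rewrite mulr_ge0// exprn_ge0//; case/andP: q01.
have /cvgrPdist_lt/(_ 1 ltr01)/nbhs_ballP[d1 /= d10 hd1] := cW t.
have /continuous_enormP/(_ t _ e3)[d2 d20 hd2] := cF K.
exists (Num.min d1 d2); first by rewrite lt_min d10.
move=> u; rewrite lt_min => /andP[u1 /hd2 u2].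
have hW v : `|v - t| < d1 -> enorm (f v - F K v) <= e / 3.
  move=> vt; apply: le_trans (hF K v) _; apply: le_trans (ltW (hK K (leqnn _))).
  rewrite [leRHS]mulrAC ler_wpM2l//.
  have := hd1 v; rewrite /ball/= distrC => /(_ vt) h1.
  rewrite -[W v](subrK (W t)) addrC; apply: lerD (ler_norm _) _.
  by rewrite distrC in h1; exact: le_trans (ler_norm _) (ltW h1).
have h1 := hW u u1; have := hW t; rewrite subrr normr0 => /(_ d10) h2.
have h3 := enorm_dist (F K u) (f u) (f t).
have h4 := enorm_dist (F K t) (F K u) (f t).
rewrite (enormBC (F K t)) in h4.
lra.
Qed.

(** The contraction principle for the norm [sup_t |f t| / W t]. Instead of being
    complete, [X] contains the limits of geometrically convergent sequences,
    which is all that the iteration produces. *)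
Lemma weighted_fixpoint (X : set (R -> 'cV[R]_n)) W (Phi : (R -> 'cV[R]_n) -> R -> 'cV[R]_n)
    q c0 f0 : 0 <= q < 1 -> 0 <= c0 -> (forall t, 0 <= W t) ->
  X f0 -> (forall f, X f -> X (Phi f)) ->
  (forall F f c, 0 <= c -> (forall k : nat, X (F k)) ->
    (forall k t, enorm (f t - F k t) <= c * q ^+ k * W t) -> X f) ->
  (forall f g c, 0 <= c -> X f -> X g ->
    (forall t, enorm (f t - g t) <= c * W t) ->
    forall t, enorm (Phi f t - Phi g t) <= q * c * W t) ->
  (forall t, enorm (Phi f0 t - f0 t) <= c0 * W t) ->
  exists f, [/\ X f, forall t, Phi f t = f t &
    forall t, enorm (f t - f0 t) <= c0 / (1 - q) * W t].
Proof.
move=> q01 c00 W0 Xf0 XPhi Xlim hPhi h0; have /andP[q0 q1] := q01.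
have q10 : 0 < 1 - q by rewrite subr_gt0.
pose F k := iter k Phi f0.
have XF k : X (F k) by elim: k => [//|k IH]; exact: XPhi.
have hF k t : enorm (F k.+1 t - F k t) <= c0 * q ^+ k * W t.
  elim: k t => [|k IH] t; first by rewrite expr0 mulr1 h0.
  have -> : c0 * q ^+ k.+1 = q * (c0 * q ^+ k) by rewrite exprS mulrCA.
  by apply: (hPhi (F k.+1) (F k)) => //; rewrite mulr_ge0// exprn_ge0.
have [f hf] := geometric_limit q01 c00 W0 hF.
have C0 : 0 <= c0 / (1 - q) by rewrite divr_ge0// ltW.
have Xf : X f by exact: Xlim hf.
exists f; split => // [t|t]; last by have := hf 0 t; rewrite expr0 mulr1.
apply/eqP; rewrite -subr_eq0; apply/eqP/enorm_eq0/ler_addgt0Pr => e e0.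
rewrite add0r; have [K hK] := expr_small (2 * (c0 / (1 - q)) * W t) q01 e0.
apply: le_trans (ltW (hK K (leqnn K))).
apply: le_trans (enorm_dist (F K.+1 t) _ _) _.
have hfK u : enorm (f u - F K u) <= c0 / (1 - q) * q ^+ K * W u by exact: hf.
have Cq0 : 0 <= c0 / (1 - q) * q ^+ K by rewrite mulr_ge0// exprn_ge0.
have k1 := hPhi f (F K) _ Cq0 Xf (XF K) hfK t.
have k2 := hf K.+1 t; rewrite enormBC exprS in k2.
apply: le_trans (lerD k1 k2) _.
have -> : q * (c0 / (1 - q) * q ^+ K) * W t + c0 / (1 - q) * (q * q ^+ K) * W t =
   2 * (c0 / (1 - q)) * W t * q ^+ K * q by ring.
apply: ler_piMr; last exact: ltW.
by rewrite mulr_ge0 ?exprn_ge0// mulr_ge0// mulr_ge0.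
Qed.

End limits.

(** * Causal functional equations *)

Lemma is_derive_expR_shift (R : realType) (k c s t : R) :
  is_derive t 1 (fun u => c * expR (k * (u - s))) (c * k * expR (k * (t - s))).
Proof.
have h1 : is_derive t 1 (fun u => k * (u - s)) k.
  rewrite (_ : (fun u => _) = k \*: (id - cst s : R -> R)); last by [].
  rewrite -[X in is_derive _ _ _ X]mulr1 -[X in _ * X]subr0.
  exact: is_deriveZ.
have h2 : is_derive t 1 (fun u => expR (k * (u - s))) (k * expR (k * (t - s))).
  have := @is_derive1_comp _ expR (fun u => k * (u - s)) t _ _ _ h1.
  move=> /(_ _ (is_derive_expR _)); rewrite mulrC; exact.
rewrite -mulrA; exact: is_deriveZ.
Qed.

Lemma continuous_expR_shift (R : realType) (k s : R) :
  continuous (fun u => expR (k * (u - s))).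
Proof.
move=> u; apply/differentiable_continuous/derivable1_diffP.
rewrite (_ : (fun u => _) = (fun u => 1 * expR (k * (u - s)))).
  by have h := is_derive_expR_shift k 1 s u; exact: ex_derive.
by apply/funext => v; rewrite mul1r.
Qed.

(** The part of a linear functional differential equation that the estimates
    use: the right-hand side at time [t] depends linearly on the restriction of
    the function to [[t - r, t]], with norm at most [M]. Both [A t *m x t] and
    the delay functional have this form. *)
Record causal (R : realType) (n : nat) (r M : R)
    (Lam : (R -> 'cV[R]_n) -> R -> 'cV[R]_n) : Prop := {
  causal_lin : forall (x y : R -> 'cV[R]_n) (c t : R), continuous x -> continuous y ->
    Lam (fun u => x u + c *: y u) t = Lam x t + c *: Lam y t ;
  causal_bound : forall (x : R -> 'cV[R]_n) (t c : R), continuous x -> 0 <= c ->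
    (forall u, t - r <= u <= t -> enorm (x u) <= c) -> enorm (Lam x t) <= M * c ;
  causal_measurable : forall x : R -> 'cV[R]_n, continuous x -> lmeasurable (Lam x)
}.

Section causal_equations.
Context (R : realType) (n : nat) (r M : R) (r0 : 0 <= r) (M0 : 0 <= M).
Context (Lam : (R -> 'cV[R]_n) -> R -> 'cV[R]_n) (HL : causal r M Lam).
Implicit Types (x y f g h : R -> 'cV[R]_n) (s t a b c e : R).

Lemma causal_integrand x : continuous x -> integrand (Lam x).
Proof.
move=> cx; split; first exact: (causal_measurable HL).
move=> b; have [c c0 hc] := continuous_bounded (- `|b| - r) `|b| cx.
exists (M * c) => t tb; apply: (causal_bound HL) => // u /andP[h1 h2].
apply: hc; have := ler_norm t; have := ler_norm (- t); rewrite normrN => h3 h4.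
have h5 := ler_norm b.
by apply/andP; split; lra.
Qed.

Lemma causalB x y t : continuous x -> continuous y ->
  Lam (fun u => x u - y u) t = Lam x t - Lam y t.
Proof.
move=> cx cy; rewrite -scaleN1r -(causal_lin HL)//; congr Lam.
by apply/funext => u; rewrite scaleN1r.
Qed.

Lemma continuousB_fun x y : continuous x -> continuous y ->
  continuous (fun u => x u - y u).
Proof. by move=> cx cy t; apply: cvgB; [exact: cx|exact: cy]. Qed.

Lemma causal_dist x y t c : continuous x -> continuous y -> 0 <= c ->
  (forall u, t - r <= u <= t -> enorm (x u - y u) <= c) ->
  enorm (Lam x t - Lam y t) <= M * c.
Proof.
move=> cx cy c0 h; rewrite -causalB//; apply: (causal_bound HL) => //.
exact: continuousB_fun.
Qed.

Lemma eq_causal x y t : continuous x -> continuous y ->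
  (forall u, t - r <= u <= t -> x u = y u) -> Lam x t = Lam y t.
Proof.
move=> cx cy xy; apply/eqP; rewrite -subr_eq0; apply/eqP/enorm_eq0.
rewrite -(mulr0 M); apply: causal_dist => // u /xy ->.
by rewrite subrr enorm0.
Qed.

(** The equation [x' = Lam x + f] for times from [s] on, in integral form; [x] is
    defined on the whole line because [Lam x] depends on the history of [x]. The
    coefficient [1] gives the integrand the shape [g + c *: h] in which
    linearity is stated. *)
Definition sol f s x := continuous x /\
  forall t, s <= t -> x t - x s = integ (fun u => Lam x u + 1 *: f u) s t.

Lemma sol_integrand f x : integrand f -> continuous x ->
  integrand (fun u => Lam x u + 1 *: f u).
Proof. by move=> fi cx; apply: integrandD => //; exact: causal_integrand. Qed.

Lemma solS f s x a : integrand f -> s <= a -> sol f s x -> sol f a x.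
Proof.
move=> fi sa [cx hx]; split => // t at_.
have st := le_trans sa at_.
have := integ_chasles (sol_integrand fi cx) sa at_; rewrite -!hx//.
move=> h1; apply: (addrI (x a - x s)); rewrite -h1.
by rewrite addrC addrA subrK.
Qed.

Lemma sol_solvesP f s x : integrand f -> continuous x ->
  sol f s x <-> solves_from s x (fun u => Lam x u + 1 *: f u).
Proof.
move=> fi cx; rewrite (solves_from_integ _ _ (sol_integrand fi cx)).
by split=> [[]//|].
Qed.

Lemma solDZ f g s x y c : integrand f -> integrand g -> sol f s x -> sol g s y ->
  sol (fun t => f t + c *: g t) s (fun t => x t + c *: y t).
Proof.
move=> fi gi xs ys; have cx := xs.1; have cy := ys.1.
have cxy := continuousDZ cx cy (c := c).
apply/sol_solvesP => //; first exact: integrandD.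
move/(sol_solvesP _ fi cx) : xs => xs; move/(sol_solvesP _ gi cy) : ys => ys.
apply: eq_solves_from (solves_fromD c xs ys) => // t st.
by rewrite (causal_lin HL)//; vring.
Qed.

Lemma eq_sol f g s x : integrand f -> integrand g ->
  (forall t, s <= t -> f t = g t) -> sol f s x -> sol g s x.
Proof.
move=> fi gi fg [cx hx]; split => // t st; rewrite hx//.
apply: eq_integ => //; [exact: sol_integrand|exact: sol_integrand|].
by move=> u /andP[/fg -> _].
Qed.

Definition zf : R -> 'cV[R]_n := fun=> 0.

Lemma integrand0 : integrand zf. Proof. exact: integrand_cst. Qed.

Lemma solDZ0 s x y c : sol zf s x -> sol zf s y -> sol zf s (fun t => x t + c *: y t).
Proof.
move=> xs ys; apply: eq_sol (solDZ c integrand0 integrand0 xs ys) => //.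
- by apply: integrandD; exact: integrand0.
- exact: integrand0.
- by move=> t _; rewrite /zf scaler0 addr0.
Qed.

Lemma solBf f s x y : integrand f -> sol f s x -> sol f s y ->
  sol zf s (fun t => x t + -1 *: y t).
Proof.
move=> fi xs ys; apply: eq_sol (solDZ (-1) fi fi xs ys) => //.
- exact: integrandD.
- exact: integrand0.
- by move=> t _; rewrite scaleN1r subrr.
Qed.

Let gam := 2 * M + 1.
Let gam0 : 0 < gam. Proof. by rewrite /gam ltr_wpDl// mulr_ge0. Qed.

(** Gronwall's inequality in the form that suffices here: at the point where
    [x] is largest relative to [exp ((2 M + 1) (t - s))], the integral equation
    bounds this ratio by [3 c / 2] plus half of its own value. *)
Lemma growth s x c t : sol zf s x -> s <= t -> 0 <= c ->
  (forall u, s - r <= u <= s -> enorm (x u) <= c) ->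
  enorm (x t) <= 3 * c * expR (gam * (t - s)).
Proof.
move=> [cx hx] st c0 xc.
pose W u := expR (gam * (u - s)).
have cW : continuous W by exact: continuous_expR_shift.
have W0 u : 0 < W u by exact: expR_gt0.
have [|m mst hm] := @EVT_max R (fun u => enorm (x u) / W u) s t st.
  apply: continuous_subspaceT => u; apply: cvgM.
    apply: (@continuous_comp _ _ _ x); [exact: cx|exact: enorm_continuous].
  by apply: cvgV; [rewrite gt_eqF|exact: cW].
move: mst; rewrite in_itv/= => /andP[sm mt].
pose B := enorm (x m) / W m.
have B0 : 0 <= B by rewrite divr_ge0 ?enorm_ge0// ltW.
have xB u : s <= u -> u <= t -> enorm (x u) <= B * W u.
  by move=> su ut; rewrite -ler_pdivrMr// hm// in_itv/= su.
have Ws : W s = 1 by rewrite /W subrr mulr0 expR0.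
have W1 u : s <= u -> 1 <= W u.
  by move=> su; rewrite -Ws ler_expR ler_wpM2l ?lerD2r// ltW.
have Wmono u v : u <= v -> W u <= W v.
  by move=> uv; rewrite ler_expR ler_wpM2l ?lerD2r// ltW.
suff B3c : B <= 3 * c.
  by apply: le_trans (xB t st (lexx t)) _; rewrite ler_wpM2r// ltW.
pose D := c + B.
have : enorm (x m) <= c + M * D / gam * W m.
  rewrite -[x m](subrK (x s)) addrC hx//.
  apply: le_trans (enormD _ _) _; apply: lerD; first by rewrite xc// lexx gerBl r0.
  have D0 : 0 <= D by rewrite addr_ge0.
  have := @integ_le _ _ (fun u => Lam x u + 1 *: zf u)
    (fun u => M * D / gam * W u) (fun u => M * D / gam * gam * W u) s m
    (sol_integrand integrand0 cx) sm.
  move=> /(_ (fun u => is_derive_expR_shift _ _ _ _)) h1.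
  apply: le_trans (h1 _ _) _.
  - by move=> u; rewrite !mulr_ge0// ?invr_ge0 ltW.
  - move=> u /andP[su um]; rewrite /zf scaler0 addr0 divfK ?gt_eqF// -mulrA.
    apply: (causal_bound HL) => //; first by rewrite mulr_ge0// ltW.
    move=> v /andP[v1 v2]; rewrite /D.
    have [vs|sv] := leP v s.
      apply: (@le_trans _ _ c); first by apply: xc; apply/andP; split => //; lra.
      by rewrite -[leLHS]mulr1 ler_pM ?W1// lerDl.
    apply: le_trans (xB v (ltW sv) _) _; first by rewrite (le_trans v2)// (le_trans um).
    by apply: ler_pM => //; [exact: ltW|rewrite lerDr|exact: Wmono].
  by rewrite gerBl !mulr_ge0// ?invr_ge0 ltW.
rewrite -[enorm (x m)](divfK (lt0r_neq0 (W0 m))) -/B => h1.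
have h2 : B * W m <= (c + M * D / gam) * W m.
  by rewrite (le_trans h1)// mulrDl lerD2r ler_peMr// W1.
rewrite ler_pM2r// in h2.
have : M * D / gam <= D / 2.
  rewrite ler_pdivrMr// /gam; have : 0 <= D by rewrite addr_ge0.
  by move=> D0; lra.
by rewrite /D in h2 *; lra.
Qed.

Lemma sol_unique f s x y : integrand f -> sol f s x -> sol f s y ->
  (forall u, s - r <= u <= s -> x u = y u) -> forall t, s <= t -> x t = y t.
Proof.
move=> fi xs ys xy t st; apply/eqP; rewrite -subr_eq0; apply/eqP/enorm_eq0.
have := growth (solBf fi xs ys) st (lexx 0); rewrite mulr0 mul0r scaleN1r.
by apply => u /xy ->; rewrite scaleN1r subrr enorm0.
Qed.

Lemma continuous_clampl s x : continuous x -> continuous (fun t => x (Num.min t s)).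
Proof.
move=> cx t; apply: continuous_comp; last exact: cx.
exact: (continuous_min (@cvg_id _ _) (cvg_cst _)).
Qed.

(** Picard iteration, started at the history extended by a constant; the
    integral operator is a contraction for the sup norm with weight
    [exp ((2 M + 1) (t - s))]. *)
Lemma sol_exists f s h cf : integrand f -> continuous h ->
  (forall t, enorm (f t) <= cf) ->
  exists x, (forall t, t <= s -> x t = h t) /\ sol f s x.
Proof.
move=> fi ch fb; have cf0 : 0 <= cf by apply: le_trans (enorm_ge0 _) (fb 0).
pose W u := expR (gam * (u - s)).
have cW : continuous W by exact: continuous_expR_shift.
have W0 u : 0 < W u by exact: expR_gt0.
have Wmono u v : u <= v -> W u <= W v.
  by move=> uv; rewrite ler_expR ler_wpM2l ?lerD2r// ltW.
pose X := [set x : R -> 'cV[R]_n | continuous x /\ forall t, t <= s -> x t = h t].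
pose Phi x t := h (Num.min t s) +
  integ (fun u => Lam x u + 1 *: f u) s (Num.max s t).
pose f0 t := h (Num.min t s).
pose q := M / gam.
have q01 : 0 <= q < 1.
  apply/andP; split; first by rewrite divr_ge0// ltW.
  by rewrite /q ltr_pdivrMr// mul1r /gam ltr_pwDr// ler_peMl// ler1n.
have /andP[q0 _] := q01.
have minl t : t <= s -> Num.min t s = t by move=> ts; rewrite min_l.
have minr t : s <= t -> Num.min t s = s by move=> ts; rewrite min_r.
have maxl t : t <= s -> Num.max s t = s by move=> ts; rewrite max_l.
have maxr t : s <= t -> Num.max s t = t by move=> ts; rewrite max_r.
have Xf0 : X f0 by split; [exact: continuous_clampl|move=> t ts; rewrite /f0 minl].
have XPhi x : X x -> X (Phi x).
  move=> [cx xh]; have gi := sol_integrand fi cx; split; last first.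
    by move=> t ts; rewrite /Phi minl// maxl// integ_refl// addr0.
  move=> t; apply: cvgD; first exact: continuous_clampl.
  exact: integ_continuous.
have Xlim F x c : 0 <= c -> (forall k : nat, X (F k)) ->
    (forall k t, enorm (x t - F k t) <= c * q ^+ k * W t) -> X x.
  move=> c0 XF hF; split.
    by apply: (continuous_weighted_limit q01 c0 cW _ hF) => k; case: (XF k).
  move=> t ts; apply/eqP; rewrite -subr_eq0; apply/eqP/enorm_eq0/ler_addgt0Pr => e e0.
  have [K hK] := expr_small (c * W t) q01 e0.
  rewrite add0r; apply: le_trans (ltW (hK K (leqnn K))).
  by have [_ /(_ t ts) <-] := XF K; rewrite mulrAC.
have hPhi x y c : 0 <= c -> X x -> X y -> (forall t, enorm (x t - y t) <= c * W t) ->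
    forall t, enorm (Phi x t - Phi y t) <= q * c * W t.
  move=> c0 [cx xh] [cy yh] xy t.
  have qcW u : 0 <= q * c * W u.
    by rewrite (mulr_ge0 (mulr_ge0 q0 c0))// ltW.
  have [ts|/ltW st] := leP t s.
    by rewrite /Phi !maxl// !integ_refl ?subrr ?enorm0//; exact: sol_integrand.
  rewrite /Phi maxr// opprD addrACA subrr add0r.
  rewrite -scaleN1r -integD//; [|exact: sol_integrand|exact: sol_integrand].
  have gi : integrand (fun u => (Lam x u + 1 *: f u) + -1 *: (Lam y u + 1 *: f u)).
    by apply: integrandD; exact: sol_integrand.
  apply: le_trans (@integ_le _ _ _ (fun u => q * c * W u)
    (fun u => q * c * gam * W u) s t gi st _ _ _) _.
  - by move=> u; exact: is_derive_expR_shift.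
  - by move=> u; rewrite mulrAC (mulr_ge0 (qcW u))// ltW.
  - move=> u /andP[su ut].
    rewrite (_ : _ + _ = Lam x u - Lam y u); last by vring.
    rewrite (_ : q * c * gam = M * c); last by rewrite /q mulrAC divfK// gt_eqF.
    rewrite -mulrA; apply: causal_dist => //; first by rewrite mulr_ge0// ltW.
    by move=> v /andP[_ vu]; rewrite (le_trans (xy v))// ler_wpM2l// Wmono.
  by rewrite gerBl.
have [ch0 ch00 hch] := continuous_bounded (s - r) s ch.
pose C := M * ch0 + cf.
have C0 : 0 <= C by rewrite addr_ge0// mulr_ge0.
have h0 t : enorm (Phi f0 t - f0 t) <= C / gam * W t.
  rewrite /Phi -/(f0 t) [X in X - _]addrC addrK.
  have gi := sol_integrand fi Xf0.1.
  have CW : 0 <= C / gam * W t by rewrite !mulr_ge0// ?invr_ge0 ltW.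
  have [ts|/ltW st] := leP t s; first by rewrite integ_refl// enorm0.
  apply: le_trans (@integ_le_cst _ _ _ C s t gi st C0 _) _.
    move=> u /andP[su ut]; rewrite scale1r; apply: le_trans (enormD _ _) _.
    apply: lerD (fb u); apply: (causal_bound HL Xf0.1 ch00).
    move=> v /andP[v1 v2]; apply: hch; rewrite /Num.min; case: ltP => vs.
      by rewrite (ltW vs) andbT (le_trans _ v1)// lerD2r.
    by rewrite lexx gerBl r0.
  rewrite -mulrA ler_wpM2l// mulrC ler_pdivlMr// mulrC.
  apply: le_trans (expR_ge1Dx _); lra.
have [|x [[cx xh] Phix _]] := weighted_fixpoint q01 _ (fun t => ltW (W0 t)) Xf0 XPhi Xlim hPhi h0.
  by rewrite divr_ge0// ltW.
exists x; split => //; split => // t st.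
by rewrite -{1}Phix /Phi minr// maxr// xh// addrC addKr.
Qed.

End causal_equations.

(** * Riemann-Stieltjes sums *)

Section uniform_continuity.
Context (R : realType) (n : nat).
Implicit Types (x : R -> 'cV[R]_n) (s t a b e : R).

Lemma uniform_continuity x a b e : continuous x -> a <= b -> 0 < e ->
  exists2 d, 0 < d & forall u v, a <= u <= b -> `|v - u| < d ->
    enorm (x v - x u) < e.
Proof.
move=> cx ab e0.
suff [d [d0 hd]] : exists d, 0 < d /\ forall u v, a <= u <= b -> `|v - u| < d ->
    enorm (x v - x u) < e by exists d.
pose P p q := exists d, 0 < d /\ forall u v, p <= u <= q -> `|v - u| < d ->
    enorm (x v - x u) < e.
apply: (@cousin _ P a b ab) => [p c q _ pc cq _ [d1 [d10 h1]] [d2 [d20 h2]]|t _].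
  exists (Num.min d1 d2); split; first by rewrite lt_min d10.
  move=> u v /andP[pu uq]; rewrite lt_min => /andP[vd1 vd2].
  have [uc|cu] := leP u c; first by apply: h1; rewrite ?pu.
  by apply: h2; rewrite ?(ltW cu).
have /continuous_enormP/(_ t (e / 2)) := cx.
rewrite divr_gt0// => /(_ isT)[d d0 hd].
exists (d / 2); first by rewrite divr_gt0.
move=> p q _ pt tq _ pq; exists (d / 2); split; first by rewrite divr_gt0.
move=> u v /andP[pu uq] vu.
have ut : `|u - t| < d / 2 by rewrite ltr_norml; apply/andP; split; lra.
have vt : `|v - t| < d.
  rewrite -(subrK u v) -addrA (splitr d); apply: le_lt_trans (ler_normD _ _) _.
  exact: ltrD.
have {}ut : `|u - t| < d by apply: lt_le_trans ut _; lra.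
rewrite (splitr e); apply: le_lt_trans (enorm_dist (x t) _ _) _.
by rewrite (enormBC (x t)); apply: ltrD; exact: hd.
Qed.

End uniform_continuity.

Section riemann_stieltjes.
Context (R : realType) (n : nat) (G : R -> 'M[R]_n).
Implicit Types (f : R -> 'cV[R]_n) (x u v a b c d e : R) (p q : seq R).

(** [V] plays the role of the total variation of [G]. *)
Definition dominates (V : R -> R) a b := forall u v,
  a <= u -> u <= v -> v <= b -> V u <= V v /\
  forall w : 'cV[R]_n, enorm ((G v - G u) *m w) <= (V v - V u) * enorm w.

Lemma bounded_variation_dominated a b : a < b ->
  (forall i j, bounded_variation a b (fun x => G x i j)) ->
  exists V, dominates V a b.
Proof.
move=> ab bv.
have hV i j : exists V : R -> R, forall u v, a <= u -> u <= v -> v <= b ->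
    `|G v i j - G u i j| <= V v - V u.
  have bvN := bounded_variationN (bv i j).
  exists (fun x => fine (pos_tv a (fun x => G x i j) x) + fine (neg_tv a (fun x => G x i j) x)).
  move=> u v au uv vb.
  have iu : u \in `[a, b] by rewrite in_itv/= au (le_trans uv).
  have iv : v \in `[a, b] by rewrite in_itv/= vb (le_trans au).
  have /= := bounded_variation_pos_neg_tvE (bv i j) iu.
  have /= := bounded_variation_pos_neg_tvE (bv i j) iv.
  have /= := fine_neg_tv_nondecreasing (bv i j) iu iv uv.
  have /= := fine_neg_tv_nondecreasing bvN iu iv uv.
  rewrite -/(pos_tv _ _ _) => h1 h2 h3 h4; rewrite [leLHS](_ : _ =
     `|(fine (pos_tv a (fun x => G x i j) v) - fine (pos_tv a (fun x => G x i j) u)) -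
       (fine (neg_tv a (fun x => G x i j) v) - fine (neg_tv a (fun x => G x i j) u))|).
    by rewrite ler_norml; apply/andP; split; rewrite /pos_tv; lra.
  by congr `|_|; rewrite h3 h4 /pos_tv; lra.
have hV' i : exists Vi : 'I_n -> R -> R, forall j u v, a <= u -> u <= v -> v <= b ->
    `|G v i j - G u i j| <= Vi j v - Vi j u.
  by have [Vi hVi] := choice (hV i); exists Vi.
have [V hVi] := choice hV'.
exists (fun x => \sum_i \sum_j V i j x) => u v au uv vb; split=> [|w].
  apply: ler_sum => i _; apply: ler_sum => j _; rewrite -subr_ge0.
  by apply: le_trans (hVi i j u v au uv vb); exact: normr_ge0.
apply: le_trans (enorm_le_sum _) _.
rewrite -sumrB mulr_suml; apply: ler_sum => i _.
rewrite !mxE; apply: le_trans (ler_norm_sum _ _ _) _.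
rewrite -sumrB mulr_suml; apply: ler_sum => j _.
rewrite normrM !mxE; apply: ler_pM => //; first exact: hVi.
exact: enorm_coord.
Qed.

Definition points a p i := nth 0 (a :: p) i.

Definition rs_sum f a p (xi : nat -> R) : 'cV[R]_n :=
  \sum_(i < size p) (G (points a p i.+1) - G (points a p i)) *m f (xi i).

Definition tagged a b p (xi : nat -> R) := itv_partition a b p /\
  forall i, (i < size p)%N -> points a p i <= xi i <= points a p i.+1.

Definition clamp u v x := Num.max u (Num.min v x).

Lemma points_last a b p : itv_partition a b p -> points a p (size p) = b.
Proof. by case=> _ /eqP <-; rewrite /points -last_nth. Qed.

Lemma points_le a b p i j : itv_partition a b p -> (i <= j)%N -> (j <= size p)%N ->
  points a p i <= points a p j.
Proof.
move=> [pp _] ij jp; apply: (@sorted_leq_nth _ <=%O); rewrite ?inE ?ltnS//.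
- exact: le_trans.
- by apply: (sub_path _ pp) => u v; exact: ltW.
- exact: leq_trans jp.
Qed.

(** The interval [[u, v]] meets each cell of the partition in an interval whose
    end points are those of the cell clamped to [[u, v]]. *)
Lemma clamp_telescope (W : zmodType) (F : R -> W) a b p u v :
  itv_partition a b p -> a <= u -> u <= v -> v <= b ->
  \sum_(j < size p) (F (clamp u v (points a p j.+1)) - F (clamp u v (points a p j))) =
  F v - F u.
Proof.
move=> ip au uv vb.
rewrite -(big_mkord xpredT (fun j => F (clamp u v (points a p j.+1)) -
  F (clamp u v (points a p j)))) telescope_sumr//.
rewrite (points_last ip) /clamp (min_l vb) (max_r uv) /points/=.
by rewrite min_r ?(le_trans au)// max_l.
Qed.

Lemma clamp_below u v x : x <= u -> u <= v -> clamp u v x = u.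
Proof. by move=> xu uv; rewrite /clamp min_r ?(le_trans xu)// max_l. Qed.

Lemma clamp_above u v x : v <= x -> u <= v -> clamp u v x = v.
Proof. by move=> vx uv; rewrite /clamp min_l// max_r. Qed.

Lemma clamp_in u v x : u <= x -> x <= v -> clamp u v x = x.
Proof. by move=> ux xv; rewrite /clamp min_r// max_r. Qed.

Lemma clamp_swap u u' v v' : u <= u' -> v <= v' ->
  (clamp u u' v = clamp u u' v' /\ clamp v v' u = clamp v v' u') \/
  [/\ clamp u u' v' = clamp v v' u', clamp u u' v = clamp v v' u, u <= v' & v <= u'].
Proof.
move=> uu vv; have [vu|/ltW uv] := leP v u'; last first.
  left; rewrite !(clamp_above (u := u)) ?(le_trans uv)//.
  by rewrite !(clamp_below (u := v)) ?(le_trans uu).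
have [uv'|/ltW vu'] := leP u v'; last first.
  left; rewrite !(clamp_below (u := u)) ?(le_trans vv)//.
  by rewrite !(clamp_above (u := v)) ?(le_trans vu').
right; split => //.
  have [u'v'|/ltW v'u'] := leP u' v'; first by rewrite clamp_above// clamp_in.
  by rewrite clamp_in// clamp_above.
have [uv|/ltW vu2] := leP u v; first by rewrite clamp_in// clamp_below.
by rewrite clamp_below// clamp_in.
Qed.

Lemma clamp_le u v x y : x <= y -> clamp u v x <= clamp u v y.
Proof. by move=> xy; rewrite ge_max !le_max lexx/= le_min !ge_min lexx xy !orbT. Qed.

Lemma clamp_itv u v x : u <= v -> u <= clamp u v x <= v.
Proof. by move=> uv; rewrite le_max lexx/= ge_max uv ge_min lexx. Qed.

Definition mesh a p d := forall i, (i < size p)%N -> points a p i.+1 - points a p i < d.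

(** Two Riemann-Stieltjes sums over fine partitions are close: on the common
    refinement both are sums over the same increments of [G], multiplied by
    values of [f] at points at distance less than [2 d]. *)
Lemma rs_sum_compare a b V f w d p q xi zeta : dominates V a b ->
  tagged a b p xi -> tagged a b q zeta -> mesh a p d -> mesh a q d ->
  0 <= w -> (forall x y, a <= x <= b -> a <= y <= b -> `|x - y| < 2 * d ->
    enorm (f x - f y) <= w) ->
  enorm (rs_sum f a p xi - rs_sum f a q zeta) <= (V b - V a) * w.
Proof.
move=> dV [ip tp] [iq tq] mp mq w0 fw.
have ap i : (i <= size p)%N -> a <= points a p i.
  by move=> ip'; exact: (points_le ip (leq0n i) ip').
have pb i : (i <= size p)%N -> points a p i <= b.
  by move=> ip'; rewrite -(points_last ip); exact: points_le ip ip' _.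
have aq i : (i <= size q)%N -> a <= points a q i.
  by move=> iq'; exact: (points_le iq (leq0n i) iq').
have qb i : (i <= size q)%N -> points a q i <= b.
  by move=> iq'; rewrite -(points_last iq); exact: points_le iq iq' _.
have pS i : (i < size p)%N -> points a p i <= points a p i.+1.
  by move=> ip'; exact: (points_le ip (leqnSn i)).
have qS i : (i < size q)%N -> points a q i <= points a q i.+1.
  by move=> iq'; exact: (points_le iq (leqnSn i)).
(* [[Y i j, X i j]] is the intersection of the cells [i] of [p] and [j] of [q],
   degenerate if they do not meet; so is [[Y' i j, X' i j]]. *)
pose X i j := clamp (points a p i) (points a p i.+1) (points a q j.+1).
pose Y i j := clamp (points a p i) (points a p i.+1) (points a q j).
pose X' i j := clamp (points a q j) (points a q j.+1) (points a p i.+1).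
pose Y' i j := clamp (points a q j) (points a q j.+1) (points a p i).
have -> : rs_sum f a p xi - rs_sum f a q zeta =
    \sum_(i < size p) \sum_(j < size q)
      (G (X i j) - G (Y i j)) *m (f (xi i) - f (zeta j)).
  have -> : rs_sum f a p xi =
      \sum_(i < size p) \sum_(j < size q) (G (X i j) - G (Y i j)) *m f (xi i).
    apply: eq_bigr => i _; rewrite -mulmx_suml; congr (_ *m _); apply/esym.
    by apply: (clamp_telescope _ iq); [exact/ap/ltnW|exact: pS|exact: pb].
  have -> : rs_sum f a q zeta =
      \sum_(i < size p) \sum_(j < size q) (G (X i j) - G (Y i j)) *m f (zeta j).
    rewrite exchange_big; apply: eq_bigr => j _; rewrite -mulmx_suml.
    congr (_ *m _); apply/esym.
    rewrite -(clamp_telescope G ip (aq j (ltnW (ltn_ord j))) (qS j (ltn_ord j)) (qb j.+1 (ltn_ord j))).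
    apply: eq_bigr => i _; rewrite -/(X' i j) -/(Y' i j).
    have [[h1 h2]|[h1 h2 _ _]] := clamp_swap (pS i (ltn_ord i)) (qS j (ltn_ord j)).
      by rewrite /X' /Y' /X /Y h1 h2 !subrr.
    by rewrite /X' /Y' /X /Y h1 h2.
  rewrite -sumrB; apply: eq_bigr => i _; rewrite -sumrB; apply: eq_bigr => j _.
  by rewrite mulmxBr.
have -> : (V b - V a) * w = \sum_(i < size p) \sum_(j < size q) (V (X i j) - V (Y i j)) * w.
  have -> : V b - V a = \sum_(i < size p) (V (points a p i.+1) - V (points a p i)).
    rewrite -(big_mkord xpredT (fun i => V (points a p i.+1) - V (points a p i))).
    by rewrite telescope_sumr// (points_last ip).
  rewrite mulr_suml; apply: eq_bigr => i _; rewrite -mulr_suml; congr (_ * _).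
  apply/esym; apply: (clamp_telescope _ iq); [exact/ap/ltnW|exact: pS|exact: pb].
apply: le_trans (enorm_sum _ _) _; apply: ler_sum => i _.
apply: le_trans (enorm_sum _ _) _; apply: ler_sum => j _.
have pi := pS i (ltn_ord i); have qj := qS j (ltn_ord j).
have [[h1 h2]|[h1 h2 h3 h4]] := clamp_swap pi qj.
  by rewrite /X /Y h1 !subrr mul0mx enorm0 mul0r.
have YX : Y i j <= X i j by exact: clamp_le.
have /andP[X1 X2] := clamp_itv (points a q j.+1) pi.
have /andP[Y1 Y2] := clamp_itv (points a q j) pi.
have aY : a <= Y i j by apply: le_trans Y1; exact/ap/ltnW.
have Xb : X i j <= b by apply: le_trans X2 _; exact: pb.
have [VYX VD] := dV _ _ aY YX Xb.
apply: le_trans (VD _) _; apply: ler_wpM2l; first by rewrite subr_ge0.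
have /andP[t1 t2] := tp i (ltn_ord i); have /andP[t3 t4] := tq j (ltn_ord j).
have m1 := mp i (ltn_ord i); have m2 := mq j (ltn_ord j).
apply: fw.
- by rewrite (le_trans _ t1) ?(le_trans t2) ?pb//; exact/ap/ltnW.
- by rewrite (le_trans _ t3) ?(le_trans t4) ?qb//; exact/aq/ltnW.
- rewrite ltr_norml; apply/andP; split; lra.
Qed.

End riemann_stieltjes.

(** * Segments and the Riemann-Stieltjes integral *)

Section uniform_partitions.
Context (R : realType).
Implicit Types (a b d : R) (p : seq R).

Definition uniform_partition a b N : seq R :=
  [seq a + i.+1%:R * ((b - a) / N%:R) | i <- iota 0 N].

Lemma points_uniform a b N i : (i <= N)%N ->
  points a (uniform_partition a b N) i = a + i%:R * ((b - a) / N%:R).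
Proof.
case: i => [_|i iN]; first by rewrite /points/= mul0r addr0.
by rewrite /points/= (nth_map 0%N) ?size_iota// nth_iota.
Qed.

Lemma uniform_partitionP a b N : a < b -> (0 < N)%N ->
  itv_partition a b (uniform_partition a b N).
Proof.
move=> ab N0; have h0 : 0 < (b - a) / N%:R by rewrite divr_gt0 ?subr_gt0// ltr0n.
have sz : size (uniform_partition a b N) = N by rewrite size_map size_iota.
split.
  apply/(pathP 0) => i; rewrite sz => iN.
  rewrite -[nth 0 (a :: _) i]/(points a (uniform_partition a b N) i).
  rewrite -[nth 0 (uniform_partition a b N) i]/(points a (uniform_partition a b N) i.+1).
  rewrite !points_uniform//; last exact: ltnW.
  by rewrite ltrD2l ltr_pM2r// ltr_nat.
apply/eqP; have := points_uniform a b (leqnn N).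
rewrite /points -[X in nth _ _ X]sz -last_nth => ->.
by rewrite mulrCA divff ?pnatr_eq0 -?lt0n// mulr1 addrC subrK.
Qed.

Lemma fine_partition a b d : a < b -> 0 < d ->
  exists2 p, itv_partition a b p & mesh a p d.
Proof.
move=> ab d0; have [N hN] : exists N : nat, (b - a) / d < N.+1%:R.
  exists (Num.truncn ((b - a) / d)).
  by rewrite truncnS_gt.
exists (uniform_partition a b N.+1); first exact: uniform_partitionP.
move=> i; rewrite size_map size_iota => iN.
rewrite !points_uniform//; last exact: ltnW.
rewrite -addn1 natrD mulrDl mul1r opprD addrACA subrr add0r addrAC subrr add0r.
by rewrite ltr_pdivrMr// mulrC -ltr_pdivrMr.
Qed.

End uniform_partitions.

Section delay_segments.
Context (R : realType) (r : R) (n : nat) (r0 : 0 < r).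
Notation C := (continuousType (delay_itv r) 'cV[R]_n).
Implicit Types (phi psi : C) (x : R -> 'cV[R]_n).

Lemma clamp_delay_itv (u : R) : clamp (- r) 0 u \in (delay_itv r : set R).
Proof.
by apply/mem_set; rewrite /delay_itv/= in_itv/=; apply: clamp_itv; rewrite oppr_le0 ltW.
Qed.

Definition delay_point (u : R) : delay_itv r := SigSub (clamp_delay_itv u).

Lemma val_delay_point u : - r <= u <= 0 -> \val (delay_point u) = u.
Proof. by move=> /andP[ru u0]; exact: clamp_in. Qed.

Lemma delay_itvP (th : delay_itv r) : - r <= \val th <= 0.
Proof. by case: th => u hu; move: (set_mem hu); rewrite /delay_itv/= in_itv. Qed.

Lemma delay_pointK (th : delay_itv r) : delay_point (\val th) = th.
Proof. by apply/val_inj; rewrite val_delay_point// delay_itvP. Qed.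

(** The extension of a function on [[-r, 0]] to the line by constants. *)
Definition extend (phi : delay_itv r -> 'cV[R]_n) (u : R) := phi (delay_point u).

Lemma extend_continuous phi : continuous (extend phi).
Proof.
move=> u; apply: (@continuous_comp _ _ _ delay_point); last exact: cts_fun.
move: u; apply: continuous_comp_initial => u.
change {for u, continuous (fun u => clamp (- r) 0 u)}.
apply: (@continuous_max _ _ (fun=> - r)); first exact: cvg_cst.
by apply: (@continuous_min _ _ (fun=> 0)); [exact: cvg_cst|exact: cvg_id].
Qed.

Lemma segment_continuous x t : continuous x -> continuous (segment (r := r) x t).
Proof.
move=> cx th; apply: (@continuous_comp _ _ _ (\val : delay_itv r -> R)
  (fun u => x (t + u))); first exact: (@initial_continuous _ _ (\val : delay_itv r -> R)).
move: (\val th); apply/continuous_enormP => u e e0.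
have /continuous_enormP/(_ (t + u) e e0)[d d0 hd] := cx.
by exists d => // v vu; apply: hd; rewrite opprD addrACA subrr add0r.
Qed.

Definition cseg x (cx : continuous x) t : C := mkcts (segment_continuous (t := t) cx).

Lemma has_sup_enorm phi : has_sup (range (fun th => enorm (phi th))).
Proof.
have [c c0 hc] := continuous_bounded (- r) 0 (@extend_continuous phi).
split; first by exists (enorm (phi (delay_point 0))); exists (delay_point 0).
exists c => _ [th _ <-]; rewrite -(delay_pointK th); apply: hc.
exact: delay_itvP.
Qed.

Lemma supnorm_ge phi th : enorm (phi th) <= supnorm phi.
Proof. by apply: ub_le_sup; [exact: (has_sup_enorm phi).2|exists th]. Qed.

Lemma supnorm_le phi c : (forall th, enorm (phi th) <= c) -> supnorm phi <= c.
Proof.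
move=> h; apply: ge_sup; first exact: (has_sup_enorm phi).1.
by move=> _ [th _ <-].
Qed.

Lemma supnorm_ge0 phi : 0 <= supnorm phi.
Proof. exact: le_trans (enorm_ge0 _) (supnorm_ge phi (delay_point 0)). Qed.

End delay_segments.

Section stieltjes_integral_theory.
Context (R : realType) (r : R) (n : nat) (r0 : 0 < r) (G : R -> 'M[R]_n).
Notation C := (continuousType (delay_itv r) 'cV[R]_n).
Implicit Types (phi psi : C) (I J : 'cV[R]_n).

Let r00 : - r < 0. Proof. by rewrite oppr_lt0. Qed.

Lemma stieltjes_sumE phi p xi : stieltjes_sum G phi p xi =
  rs_sum G (extend r0 phi) (- r) p (fun i => \val (xi i)).
Proof. by apply: eq_bigr => i _; rewrite /extend delay_pointK. Qed.

Lemma exists_tagged_partition (d : R) : 0 < d -> exists p (xi : nat -> delay_itv r),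
  tagged_partition p xi /\ mesh_lt r p d.
Proof.
move=> d0; have [p ip mp] := fine_partition r00 d0.
exists p, (fun i => delay_point r0 (points (- r) p i)); split=> //; split=> // i ip'.
rewrite val_delay_point.
  by rewrite lexx/=; exact: (points_le ip (leqnSn i)).
apply/andP; split; first exact: (points_le ip (leq0n i) (ltnW ip')).
by have := points_le ip (ltnW ip') (leqnn _); rewrite (points_last ip).
Qed.

Lemma stieltjes_unique phi I J : is_stieltjes_integral G phi I ->
  is_stieltjes_integral G phi J -> I = J.
Proof.
move=> hI hJ; apply/eqP; rewrite -subr_eq0; apply/eqP/enorm_eq0/ler_addgt0Pr => e e0.
have [d1 d10 h1] := hI _ (divr_gt0 e0 (ltr0n _ 2)).
have [d2 d20 h2] := hJ _ (divr_gt0 e0 (ltr0n _ 2)).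
have [|p [xi [tp mp]]] := @exists_tagged_partition (Num.min d1 d2).
  by rewrite lt_min d10.
have m1 : mesh_lt r p d1.
  by move=> i /mp; rewrite lt_min => /andP[].
have m2 : mesh_lt r p d2.
  by move=> i /mp; rewrite lt_min => /andP[].
have := h1 p xi tp m1; have := h2 p xi tp m2.
have := enorm_dist (stieltjes_sum G phi p xi) I J; rewrite (enormBC I (stieltjes_sum _ _ _ _)) add0r => h3 h4 h5.
lra.
Qed.

Lemma stieltjes_exists phi :
  (forall i j, bounded_variation (- r) 0 (fun th => G th i j)) ->
  exists I, is_stieltjes_integral G phi I.
Proof.
move=> bv; have [V dV] := bounded_variation_dominated r00 bv.
have [V0 _] := dV (- r) 0 (lexx _) (ltW r00) (lexx _).
pose c := V 0 - V (- r) + 1.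
have c0 : 0 < c by rewrite ltr_wpDl// subr_ge0.
have close (e : R) : 0 < e -> exists2 d, 0 < d & forall p xi q zeta,
    tagged_partition p xi -> mesh_lt r p d ->
    tagged_partition q zeta -> mesh_lt r q d ->
    enorm (stieltjes_sum G phi p xi - stieltjes_sum G phi q zeta) < e.
  move=> e0; have ec : 0 < e / c by rewrite divr_gt0.
  have [d d0 hd] := uniform_continuity (@extend_continuous _ _ _ r0 phi) (ltW r00) ec.
  exists (d / 2); first by rewrite divr_gt0.
  move=> p xi q zeta tp mp tq mq; rewrite !stieltjes_sumE.
  apply: le_lt_trans (@rs_sum_compare _ _ _ (- r) 0 V _ (e / c) (d / 2) p q _ _ dV tp tq mp mq (ltW ec) _) _.
    move=> x y _ y1 xy; apply/ltW/hd => //; apply: lt_le_trans xy _; lra.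
  by rewrite mulrC mulrAC ltr_pdivrMr// ltr_pM2l// ltrDl.
have hk k : exists p (xi : nat -> delay_itv r),
    tagged_partition p xi /\ mesh_lt r p k.+1%:R^-1.
  by apply: exists_tagged_partition; rewrite invr_gt0.
have hk' k : exists q : seq R * (nat -> delay_itv r),
    tagged_partition q.1 q.2 /\ mesh_lt r q.1 k.+1%:R^-1.
  by have [p [xi h]] := hk k; exists (p, xi).
have [Q hQ] := choice hk'.
pose S k := stieltjes_sum G phi (Q k).1 (Q k).2.
have fine (d : R) : 0 < d -> exists K, forall k, (K <= k)%N -> mesh_lt r (Q k).1 d.
  move=> d0; exists (Num.truncn d^-1) => k Kk i ik.
  apply: lt_le_trans ((hQ k).2 i ik) _.
  rewrite invf_ple ?posrE//; apply/ltW/(lt_le_trans (truncnS_gt _)).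
  by rewrite ler_nat ltnS.
have cvgS : cvgn S.
  apply/cauchy_cvgP/cauchy_exP => e e0.
  have [d d0 hd] := close e e0; have [K hK] := fine d d0.
  exists (S K); exists K => // k /= Kk.
  rewrite -[ball _ _ _]/(ball (S K) e (S k)) -ball_normE/=.
  apply: le_lt_trans (normr_le_enorm _) _.
  by apply: hd; [exact: (hQ K).1|exact: hK|exact: (hQ k).1|exact: hK].
exists (limn S) => e e0; have e20 : 0 < e / 2 by rewrite divr_gt0.
have [d d0 hd] := close _ e20; exists d => // p xi tp mp.
have [K hK] := fine d d0.
have /cvg_enorm/(_ _ e20)[K' _ hK'] := cvgS.
have := hK' (maxn K K'); rewrite /= leq_maxr => /(_ isT) h1.
rewrite (splitr e); apply: le_lt_trans (enorm_dist (S (maxn K K')) _ _) _.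
apply: ltrD => //; apply: hd => //; first exact: (hQ _).1.
by apply: hK; rewrite leq_maxl.
Qed.

Lemma is_stieltjesDZ phi psi I J c : is_stieltjes_integral G phi I ->
  is_stieltjes_integral G psi J ->
  is_stieltjes_integral G (fun th => phi th + c *: psi th) (I + c *: J).
Proof.
move=> hI hJ e e0; have c0 : 0 < 2 * (`|c| + 1) by rewrite mulr_gt0// ltr_wpDl.
have [d1 d10 h1] := hI _ (divr_gt0 e0 (ltr0n _ 2)).
have [d2 d20 h2] := hJ _ (divr_gt0 e0 c0).
exists (Num.min d1 d2); first by rewrite lt_min d10.
move=> p xi tp mp.
have m1 : mesh_lt r p d1 by move=> i /mp; rewrite lt_min => /andP[].
have m2 : mesh_lt r p d2 by move=> i /mp; rewrite lt_min => /andP[].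
have -> : stieltjes_sum G (fun th => phi th + c *: psi th) p xi =
    stieltjes_sum G phi p xi + c *: stieltjes_sum G psi p xi.
  rewrite /stieltjes_sum scaler_sumr -big_split/=; apply: eq_bigr => i _.
  by rewrite mulmxDr scalemxAr.
rewrite opprD addrACA -scalerBr; apply: le_lt_trans (enormD _ _) _.
rewrite enormZ (splitr e); apply: ltr_leD; first exact: h1.
apply: (@le_trans _ _ ((`|c| + 1) * (e / (2 * (`|c| + 1))))).
  apply: ler_pM; rewrite ?lerDl ?enorm_ge0//; exact/ltW/h2.
by rewrite [leLHS](_ : _ = e / 2)//; field; rewrite gt_eqF// ltr_wpDl.
Qed.

Lemma is_stieltjes_cst (v : 'cV[R]_n) :
  is_stieltjes_integral (r := r) G (fun=> v) ((G 0 - G (- r)) *m v).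
Proof.
move=> e e0; exists 1 => // p xi [ip _] _.
rewrite /stieltjes_sum -mulmx_suml.
rewrite -(big_mkord xpredT (fun i => G (points (- r) p i.+1) - G (points (- r) p i))).
by rewrite telescope_sumr// (points_last ip) subrr enorm0.
Qed.

End stieltjes_integral_theory.

(** * The delay functional *)

Section lebesgue_measurability.
Context (R : realType) (n : nat).

Lemma borel_lebesgue (f : R -> R) : measurable_fun [set: R] f ->
  measurable_fun [set: lebesgueR R] (f : lebesgueR R -> R).
Proof.
move=> mf _ Y mY; rewrite setTI; apply: sub_caratheodory.
by have := mf measurableT Y mY; rewrite setTI.
Qed.

Lemma continuous_lmeasurable (x : R -> 'cV[R]_n) : continuous x -> lmeasurable x.
Proof.
move=> cx i; apply: borel_lebesgue; apply: continuous_measurable_fun => t.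
apply: (@continuous_comp _ _ _ x (fun v : 'cV[R]_n => v i ord0)); first exact: cx.
exact: coord_continuous.
Qed.

Lemma lmeasurable_limit (F : nat -> R -> 'cV[R]_n) (f : R -> 'cV[R]_n) :
  (forall k, lmeasurable (F k)) -> (forall t, F ^~ t @ \oo --> f t) -> lmeasurable f.
Proof.
move=> mF Ff i; apply: (@measurable_fun_cvg _ (lebesgueR R) R setT (fun k t => F k t i ord0)
  (fun t => f t i ord0)).
  by move=> k; exact: mF.
move=> t _; apply/cvgrPdist_lt => e e0.
have /cvg_enorm/(_ e e0) := Ff t; apply: filterS => k; apply: le_lt_trans.
by rewrite distrC; have := enorm_coord (F k t - f t) i; rewrite !mxE.
Qed.

Lemma lmeasurable_step (F : int -> R -> 'cV[R]_n) (k : R) :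
  (forall j, lmeasurable (F j)) -> lmeasurable (fun t => F (Num.floor (t * k)) t).
Proof.
move=> mF i _ Y mY; rewrite setTI.
rewrite (_ : _ @^-1` Y = \bigcup_j ([set t | Num.floor (t * k) = j] `&`
    (fun t => F j t i ord0) @^-1` Y)); last first.
  apply/seteqP; split=> t /=; first by exists (Num.floor (t * k)).
  by move=> [j _ [/= <-]].
apply: countable_bigcupT_measurable; first exact: countableP.
move=> j; apply: measurableI; last first.
  by have := mF j i measurableT Y mY; rewrite setTI.
have mfl : measurable_fun [set: R] (fun t : R => t * k).
  by apply: measurable_funM => //; exact: measurable_cst.
have := borel_lebesgue mfl measurableT (measurable_itv `[j%:~R, (j + 1)%:~R[).
rewrite setTI; congr (measurable _); apply/seteqP; split=> t /=; rewrite in_itv/=.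
  by rewrite -floor_eq => /eqP.
by move=> /eqP; rewrite floor_eq.
Qed.

End lebesgue_measurability.

Section delay_functional.
Context (R : realType) (r : R) (n : nat) (r0 : 0 < r) (eta : R -> R -> 'M[R]_n).
Context (eta_std : standing_assumptions r eta) (M : R) (M0 : 0 < M).
Context (normM : (ereal_sup (range (normL r eta)) <= M%:E)%E).
Context (A : R -> 'M[R]_n) (etaA : forall t th, th <= - r -> eta t th = - A t).
Notation C := (continuousType (delay_itv r) 'cV[R]_n).
Implicit Types (phi psi : C) (x : R -> 'cV[R]_n) (t c : R).

Lemma delayL_spec t phi : is_stieltjes_integral (eta t) phi (delayL eta t phi).
Proof.
have [I hI] := stieltjes_exists r0 phi (eta_bounded_variation eta_std t).
by rewrite /delayL /stieltjes_integral; case: xgetP => [J _ //|/(_ I)].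
Qed.

Lemma delayL_unique t phi I : is_stieltjes_integral (eta t) phi I ->
  delayL eta t phi = I.
Proof. by move=> hI; apply: (stieltjes_unique r0 _ hI); exact: delayL_spec. Qed.

Lemma delayL_cst t (v : 'cV[R]_n) : delayL eta t (fun _ : delay_itv r => v) = A t *m v.
Proof.
have cv : continuous (fun _ : R => v) by move=> u; exact: cvg_cst.
rewrite -[LHS]/(delayL eta t (cseg r cv 0)); apply: delayL_unique.
have := is_stieltjes_cst r (eta t) v.
by rewrite (eta_right eta_std)// (etaA t (lexx _)) opprK add0r.
Qed.

Lemma delayL_bound t phi : enorm (delayL eta t phi) <= M * supnorm phi.
Proof.
have h1 psi : supnorm psi <= 1 -> enorm (delayL eta t psi) <= M.
  move=> psi1; rewrite -lee_fin; apply: le_trans normM.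
  apply: (@le_trans _ _ (normL r eta t)); last by apply: ereal_sup_ubound; exists t.
  by apply: ereal_sup_ubound; exists psi.
apply/ler_addgt0Pr => e e0; pose c := supnorm phi + e / M.
have c0 : 0 < c by rewrite ltr_wpDl ?divr_gt0// supnorm_ge0.
have := h1 (c^-1 *: phi); have -> : delayL eta t (c^-1 *: phi) = c^-1 *: delayL eta t phi.
  have hz : is_stieltjes_integral (eta t) (0 : C) 0.
    have := is_stieltjes_cst r (eta t) 0; rewrite mulmx0; exact.
  have := is_stieltjesDZ c^-1 hz (delayL_spec t phi); rewrite add0r => h2.
  apply: delayL_unique; move: h2; congr is_stieltjes_integral.
  by apply/funext => th; rewrite /= add0r.
rewrite enormZ gtr0_norm ?invr_gt0// ler_pdivrMl// mulrC /c mulrDr mulrCA divff ?gt_eqF// mulr1.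
apply; apply: supnorm_le => // th.
rewrite -[_ th]/(c^-1 *: phi th) enormZ gtr0_norm ?invr_gt0// ler_pdivrMl// mulr1.
by apply: le_trans (supnorm_ge r0 phi th) _; rewrite lerDl ltW// divr_gt0.
Qed.

Definition delayLam x t := delayL eta t (segment (r := r) x t).

Lemma delayL_linear t phi psi c :
  delayL eta t (fun th => phi th + c *: psi th) = delayL eta t phi + c *: delayL eta t psi.
Proof.
rewrite -[LHS]/(delayL eta t (phi + c *: psi)); apply: delayL_unique.
exact: is_stieltjesDZ (delayL_spec _ _) (delayL_spec _ _).
Qed.

Lemma delayLam_cst x t : delayLam (fun=> x t) t = A t *m x t.
Proof. exact: delayL_cst. Qed.

Lemma delayL_cseg_dist x (cx : continuous x) t s s' c : 0 <= c ->
  (forall th, - r <= th <= 0 -> enorm (x (s + th) - x (s' + th)) <= c) ->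
  enorm (delayL eta t (cseg r cx s) - delayL eta t (cseg r cx s')) <= M * c.
Proof.
move=> c0 h; rewrite -scaleN1r -delayL_linear.
rewrite -[X in delayL eta t X]/((cseg r cx s + -1 *: cseg r cx s' : C) : delay_itv r -> _).
apply: le_trans (delayL_bound _ _) _; rewrite ler_wpM2l ?(ltW M0)//.
apply: supnorm_le => // th; rewrite scaleN1r.
exact: h (delay_itvP th).
Qed.

(** [t |-> L t x_t] is the pointwise limit of the functions [t |-> L t x_(s t)]
    where [s t] is [t] rounded down to a multiple of [1 / k]; these are
    measurable because [s] takes countably many values. *)
Lemma delayLam_measurable x : continuous x -> lmeasurable (delayLam x).
Proof.
move=> cx; pose s k (j : int) : R := j%:~R / k.+1%:R.
pose F k t := delayL eta t (cseg r cx (s k (Num.floor (t * k.+1%:R)))).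
apply: (@lmeasurable_limit _ _ F).
  move=> k; apply: (@lmeasurable_step _ _ (fun j t => delayL eta t (cseg r cx (s k j)))).
  by move=> j i; exact: delayL_measurable eta_std _ i.
move=> t; apply/cvg_enorm => e e0.
have e1 : 0 < e / (2 * M) by rewrite divr_gt0// mulr_gt0.
have [|d d0 hd] := @uniform_continuity _ _ x (t - r) t _ cx _ e1.
  by rewrite gerBl ltW.
exists (Num.truncn d^-1) => // k /= Kk; rewrite /F.
rewrite -[delayLam x t]/(delayL eta t (cseg r cx t)).
apply: (@le_lt_trans _ _ (M * (e / (2 * M)))); last first.
  by rewrite invfM mulrCA (mulrCA M) divff ?gt_eqF// mulr1 ltr_pdivrMr// ltr_pMr// ltr1n.
apply: delayL_cseg_dist; first exact: ltW.
move=> th /andP[th1 th2]; apply/ltW/hd.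
  by apply/andP; split; lra.
rewrite opprD addrACA subrr addr0 /s.
have k0 : 0 < k.+1%:R :> R by rewrite ltr0n.
have /andP[f1 f2] := floor_itv (t * k.+1%:R).
have dk : d^-1 < k.+1%:R by apply: lt_le_trans (truncnS_gt _) _; rewrite ler_nat ltnS.
rewrite intrD mulr1z in f2; set m := Num.floor _ in f1 f2 *.
have : k.+1%:R^-1 < d by rewrite invf_plt ?posrE.
apply: le_lt_trans; rewrite -[t in leLHS](mulfK (lt0r_neq0 k0)) -mulrBl normrM.
rewrite (gtr0_norm (x := _^-1)) ?invr_gt0// ler_piMl ?invr_ge0 ?ltW//.
by rewrite ltr_norml; apply/andP; split; lra.
Qed.

Lemma delayLam_causal : causal r M delayLam.
Proof.
split.
- move=> x y c t cx cy; exact: (delayL_linear t (cseg r cx t) (cseg r cy t) c).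
- move=> x t c cx c0 h; rewrite /delayLam.
  apply: le_trans (delayL_bound t (cseg r cx t)) _; rewrite ler_wpM2l ?(ltW M0)//.
  apply: supnorm_le => // th; have /andP[h1 h2] := delay_itvP th.
  by apply: h; apply/andP; split; lra.
exact: delayLam_measurable.
Qed.

Lemma A_bound t (v : 'cV[R]_n) : enorm (A t *m v) <= M * enorm v.
Proof.
have cv : continuous (fun _ : R => v) by move=> u; exact: cvg_cst.
rewrite -delayL_cst -[X in delayL eta t X]/(cseg r cv 0 : _ -> _).
apply: le_trans (delayL_bound _ _) _; rewrite ler_wpM2l ?(ltW M0)//.
exact: supnorm_le.
Qed.

Lemma ode_causal : causal 0 M (fun x t => A t *m x t).
Proof.
split.
- by move=> x y c t _ _; rewrite mulmxDr scalemxAr.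
- move=> x t c _ _ h; apply: le_trans (A_bound _ _) _.
  by rewrite ler_wpM2l ?(ltW M0)// h// lexx subr0 lexx.
move=> x cx i; rewrite (_ : (fun t => _) = (fun t => \sum_j A t i j * x t j ord0)); last first.
  by apply/funext => t; rewrite mxE.
apply: measurable_sum => j; apply: measurable_funM; last exact: continuous_lmeasurable.
have cv : continuous (fun _ : R => delta_mx j ord0 : 'cV[R]_n) by move=> u; exact: cvg_cst.
have := delayL_measurable eta_std (cseg r cv 0) i.
congr measurable_fun; apply/funext => t.
rewrite -[delayL _ _ _]/(delayL eta t (fun=> delta_mx j ord0)) delayL_cst.
rewrite mxE (bigD1 j)//= big1 ?addr0 => [|k kj]; rewrite mxE ?eqxx ?mulr1//.
by rewrite (negPf kj) mulr0.
Qed.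

End delay_functional.

(** * The evolution operator of the ordinary equation *)

Section operator_norm.
Context (R : realType) (V W : lmodType R) (NV : V -> R) (NW : W -> R).
Hypothesis NV_ge0 : forall v, 0 <= NV v.
Hypothesis NVZ : forall a v, NV (a *: v) = `|a| * NV v.
Hypothesis NWZ : forall a w, NW (a *: w) = `|a| * NW w.

Lemma opnorm_bound (f : V -> W) (c : R) v : (forall a v, f (a *: v) = a *: f v) ->
  (opnorm NV NW f <= c%:E)%E -> NW (f v) <= c * NV v.
Proof.
move=> fZ fc.
have h1 u : NV u <= 1 -> NW (f u) <= c.
  move=> u1; rewrite -lee_fin; apply: le_trans fc.
  by apply: ereal_sup_ubound; exists u.
have c0 : 0 <= c.
  have := h1 0; rewrite -(scale0r 0) NVZ fZ NWZ normr0 !mul0r; exact.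
apply/ler_addgt0Pr => e e0; pose d := NV v + e / (c + 1).
have c1 : 0 < c + 1 by rewrite ltr_wpDl.
have d0 : 0 < d by rewrite ltr_wpDl ?divr_gt0.
have := h1 (d^-1 *: v); rewrite fZ NVZ NWZ gtr0_norm ?invr_gt0//.
rewrite ler_pdivrMl// mulr1 ler_pdivrMl// mulrC /d lerDl ltW ?divr_gt0//.
move=> /(_ isT) h2; apply: le_trans h2 _; rewrite mulrDr lerD2l.
by rewrite mulrCA ler_piMr ?(ltW e0)// ler_pdivrMr// mul1r lerDl.
Qed.

Lemma le_opnorm (f : V -> W) (c : R) : 0 <= c ->
  (forall v, NW (f v) <= c * NV v) -> (opnorm NV NW f <= c%:E)%E.
Proof.
move=> c0 fc; apply: ge_ereal_sup => _ [v /= v1 <-]; rewrite lee_fin.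
by apply: le_trans (fc v) _; rewrite -[leRHS]mulr1 ler_wpM2l.
Qed.

End operator_norm.

Section increments.
Context (R : realType) (n : nat).
Implicit Types (a b c e : R).

Lemma expR_small c k e : 0 < k -> 0 < e ->
  exists2 x : R, 0 <= x & c * expR (- (k * x)) <= e.
Proof.
move=> k0 e0; exists (`|c| / (e * k)); first by rewrite divr_ge0// mulr_ge0// ltW.
rewrite expRN ler_pdivrMr ?expR_gt0//.
apply: le_trans (ler_wpM2l (ltW e0) (expR_ge1Dx _)).
rewrite mulrDr mulr1; apply: le_trans (ler_norm c) _.
have -> : e * (k * (`|c| / (e * k))) = `|c| by field; rewrite !gt_eqF.
by rewrite lerDr ltW.
Qed.

(** The increments need to be controlled up to a factor that tends to [1] and
    up to second order only, because the interval can be cut into short pieces. *)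
Lemma increment_le (F : R -> 'cV[R]_n) (H : R -> R) (k C a b : R) : a <= b ->
  (forall u v, a <= u -> u <= v -> v <= b -> H u <= H v) ->
  (forall u v, a <= u -> u <= v -> v <= b ->
     enorm (F v - F u) <= expR (k * (v - u)) * (H v - H u) + C * (v - u) ^+ 2) ->
  enorm (F b - F a) <= H b - H a.
Proof.
move=> ab Hm FH; apply/ler_addgt0Pr => e0 e00.
have Hab : 0 <= H b - H a by rewrite subr_ge0 Hm.
pose D := H b - H a + (b - a) + 1.
have D0 : 0 < D by rewrite /D; lra.
pose e := e0 / D; have e_gt0 : 0 < e by rewrite divr_gt0.
suff : enorm (F b - F a) <= (1 + e) * (H b - H a) + e * (b - a).
  move/le_trans; apply; rewrite mulrDl mul1r -addrA lerD2l -mulrDr.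
  rewrite /e mulrAC ler_pdivrMr// ler_wpM2l ?(ltW e00)//.
  by rewrite /D lerDl.
pose P u v := enorm (F v - F u) <= (1 + e) * (H v - H u) + e * (v - u).
apply: (@cousin _ P a b ab) => [u v w au uv vw wb h1 h2|t /andP[at_ tb]].
  apply: le_trans (enorm_dist (F v) _ _) _.
  by move: h1 h2; rewrite /P; move: (enorm _) (enorm _) => *; lra.
have C0 : 0 < `|C| + 1 by rewrite ltr_wpDl.
have k0 : 0 < `|k| + 1 by rewrite ltr_wpDl.
pose l := ln (1 + e); have l0 : 0 < l by rewrite ln_gt0// ltrDl.
exists (Num.min (l / (`|k| + 1)) (e / (`|C| + 1))).
  by rewrite lt_min !divr_gt0.
move=> u v au ut tv vb; rewrite lt_min => /andP[vu1 vu2].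
have uv := le_trans ut tv; have vu0 : 0 <= v - u by rewrite subr_ge0.
apply: le_trans (FH u v au uv vb) _; apply: lerD.
  apply: ler_wpM2r; first by rewrite subr_ge0 Hm.
  have -> : 1 + e = expR l by rewrite lnK// posrE ltr_wpDl.
  rewrite ler_expR; move: vu1; rewrite ltr_pdivlMr// => /ltW; apply: le_trans.
  by rewrite mulrC ler_wpM2l// (le_trans (ler_norm _))// lerDl.
rewrite expr2 mulrA ler_wpM2r//.
move: vu2; rewrite ltr_pdivlMr// => /ltW; apply: le_trans.
by rewrite mulrC ler_wpM2l// (le_trans (ler_norm _))// lerDl.
Qed.

End increments.

Section ode_evolution_operator.
Context (R : realType) (n : nat) (A : R -> 'M[R]_n) (M : R) (M0 : 0 <= M).
Notation LA := (fun (x : R -> 'cV[R]_n) t => A t *m x t).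
Context (HA : causal 0 M LA).
Implicit Types (x y w : R -> 'cV[R]_n) (s t a b c e : R).
Notation T := (ode_evolution A).
Notation zf := (@zf R n).

Lemma solves_from_clamp s y (g : R -> 'cV[R]_n) : solves_from s y g ->
  continuous (fun u => y (Num.max s u)).
Proof.
move=> [ay _]; apply/continuous_enormP => t e e0.
have [d d0 hd] := ay (Num.max s t + 1) e e0.
have key u v : s <= u -> u <= v -> v <= Num.max s t + 1 -> v - u < d ->
    enorm (y v - y u) < e.
  move=> su uv vb vud; have := hd 1%N (fun=> u) (fun=> v).
  rewrite !big_ord1; apply => // i j; by rewrite !ord1 eqxx.
exists (Num.min d 1); first by rewrite lt_min d0/=.
move=> u; rewrite lt_min ltr_norml => /andP[/andP[h1 h2]]; rewrite ltr_norml => /andP[h3 h4].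
have tb : Num.max s t <= Num.max s t + 1 by rewrite lerDl.
have ub : Num.max s u <= Num.max s t + 1.
  by rewrite /Num.max; case: (ltP s u) => ?; case: (ltP s t) => ?; lra.
have su : s <= Num.max s u by rewrite le_max lexx.
have st : s <= Num.max s t by rewrite le_max lexx.
have [tu|ut] := leP t u.
  have tu' : Num.max s t <= Num.max s u by rewrite ge_max !le_max lexx tu orbT.
  apply: key => //; move: tu'.
  by rewrite /Num.max; case: (ltP s u) => ?; case: (ltP s t) => ?; lra.
have ut' : Num.max s u <= Num.max s t by rewrite ge_max !le_max lexx (ltW ut) orbT.
rewrite enormBC; apply: key => //; move: ut'.
by rewrite /Num.max; case: (ltP s u) => ?; case: (ltP s t) => ?; lra.
Qed.

Lemma ode_evolutionE s t x : s <= t -> sol LA zf s x -> T t s (x s) = x t.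
Proof.
move=> st xs; have cx := xs.1; have sx := (sol_solvesP HA s (integrand0 R n) cx).1 xs.
have sx' : solves_from s x (fun u => A u *m x u).
  by apply: eq_solves_from sx => // u _; rewrite scaler0 addr0.
rewrite /ode_evolution; case: xgetP => [w _ [y [yx sy ->]]|]; last first.
  by move=> /(_ (x t)) []; exists x.
pose z u := y (Num.max s u).
have cz : continuous z by exact: solves_from_clamp sy.
have zy u : s <= u -> z u = y u by move=> su; rewrite /z max_r.
have sz : solves_from s z (fun u => A u *m z u + 1 *: zf u).
  apply: eq_solves_from sy => u su; first by rewrite zy.
  by rewrite zy// scaler0 addr0.
rewrite -zy//; apply: (sol_unique (lexx 0) M0 HA (integrand0 R n) _ xs _ st).
  exact/(sol_solvesP HA s (integrand0 R n) cz).
by move=> u; rewrite subr0 => /le_anti <-; rewrite zy.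
Qed.

Lemma ode_sol_exists s (v : 'cV[R]_n) : exists x, x s = v /\ sol LA zf s x.
Proof.
have cv : continuous (fun _ : R => v) by move=> u; exact: cvg_cst.
have [|x [xs hx]] := sol_exists (lexx 0) M0 HA s (integrand0 R n) cv (cf := 0).
  by move=> t; rewrite enorm0.
by exists x; split => //; rewrite xs.
Qed.

Lemma ode_evolution_refl s (v : 'cV[R]_n) : T s s v = v.
Proof. by have [x [<- hx]] := ode_sol_exists s v; rewrite (ode_evolutionE _ hx). Qed.

Lemma ode_evolution_cocycle a b c (v : 'cV[R]_n) : a <= b -> b <= c -> T c b (T b a v) = T c a v.
Proof.
move=> ab bc; have [x [<- hx]] := ode_sol_exists a v.
rewrite (ode_evolutionE ab hx) (ode_evolutionE (le_trans ab bc) hx).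
by rewrite (ode_evolutionE bc)//; exact: (solS HA (integrand0 R n) ab).
Qed.

Lemma ode_evolutionDZ a b c (v v' : 'cV[R]_n) : a <= b ->
  T b a (v + c *: v') = T b a v + c *: T b a v'.
Proof.
move=> ab; have [x [<- hx]] := ode_sol_exists a v.
have [y [<- hy]] := ode_sol_exists a v'.
have := solDZ0 HA c hx hy => hxy.
by rewrite (ode_evolutionE ab hx) (ode_evolutionE ab hy) -(ode_evolutionE ab hxy).
Qed.

Lemma ode_evolutionB a b (v v' : 'cV[R]_n) : a <= b -> T b a (v - v') = T b a v - T b a v'.
Proof.
move=> ab; rewrite -[- v']scaleN1r -[- T b a v']scaleN1r; exact: ode_evolutionDZ.
Qed.

Lemma ode_evolutionZ a b c (v : 'cV[R]_n) : a <= b -> T b a (c *: v) = c *: T b a v.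
Proof.
move=> ab; have h0 : T b a 0 = 0.
  by have := ode_evolutionB 0 0 ab; rewrite !subrr.
by have := ode_evolutionDZ c 0 v ab; rewrite h0 !add0r.
Qed.

(** This applies to the curve formed by the backward and forward images of a
    vector in the kernel of a projection of the dichotomy. *)
Lemma ode_evolution_sol (u : R -> 'cV[R]_n) : (forall s t, s <= t -> u t = T t s (u s)) ->
  forall s, sol LA zf s u.
Proof.
move=> hu; have cu : continuous u.
  move=> t; have [x [xs hx]] := ode_sol_exists (t - 1) (u (t - 1)).
  have xu s : t - 1 <= s -> x s = u s.
    by move=> ts; rewrite (hu _ _ ts) -xs (ode_evolutionE ts hx).
  apply/cvg_enorm => e e0.
  have /continuous_enormP/(_ t e e0)[d d0 hd] := hx.1.
  apply/nbhs_ballP; exists (Num.min d 1) => /=; first by rewrite lt_min d0/=.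
  move=> s; rewrite /ball/= lt_min distrC => /andP[/hd + h2].
  rewrite !xu//; first by rewrite gerBl.
  by move: h2; rewrite ltr_norml => /andP[h2 _]; lra.
move=> s; split => // t st; have [x [xs hx]] := ode_sol_exists s (u s).
have xu p : s <= p -> x p = u p.
  by move=> sp; rewrite (hu _ _ sp) -xs (ode_evolutionE sp hx).
rewrite -!xu// hx.2//; apply: eq_integ => //.
- exact: (sol_integrand HA (integrand0 R n) hx.1).
- exact: (sol_integrand HA (integrand0 R n) cu).
by move=> p /andP[sp _]; rewrite xu.
Qed.

(** The variation of constants formula to first order. Over short steps this is
    all that the estimates use, and it avoids integrating the evolution operator
    against the forcing. *)
Lemma duhamel a b w g c B : a <= b -> (forall s, sol LA g s w) -> integrand g ->
  (forall t, a <= t <= b -> enorm (w t) <= B) ->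
  (forall t, a <= t <= b -> enorm (g t) <= c) -> exists2 C, 0 <= C &
  forall u v e, a <= u -> u <= v -> v <= b -> 0 <= e ->
    (forall t, u <= t <= v -> enorm (g t) <= e) ->
    enorm (w v - T v u (w u)) <= C * (v - u) ^+ 2 + e * (v - u).
Proof.
move=> ab hw gi wB gc.
have B0 : 0 <= B by apply: le_trans (wB a _); [exact: enorm_ge0|rewrite lexx].
have c0 : 0 <= c by apply: le_trans (gc a _); [exact: enorm_ge0|rewrite lexx].
pose B' := B + 3 * B * expR ((2 * M + 1) * (b - a)).
have B'0 : 0 <= B' by rewrite addr_ge0// !mulr_ge0// expR_ge0.
exists (M * (M * B' + c)); first by rewrite mulr_ge0// addr_ge0// mulr_ge0.
move=> u v e au uv vb e0 ge.
have [x [xu hx]] := ode_sol_exists u (w u).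
rewrite -xu (ode_evolutionE uv hx).
have hd : sol LA g u (fun t => w t + -1 *: x t).
  apply: eq_sol (solDZ HA (-1) gi (integrand0 R n) (hw u) hx) => //.
  - exact: HA.
  - exact: integrandD gi (integrand0 R n).
  - by move=> t _; rewrite scaler0 addr0.
set d := (fun t => _) in hd.
have du : d u = 0 by rewrite /d xu scaleN1r subrr.
have gd := sol_integrand HA gi hd.1.
have dB t : u <= t -> t <= v -> enorm (d t) <= B'.
  move=> ut tv; rewrite /d scaleN1r; apply: le_trans (enormB _ _) _; apply: lerD.
    by apply: wB; rewrite (le_trans au)// (le_trans tv).
  apply: le_trans (growth (lexx 0) M0 HA hx ut B0 _) _.
    by move=> p; rewrite subr0 => /le_anti <-; rewrite xu wB// au (le_trans uv).
  rewrite ler_wpM2l ?mulr_ge0// ler_expR ler_wpM2l ?addr_ge0 ?mulr_ge0//; lra.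
have d1 t : u <= t -> t <= v -> enorm (d t) <= (M * B' + c) * (t - u).
  move=> ut tv; rewrite -[d t]subr0 -du hd.2//.
  apply: integ_le_cst => //; first by rewrite addr_ge0// mulr_ge0.
  move=> p /andP[up pt]; rewrite scale1r; apply: le_trans (enormD _ _) _.
  apply: lerD; last by apply: gc; rewrite (le_trans au up) (le_trans pt) ?(le_trans tv).
  apply: (causal_bound HA hd.1) => // q; rewrite subr0 => /le_anti <-.
  by apply: dB => //; exact: le_trans tv.
rewrite -[w v - x v](_ : d v - d u = _); last by rewrite du /d scaleN1r subr0.
rewrite hd.2// [leRHS](_ : _ = (M * ((M * B' + c) * (v - u)) + e) * (v - u)); last by ring.
have k0 : 0 <= (M * B' + c) * (v - u).
  by rewrite mulr_ge0 ?subr_ge0// addr_ge0// mulr_ge0.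
apply: integ_le_cst => //; first by rewrite addr_ge0// mulr_ge0.
move=> p /andP[up pv]; rewrite scale1r; apply: le_trans (enormD _ _) _.
apply: lerD; last by apply: ge; rewrite up.
apply: (causal_bound HA hd.1) => // q; rewrite subr0 => /le_anti <-.
apply: le_trans (d1 p up pv) _; rewrite ler_wpM2l ?lerD2r//.
by rewrite addr_ge0// mulr_ge0.
Qed.

End ode_evolution_operator.

(** * Bounded solutions of the forced ordinary equation: estimates *)

Section ode_green.
Context (R : realType) (n : nat) (A : R -> 'M[R]_n) (M : R) (M0 : 0 <= M).
Notation LA := (fun (x : R -> 'cV[R]_n) t => A t *m x t).
Context (HA : causal 0 M LA).
Implicit Types (x y w g : R -> 'cV[R]_n) (s t a b c e : R).
Notation T := (ode_evolution A).
Notation zf := (@zf R n).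
Context (P : R -> {linear 'cV[R]_n -> 'cV[R]_n}) (al K : R).
Context (al0 : 0 < al) (K0 : 0 < K) (dich : dichotomy_with (@enorm R n) T P al K).

Lemma ode_proj_idem t (v : 'cV[R]_n) : P t (P t v) = P t v.
Proof. by have [/(_ t)[_ ->]] := dich. Qed.

Lemma ode_proj_comm t s (v : 'cV[R]_n) : s <= t -> T t s (P s v) = P t (T t s v).
Proof. by move=> st; have [_ ->] := dich. Qed.

Lemma ode_stable_bound t s (v : 'cV[R]_n) : s <= t ->
  enorm (T t s (P s v)) <= K * expR (- al * (t - s)) * enorm v.
Proof.
move=> st; have [_ _ _ /(_ t s st) h _] := dich.
apply: (opnorm_bound (@enorm_ge0 R n) (@enormZ R n) (@enormZ R n) v _ h).
by move=> a u; rewrite linearZ/= (ode_evolutionZ M0 HA).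
Qed.

Lemma ode_ker_inj t s (v w : 'cV[R]_n) : t <= s -> P t v = 0 -> P t w = 0 ->
  T s t v = T s t w -> v = w.
Proof.
move=> ts v0 w0; have [_ _ /(_ s t ts)[_ inj _] _ _] := dich.
by apply: inj; apply/mem_set.
Qed.

Lemma ode_backward t s (v : 'cV[R]_n) : t <= s -> exists u, [/\ P t u = 0,
  T s t u = v - P s v & enorm u <= K * expR (- al * (s - t)) * enorm v].
Proof.
move=> ts; have [_ _ /(_ s t ts) bij _ /(_ t s ts) h] := dich.
pose bk (v : 'cV[R]_n) := backward T P t s (v - P s v).
have ks u : ker (P s) (u - P s u) by rewrite /ker/= linearB/= ode_proj_idem subrr.
have [_ inj surj] := bij.
have bkP u : ker (P t) (bk u).
  by have [+ _ _] := bijpinv_bij (fun=> 0) bij; apply.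
have bkE u : T s t (bk u) = u - P s u.
  by rewrite /bk /backward (surjpK _ surj)//; exact/mem_set.
exists (bk v); split; [exact: bkP|exact: bkE|].
apply: (opnorm_bound (@enorm_ge0 R n) (@enormZ R n) (@enormZ R n) (f := bk) v _ h).
move=> a u; apply: (ode_ker_inj ts); first exact: bkP.
  by rewrite linearZ/= (bkP u) scaler0.
by rewrite (ode_evolutionZ M0 HA)// !bkE linearZ/= scalerBr.
Qed.

Lemma weight_shift b s t u : 0 <= b ->
  expR (- b * `|u - s|) <= expR (- b * `|t - s|) * expR (b * `|t - u|).
Proof.
move=> b0; rewrite -expRD ler_expR !mulNr lerNl opprD opprK -mulrBr ler_wpM2l//.
rewrite lerBlDr; apply: le_trans (ler_normD _ _).
by rewrite [u - s + _]addrC addrA subrK.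
Qed.

Section a_priori.
Context (w g : R -> 'cV[R]_n) (B c b s : R).
Context (hw : forall a, sol LA g a w) (gi : integrand g).
Context (wB : forall t, enorm (w t) <= B).
Context (c0 : 0 <= c) (b0 : 0 <= b) (ba : b < al).
Context (gc : forall t, enorm (g t) <= c * expR (- b * `|t - s|)).
Let W t := expR (- b * `|t - s|).
Let B0 : 0 <= B. Proof. exact: le_trans (enorm_ge0 _) (wB 0). Qed.
Let W0 t : 0 < W t. Proof. exact: expR_gt0. Qed.
Let ba0 : 0 < al - b. Proof. by rewrite subr_gt0. Qed.

Let gc1 t : enorm (g t) <= c.
Proof.
apply: le_trans (gc t) _; rewrite ler_piMr// -expR0 ler_expR.
by rewrite mulNr oppr_le0 mulr_ge0.
Qed.

(** The stable part of [w t] is the integral of [T t u (P u (g u))] over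
    [u <= t]: the curve [T t u (P u (w u))] has this integrand as derivative and
    tends to [0] for [u] tending to [-oo]. *)
Lemma a_priori_stable t : enorm (P t (w t)) <= K * c / (al - b) * W t.
Proof.
apply/ler_addgt0Pr => e e0.
have [x x0 hx] := expR_small (K * B) al0 e0.
pose a := t - x; have at_ : a <= t by rewrite gerBl.
pose F u := T t u (P u (w u)).
(* A primitive of the bound [K c W t exp ((al - b) (u - t))] for the integrand. *)
pose H u := K * c / (al - b) * W t * expR ((al - b) * (u - t)).
have H0 u : 0 <= H u by rewrite !mulr_ge0 ?expR_ge0// ?invr_ge0 ltW.
have Ft : F t = P t (w t) by rewrite /F (ode_evolution_refl M0 HA).
have Ht : H t = K * c / (al - b) * W t by rewrite /H subrr mulr0 expR0 mulr1.
have Fa : enorm (F a) <= e.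
  apply: le_trans (ode_stable_bound _ at_) _.
  apply: le_trans (ler_wpM2l _ (wB a)) _; first by rewrite mulr_ge0 ?expR_ge0// ltW.
  rewrite mulrAC (_ : - al * (t - a) = - (al * x))//.
  by rewrite /a opprB addrCA subrr addr0 mulNr.
have [C C0 hC] := duhamel M0 HA at_ hw gi (fun t _ => wB t) (fun t _ => gc1 t).
have Hm u v : u <= v -> H u <= H v.
  move=> uv; rewrite ler_wpM2l//; first by have := H0 t; rewrite Ht.
  by rewrite ler_expR ler_wpM2l ?lerD2r// ltW.
suff : enorm (F t - F a) <= H t - H a.
  rewrite Ft Ht => h1; rewrite -[P t (w t)](subrK (F a)).
  apply: le_trans (enormD _ _) _; apply: lerD => //.
  by apply: le_trans h1 _; rewrite gerBl.
apply: (@increment_le _ _ F H al (K * C)) => // [u v _ uv _|u v au uv vt]; first exact: Hm.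
have ut := le_trans uv vt.
have -> : F v - F u = T t v (P v (w v - T v u (w u))).
  rewrite linearB/= (ode_evolutionB M0 HA)// -[P v (T v u _)]ode_proj_comm//.
  by rewrite (ode_evolution_cocycle M0 HA).
apply: le_trans (ode_stable_bound _ vt) _.
have eb0 : 0 <= c * W t * expR (b * (t - u)) by rewrite !mulr_ge0 ?expR_ge0// ltW.
have hv := hC u v _ au uv vt eb0 _.
apply: le_trans (ler_wpM2l _ (hv _)) _; first by rewrite mulr_ge0 ?expR_ge0// ltW.
  move=> p /andP[up pv]; apply: le_trans (gc p) _; rewrite -mulrA ler_wpM2l//.
  apply: le_trans (weight_shift s t p b0) _.
  rewrite ler_wpM2l ?expR_ge0// ler_expR ler_wpM2l// ger0_norm ?lerD2l ?lerN2//.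
  by rewrite subr_ge0 (le_trans pv).
rewrite mulrDr [leRHS]addrC; apply: lerD.
  rewrite -!mulrA ler_wpM2l ?(ltW K0)//; apply: ler_piMl.
    by rewrite mulr_ge0// sqr_ge0.
  by rewrite -expR0 ler_expR mulNr oppr_le0 mulr_ge0 ?(ltW al0)// subr_ge0.
have -> : H v - H u = H u * (expR ((al - b) * (v - u)) - 1).
  have hE : expR ((al - b) * (v - t)) =
      expR ((al - b) * (u - t)) * expR ((al - b) * (v - u)).
    by rewrite -expRD; congr expR; ring.
  by rewrite /H hE; ring.
have h1 : (al - b) * (v - u) <= expR ((al - b) * (v - u)) - 1.
  by rewrite lerBrDr addrC expR_ge1Dx.
apply: le_trans (ler_wpM2l (expR_ge0 _) (ler_wpM2l (H0 u) h1)).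
rewrite le_eqVlt; apply/orP; left; apply/eqP.
transitivity (K * c * W t * (v - u) * (expR (- al * (t - v)) * expR (b * (t - u)))).
  by ring.
transitivity (K * c * W t * (v - u) * (expR (al * (v - u)) * expR ((al - b) * (u - t)))).
  by rewrite -!expRD; congr (_ * expR _); ring.
by rewrite /H; field; rewrite gt_eqF.
Qed.

(** Symmetrically, the unstable part of [w t] is minus the integral over
    [u >= t] of the backward image at [t] of the unstable part of [g u]; the
    curve of the backward images [F u] of the unstable part of [w u] tends to [0]
    for [u] tending to [+oo]. *)
Lemma a_priori_unstable t : enorm (w t - P t (w t)) <= K * c / (al - b) * W t.
Proof.
apply/ler_addgt0Pr => e e0.
have [x x0 hx] := expR_small (K * B) al0 e0.
pose d := t + x; have td : t <= d by rewrite lerDl.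
have hF u : exists v, t <= u -> [/\ P t v = 0, T u t v = w u - P u (w u) &
    enorm v <= K * expR (- al * (u - t)) * enorm (w u)].
  have [tu|ut] := leP t u; last by exists 0.
  by have [v hv] := ode_backward (w u) tu; exists v.
have [F hFu] := choice hF.
pose H u := - (K * c / (al - b) * W t * expR (- (al - b) * (u - t))).
have H0 u : 0 <= - H u by rewrite opprK !mulr_ge0 ?expR_ge0// ?invr_ge0 ltW.
have Ft : F t = w t - P t (w t).
  by have [_ + _] := hFu t (lexx t); rewrite (ode_evolution_refl M0 HA).
have Ht : H t = - (K * c / (al - b) * W t) by rewrite /H subrr mulr0 expR0 mulr1.
have Fd : enorm (F d) <= e.
  have [_ _ h1] := hFu d td; apply: le_trans h1 _.
  apply: le_trans (ler_wpM2l _ (wB d)) _; first by rewrite mulr_ge0 ?expR_ge0// ltW.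
  rewrite mulrAC (_ : - al * (d - t) = - (al * x))//.
  by rewrite /d addrAC subrr add0r mulNr.
have [C C0 hC] := duhamel M0 HA td hw gi (fun t _ => wB t) (fun t _ => gc1 t).
have Hm u v : u <= v -> H u <= H v.
  move=> uv; rewrite lerN2 ler_wpM2l//.
    by have := H0 t; rewrite Ht opprK.
  by rewrite ler_expR !mulNr lerN2 ler_wpM2l ?lerD2r// ltW.
suff : enorm (F d - F t) <= H d - H t.
  move=> h1; rewrite enormBC Ht opprK in h1; rewrite -Ft -[F t](subrK (F d)).
  apply: le_trans (enormD _ _) _; apply: lerD => //.
  by apply: le_trans h1 _; rewrite gerDr -oppr_ge0.
apply: (@increment_le _ _ F H al (K * C)) => // [u v _ uv _|u v tu uv vd]; first exact: Hm.
have tv := le_trans tu uv.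
have [Pu Tu _] := hFu u tu; have [Pv Tv _] := hFu v tv.
have [z [Pz Tz zb]] := ode_backward (w v - T v u (w u)) tv.
have -> : F v - F u = z.
  apply: (ode_ker_inj tv) => //; first by rewrite linearB/= Pu Pv subrr.
  rewrite (ode_evolutionB M0 HA)// Tz Tv.
  rewrite -(ode_evolution_cocycle M0 HA _ tu uv) Tu (ode_evolutionB M0 HA)//.
  have abel (p q p' q' : 'cV[R]_n) : p - q - (p' - q') = p - p' - (q - q') by vring.
  by rewrite abel (ode_proj_comm (w u) uv) [in RHS]linearB.
apply: le_trans zb _.
have eb0 : 0 <= c * W t * expR (b * (v - t)) by rewrite !mulr_ge0 ?expR_ge0// ltW.
have hv := hC u v _ tu uv vd eb0 _.
apply: le_trans (ler_wpM2l _ (hv _)) _; first by rewrite mulr_ge0 ?expR_ge0// ltW.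
  move=> p /andP[up pv]; apply: le_trans (gc p) _; rewrite -mulrA ler_wpM2l//.
  apply: le_trans (weight_shift s t p b0) _.
  rewrite ler_wpM2l ?expR_ge0// ler_expR ler_wpM2l// distrC ger0_norm ?lerD2r//.
  by rewrite subr_ge0 (le_trans tu).
rewrite mulrDr [leRHS]addrC; apply: lerD.
  rewrite -!mulrA ler_wpM2l ?(ltW K0)//; apply: ler_piMl.
    by rewrite mulr_ge0// sqr_ge0.
  by rewrite -expR0 ler_expR mulNr oppr_le0 mulr_ge0 ?(ltW al0)// subr_ge0.
have -> : H v - H u = - H v * (expR ((al - b) * (v - u)) - 1).
  have hE : expR (- (al - b) * (u - t)) =
      expR (- (al - b) * (v - t)) * expR ((al - b) * (v - u)).
    by rewrite -expRD; congr expR; ring.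
  by rewrite /H hE; ring.
have h1 : (al - b) * (v - u) <= expR ((al - b) * (v - u)) - 1.
  by rewrite lerBrDr addrC expR_ge1Dx.
have h2 : 1 <= expR (al * (v - u)).
  by rewrite -expR0 ler_expR mulr_ge0 ?(ltW al0)// subr_ge0.
have h3 : 0 <= - H v * (expR ((al - b) * (v - u)) - 1).
  by rewrite mulr_ge0// (le_trans _ h1)// mulr_ge0 ?(ltW ba0)// subr_ge0.
apply: le_trans (ler_peMl h3 h2); apply: le_trans (ler_wpM2l (H0 v) h1).
rewrite le_eqVlt; apply/orP; left; apply/eqP.
transitivity (K * c * W t * (v - u) * (expR (- al * (v - t)) * expR (b * (v - t)))).
  by ring.
rewrite -expRD (_ : - al * (v - t) + b * (v - t) = - (al - b) * (v - t)); last by ring.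
by rewrite /H; field; rewrite gt_eqF.
Qed.

Lemma a_priori t : enorm (w t) <= 2 * K * c / (al - b) * W t.
Proof.
rewrite -[w t](subrK (P t (w t))); apply: le_trans (enormD _ _) _.
apply: le_trans (lerD (a_priori_unstable t) (a_priori_stable t)) _.
by rewrite le_eqVlt; apply/orP; left; apply/eqP; ring.
Qed.

End a_priori.

End ode_green.

(** * Bounded solutions of forced equations: existence *)

Section global_solutions.
Context (R : realType) (n : nat) (r M : R) (r0 : 0 <= r) (M0 : 0 <= M).
Context (Lam : (R -> 'cV[R]_n) -> R -> 'cV[R]_n) (HL : causal r M Lam).
Implicit Types (x y f g w : R -> 'cV[R]_n) (s t a b c e : R).

Definition global_sol f x := forall s, sol Lam f s x.

Lemma global_solB f g x y : integrand f -> integrand g -> global_sol f x -> global_sol g y ->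
  global_sol (fun t => f t - g t) (fun t => x t - y t).
Proof.
move=> fi gi hx hy s; have := solDZ HL (-1) fi gi (hx s) (hy s).
rewrite (_ : (fun t => f t + _) = (fun t => f t - g t)); last first.
  by apply/funext => t; rewrite scaleN1r.
by rewrite (_ : (fun t => x t + _) = (fun t => x t - y t))//; apply/funext => t;
  rewrite scaleN1r.
Qed.

(** By causality, [Lam x] vanishes before [a] together with [x]. *)
Lemma global_sol_extend f x a : integrand f -> (forall t, t <= a -> x t = 0) ->
  (forall t, t <= a -> f t = 0) -> sol Lam f a x -> global_sol f x.
Proof.
move=> fi x0 f0 hx s; have [as_|/ltW sa] := leP a s; first exact: (solS HL fi as_).
have cx := hx.1; have gi := sol_integrand HL fi cx.
have z b : s <= b -> b <= a -> integ (fun u => Lam x u + 1 *: f u) s b = 0.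
  move=> sb ba; apply: enorm_eq0; rewrite -(mul0r (b - s)).
  apply: integ_le_cst => // u /andP[_ ub]; rewrite f0 ?(le_trans ub)// scaler0 addr0.
  rewrite -(mulr0 M); apply: (causal_bound HL cx) => // v /andP[_ vu].
  by rewrite x0 ?enorm0// (le_trans vu)// (le_trans ub).
split=> // t st; rewrite (x0 s sa) subr0.
have [ta|/ltW at_] := leP t a; first by rewrite x0// z.
rewrite (integ_chasles gi sa at_) (z a sa (lexx a)) add0r -hx.2//.
by rewrite (x0 a (lexx a)) subr0.
Qed.

Lemma global_sol_limit (F G : nat -> R -> 'cV[R]_n) w g c q : 0 <= q < 1 -> 0 <= c ->
  (forall k, integrand (G k)) -> integrand g -> (forall k, global_sol (G k) (F k)) ->
  (forall k t, enorm (w t - F k t) <= c * q ^+ k) ->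
  (forall k t, enorm (g t - G k t) <= c * q ^+ k) -> global_sol g w.
Proof.
move=> q01 c0 Gi gi hF wF gG s; have /andP[q0 _] := q01.
have cw : continuous w.
  apply: (@continuous_weighted_limit _ _ F w (fun=> 1) c q) => //.
  - by move=> t; exact: cvg_cst.
  - by move=> k; case: (hF k s).
  - by move=> k t; rewrite mulr1.
split=> // t st; apply/eqP; rewrite -subr_eq0; apply/eqP/enorm_eq0/ler_addgt0Pr => e e0.
have [k hk] := expr_small (c * (2 + (M + 1) * (t - s))) q01 e0.
have cq0 : 0 <= c * q ^+ k by rewrite mulr_ge0// exprn_ge0.
have /= h1 := hk k (leqnn k); rewrite add0r; apply: le_trans (ltW h1).
have wi := sol_integrand HL gi cw; have Fi := sol_integrand HL (Gi k) (hF k s).1.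
rewrite (_ : _ - _ = (w t - F k t) - (w s - F k s) -
    (integ (fun u => Lam w u + 1 *: g u) s t -
     integ (fun u => Lam (F k) u + 1 *: G k u) s t)); last first.
  by rewrite -(hF k s).2//; vring.
apply: le_trans (enormB _ _) _.
apply: le_trans (lerD (enormB _ _) (lexx _)) _.
apply: le_trans (lerD (lerD (wF k t) (wF k s)) (lexx _)) _.
rewrite -[_ - integ _ _ _]/(_ + - _) -scaleN1r -integD//.
have : enorm (integ (fun u => Lam w u + 1 *: g u + -1 *: (Lam (F k) u + 1 *: G k u)) s t)
    <= (M + 1) * (c * q ^+ k) * (t - s).
  apply: integ_le_cst => //; first exact: integrandD.
    by rewrite mulr_ge0// addr_ge0.
  move=> u _; rewrite (_ : _ + _ = (Lam w u - Lam (F k) u) + (g u - G k u)); last by vring.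
  apply: le_trans (enormD _ _) _; rewrite mulrDl mul1r; apply: lerD => //.
  by apply: (causal_dist HL cw (hF k s).1).
by lra.
Qed.

End global_solutions.

Section green.
Context (R : realType) (n : nat) (A : R -> 'M[R]_n) (M : R) (M0 : 0 <= M).
Notation LA := (fun (x : R -> 'cV[R]_n) t => A t *m x t).
Context (HA : causal 0 M LA).
Implicit Types (x y w g f : R -> 'cV[R]_n) (s t a b c e : R).
Notation T := (ode_evolution A).
Notation zf := (@zf R n).
Context (P : R -> {linear 'cV[R]_n -> 'cV[R]_n}) (al K : R).
Context (al0 : 0 < al) (K0 : 0 < K) (dich : dichotomy_with (@enorm R n) T P al K).

(** Follow the solution that vanishes up to time [a] as far as [b], and subtract
    the homogeneous solution through its unstable part there: the difference is
    stable after [b], and minus an unstable solution before [a]. *)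
Lemma ode_green_compact g a b cg : integrand g -> a <= b ->
  (forall t, enorm (g t) <= cg) ->
  (forall t, t <= a -> g t = 0) -> (forall t, b <= t -> g t = 0) ->
  exists w, global_sol LA g w /\ exists B, forall t, enorm (w t) <= B.
Proof.
move=> gi ab gb ga0 gb0.
have c0 : continuous (fun _ : R => 0 : 'cV[R]_n) by move=> u; exact: cvg_cst.
have [y [ya hya]] := sol_exists (lexx 0) M0 HA a gi c0 gb.
have hy : global_sol LA g y.
  exact: (@global_sol_extend _ _ 0 M LA HA g y a gi ya ga0 hya).
pose v := y b; pose eta := v - P b v.
have hxi t : exists p, t <= b -> [/\ P t p = 0, T b t p = eta &
    enorm p <= K * expR (- al * (b - t)) * enorm v].
  have [tb|bt] := leP t b; last by exists 0.
  by have [p hp] := ode_backward M0 HA dich v tb; exists p.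
have [xi hx] := choice hxi.
pose u t := if t <= b then xi t else T t b eta.
have ub : u b = eta.
  by rewrite /u lexx; have [_ <- _] := hx b (lexx b); rewrite (ode_evolution_refl M0 HA).
have carry s t : s <= t -> u t = T t s (u s).
  move=> st; rewrite /u; have [tb|bt] := leP t b.
    have sb := le_trans st tb; rewrite sb.
    have [p1 p2 _] := hx s sb; have [q1 q2 _] := hx t tb.
    apply: (ode_ker_inj dich tb) => //.
      rewrite -(ode_proj_comm dich)// p1.
      by rewrite -(scale0r 0) (ode_evolutionZ M0 HA)// !scale0r.
    by rewrite (ode_evolution_cocycle M0 HA)// p2.
  have [sb|/ltW bs] := leP s b.
    by have [_ <- _] := hx s sb; rewrite (ode_evolution_cocycle M0 HA)// ltW.
  by rewrite (ode_evolution_cocycle M0 HA).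
have hu : global_sol LA zf u := ode_evolution_sol M0 HA carry.
have hw : global_sol LA g (fun t => y t - u t).
  have := global_solB HA gi (integrand0 R n) hy hu.
  by rewrite (_ : (fun t => g t - _) = g)//; apply/funext => t; rewrite subr0.
exists (fun t => y t - u t); split => //.
have [B B0 hB] := continuous_bounded a b (hw a).1.
exists (B + K * enorm v) => t.
have Kv0 : 0 <= K * enorm v by rewrite mulr_ge0 ?enorm_ge0// ltW.
have e1 (z : R) : 0 <= z -> K * expR (- al * z) * enorm v <= K * enorm v.
  move=> z0; rewrite ler_wpM2r ?enorm_ge0// ler_piMr ?(ltW K0)//.
  by rewrite -expR0 ler_expR mulNr oppr_le0 mulr_ge0// ltW.
have [bt|tb] := leP b t.
  have hwb : sol LA zf b (fun t => y t - u t).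
    by apply: (eq_sol HA gi (integrand0 R n) _ (hw b)).
  have := ode_evolutionE M0 HA bt hwb; rewrite /= ub /eta /v opprB addrC subrK => <-.
  apply: le_trans (ode_stable_bound M0 HA dich _ bt) _.
  by apply: le_trans (e1 _ _) _; rewrite ?subr_ge0// lerDr.
have [at_|ta] := leP a t; first by rewrite (le_trans (hB t _)) ?lerDl// at_ ltW.
rewrite ya ?(ltW ta)// sub0r enormN /u (ltW tb).
have [_ _ h1] := hx t (ltW tb); apply: le_trans h1 _.
by apply: le_trans (e1 _ _) _; rewrite ?subr_ge0 ?(ltW tb)// lerDr.
Qed.

Lemma lmeasurable_restrict g (D : set R) : measurable D -> lmeasurable g ->
  lmeasurable (fun t => if t \in D then g t else 0).
Proof.
move=> mD mg i.
rewrite (_ : (fun t => _) = (fun t => (\1_D t : R) * g t i ord0)); last first.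
  by apply/funext => t; rewrite indicE; case: ifP; rewrite ?mul1r ?mul0r// mxE.
exact: measurable_funM (borel_lebesgue (measurable_indic mD)) (mg i).
Qed.

Lemma bounded_integrand g c : lmeasurable g -> (forall t, enorm (g t) <= c) -> integrand g.
Proof. by move=> mg gc; split=> // b; exists c. Qed.

(** The bounded solutions for the truncations of [g] to [|t - s| < m] form a
    geometrically convergent sequence: by [a_priori] they differ by a multiple of
    the size of [g] outside these intervals. *)
Lemma ode_green g c b s : lmeasurable g -> 0 <= c -> 0 < b -> b < al ->
  (forall t, enorm (g t) <= c * expR (- b * `|t - s|)) ->
  exists w, global_sol LA g w /\
    forall t, enorm (w t) <= 2 * K * c / (al - b) * expR (- b * `|t - s|).
Proof.
move=> mg c0 b0 ba gc.
have W1 t : expR (- b * `|t - s|) <= 1.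
  by rewrite -expR0 ler_expR mulNr oppr_le0 mulr_ge0// ltW.
have gc1 t : enorm (g t) <= c by apply: le_trans (gc t) _; rewrite ler_piMr.
have gi := bounded_integrand mg gc1.
pose D (m : nat) : set R := `](s - m%:R), (s + m%:R)[%classic.
pose G m t := if t \in D m then g t else 0.
have Gc1 m t : enorm (G m t) <= c.
  by rewrite /G; case: ifP => // _; rewrite enorm0.
have mG m : lmeasurable (G m) by apply: lmeasurable_restrict => //; exact: measurable_itv.
have Gi m : integrand (G m) := bounded_integrand (mG m) (Gc1 m).
pose q := expR (- b).
have q01 : 0 <= q < 1 by rewrite expR_ge0/= -expR0 ltr_expR oppr_lt0.
have DE m t : (t \in D m) = (`|t - s| < m%:R).
  rewrite ltr_distl; apply/idP/idP => [/set_mem|] h; last by apply/mem_set; rewrite /D/= in_itv.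
  by move: h; rewrite /D/= in_itv.
have gG m t : enorm (g t - G m t) <= c * q ^+ m.
  rewrite /G; case: ifPn => [_|]; first by rewrite subrr enorm0 mulr_ge0// exprn_ge0// expR_ge0.
  rewrite DE -leNgt subr0 => mt; apply: le_trans (gc t) _; rewrite ler_wpM2l//.
  by rewrite -expRM_natr ler_expR !mulNr lerN2 ler_wpM2l// ltW.
have hF m : exists w, global_sol LA (G m) w /\ exists B, forall t, enorm (w t) <= B.
  apply: (@ode_green_compact (G m) (s - m%:R) (s + m%:R) c) => //.
  - by have := ler0n R m; lra.
  - move=> t tm; rewrite /G ifN// DE -leNgt ler_normr; apply/orP; right; lra.
  - move=> t tm; rewrite /G ifN// DE -leNgt ler_normr; apply/orP; left; lra.
have [F hFm] := choice hF.
have FS k t : enorm (F k.+1 t - F k t) <= 2 * K * (2 * c) / al * q ^+ k * 1.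
  have [h1 [B1 hB1]] := hFm k.+1; have [h2 [B2 hB2]] := hFm k.
  have GG u : enorm (G k.+1 u - G k u) <= 2 * c * q ^+ k * expR (- 0 * `|u - s|).
    rewrite oppr0 mul0r expR0 mulr1; apply: le_trans (enorm_dist (g u) _ _) _.
    rewrite enormBC; apply: le_trans (lerD (gG _ _) (gG _ _)) _.
    rewrite -mulrA mulr_natl mulr2n lerD2r ler_wpM2l// exprS ler_piMl ?exprn_ge0 ?expR_ge0//.
    by case/andP: q01 => _ /ltW.
  have := a_priori M0 HA al0 K0 dich (global_solB HA (Gi _) (Gi _) h1 h2) _ _ _ (lexx 0) al0 GG.
  move=> /(_ (B1 + B2)) h3; apply: le_trans (h3 _ _ _ t) _.
  - have := integrandD (-1) (Gi k.+1) (Gi k); congr integrand.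
    by apply/funext => u; rewrite scaleN1r.
  - by move=> u; apply: le_trans (enormB _ _) _; exact: lerD.
  - by rewrite !mulr_ge0// exprn_ge0// expR_ge0.
  rewrite oppr0 mul0r expR0 addr0 !mulr1.
  by rewrite le_eqVlt; apply/orP; left; apply/eqP; ring.
pose C := 2 * K * (2 * c) / al.
have C0 : 0 <= C by rewrite !mulr_ge0// ?invr_ge0 ltW.
have [w hw] := geometric_limit q01 C0 (fun _ => ler01) FS.
pose C' := C / (1 - q) + c.
have C1 : 0 <= C / (1 - q) by rewrite divr_ge0// subr_ge0 ltW//; case/andP: q01.
have q0 k : 0 <= q ^+ k by rewrite exprn_ge0// expR_ge0.
have C'0 : 0 <= C' by rewrite addr_ge0.
have ws : global_sol LA g w.
  apply: (global_sol_limit M0 HA q01 C'0 Gi gi (fun k => (hFm k).1)) => k t.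
    by apply: le_trans (hw k t) _; rewrite mulr1 ler_wpM2r// lerDl.
  by apply: le_trans (gG k t) _; rewrite ler_wpM2r// lerDr.
exists w; split=> // t.
have [_ [B0 hB0]] := hFm 0.
apply: (a_priori M0 HA al0 K0 dich ws gi (B := C / (1 - q) + B0)) => //; last exact: ltW.
move=> u; rewrite -[w u](subrK (F 0 u)); apply: le_trans (enormD _ _) _.
by apply: lerD (hB0 u); have := hw 0 u; rewrite expr0 !mulr1.
Qed.

End green.

Section delay_perturbation.
Context (R : realType) (n : nat) (A : R -> 'M[R]_n) (r M : R) (r0 : 0 <= r) (M0 : 0 <= M).
Notation LA := (fun (x : R -> 'cV[R]_n) t => A t *m x t).
Context (HA : causal 0 M LA).
Context (Lam : (R -> 'cV[R]_n) -> R -> 'cV[R]_n) (HL : causal r M Lam).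
Hypothesis Lam_cst : forall (x : R -> 'cV[R]_n) t, Lam (fun=> x t) t = A t *m x t.
Implicit Types (x y w g f : R -> 'cV[R]_n) (s t a b c e : R).
Notation T := (ode_evolution A).
Notation zf := (@zf R n).
Context (P : R -> {linear 'cV[R]_n -> 'cV[R]_n}) (al K : R).
Context (al0 : 0 < al) (K0 : 0 < K) (dich : dichotomy_with (@enorm R n) T P al K).

(** The delay equation is the ordinary equation with the forcing
    [delay_defect w]. *)
Definition delay_defect w t := Lam w t - A t *m w t.

Lemma delay_defect_integrand w : continuous w -> integrand (delay_defect w).
Proof.
move=> cw; have := integrandD (-1) (causal_integrand HL cw) (causal_integrand HA cw).
by congr integrand; apply/funext => t; rewrite scaleN1r.
Qed.

Lemma delay_defectB x y t : continuous x -> continuous y ->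
  delay_defect (fun u => x u - y u) t = delay_defect x t - delay_defect y t.
Proof.
by move=> cx cy; rewrite /delay_defect (causalB HL)// mulmxBr; vring.
Qed.

Lemma global_sol_delay f g w : integrand f -> integrand g ->
  (forall t, g t = f t + delay_defect w t) -> global_sol LA g w -> global_sol Lam f w.
Proof.
move=> fi gi gE hw s; have cw := (hw s).1; split=> // t st; rewrite (hw s).2//.
apply: eq_integ => //; [exact: (sol_integrand HA)|exact: (sol_integrand HL)|].
by move=> u _; rewrite gE /delay_defect; vring.
Qed.

Lemma global_sol_ode f w : integrand f -> global_sol Lam f w ->
  global_sol LA (fun t => f t + 1 *: delay_defect w t) w.
Proof.
move=> fi hw s; have cw := (hw s).1; split=> // t st; rewrite (hw s).2//.
apply: eq_integ => //; first exact: (sol_integrand HL).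
  by apply: (sol_integrand HA) => //; apply: integrandD => //; exact: delay_defect_integrand.
by move=> u _; rewrite /delay_defect; vring.
Qed.

(** The contraction constant: the defect of [w] at [t] is at most [M] times the
    oscillation of [w] on [[t - r, t]], hence at most [M r] times a bound for
    [A w + g] there; the weight [expR (- b * |t - s|)] varies by a factor of at
    most [expR (b * r)] on this interval. *)
Definition rate b := M * r * expR (b * r) * (2 * K * M / (al - b) + 1).

Lemma rate_ge0 b : b < al -> 0 <= rate b.
Proof.
move=> ba; rewrite !mulr_ge0 ?expR_ge0// addr_ge0// mulr_ge0 ?invr_ge0 ?subr_ge0 ?(ltW ba)//.
by rewrite !mulr_ge0// ltW.
Qed.

Lemma delay_defect_bound w g B c b s t : integrand g -> global_sol LA g w ->
  (forall t, enorm (w t) <= B) -> 0 <= c -> 0 <= b -> b < al ->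
  (forall t, enorm (g t) <= c * expR (- b * `|t - s|)) ->
  enorm (delay_defect w t) <= rate b * c * expR (- b * `|t - s|).
Proof.
move=> gi hw wB c0 b0 ba gc; have cw := (hw 0).1.
have wb := a_priori M0 HA al0 K0 dich hw gi wB c0 b0 ba gc.
have ba0 : 0 <= al - b by rewrite subr_ge0 ltW.
pose k := (M * (2 * K * c / (al - b)) + c) * (expR (- b * `|t - s|) * expR (b * r)).
have k0 : 0 <= M * (2 * K * c / (al - b)) + c.
  by rewrite addr_ge0// mulr_ge0// mulr_ge0 ?invr_ge0// mulr_ge0// mulr_ge0// ltW.
have -> : rate b * c * expR (- b * `|t - s|) = M * (k * r) by rewrite /rate /k; ring.
rewrite /delay_defect -Lam_cst.
have cc : continuous (fun _ : R => w t) by move=> u; exact: cvg_cst.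
apply: (causal_dist HL cw cc); first by rewrite !mulr_ge0// expR_ge0.
move=> u /andP[u1 ut]; rewrite enormBC (hw u).2//.
have ge0 : 0 <= k by rewrite !mulr_ge0// expR_ge0.
apply: le_trans (integ_le_cst (sol_integrand HA gi cw) ut ge0 _) _; last first.
  by rewrite ler_wpM2l//; lra.
move=> p /andP[up pt]; rewrite scale1r; apply: le_trans (enormD _ _) _.
apply: (@le_trans _ _ ((M * (2 * K * c / (al - b)) + c) * expR (- b * `|p - s|))).
  rewrite mulrDl; apply: lerD; last exact: gc.
  rewrite -mulrA; apply: (causal_bound HA cw).
    by apply: le_trans (wb p); exact: enorm_ge0.
  by move=> v; rewrite subr0 => /le_anti <-.
rewrite /k ler_wpM2l//; apply: le_trans (weight_shift s t p b0) _.
rewrite ler_wpM2l ?expR_ge0// ler_expR ler_wpM2l// ger0_norm; lra.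
Qed.

(** The defect [N w] of [w] is the forcing under which [w] solves the ordinary
    equation, so a bound [c] for it improves to [rate 0 * c]; hence it is [0],
    and the a priori estimate for the zero forcing gives [w = 0]. *)
Lemma delay_bounded_zero w B : rate 0 < 1 -> global_sol Lam zf w ->
  (forall t, enorm (w t) <= B) -> forall t, w t = 0.
Proof.
move=> q1 hw wB.
have cw := (hw 0).1; have Ni := delay_defect_integrand cw.
have hN : global_sol LA (delay_defect w) w.
  have := global_sol_ode (integrand0 R n) hw.
  by congr (global_sol _ _ _); apply/funext => t; rewrite add0r scale1r.
have q0 := rate_ge0 al0.
have E0 t : expR (- 0 * `|t - 0|) = 1 :> R by rewrite oppr0 mul0r expR0.
have B0 : 0 <= B by apply: le_trans (wB 0); exact: enorm_ge0.
have step c : 0 <= c -> (forall t, enorm (delay_defect w t) <= c) ->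
    forall t, enorm (delay_defect w t) <= rate 0 * c.
  move=> c0 hc t.
  have := @delay_defect_bound w _ B c 0 0 t Ni hN wB c0 (lexx 0) al0.
  by rewrite E0 mulr1; apply => u; rewrite E0 mulr1.
have Nk k t : enorm (delay_defect w t) <= 2 * M * B * rate 0 ^+ k.
  elim: k t => [|k IH] t.
    rewrite expr0 mulr1 /delay_defect; apply: le_trans (enormB _ _) _.
    have -> : 2 * M * B = M * B + M * B by ring.
    by apply: lerD; [apply: (causal_bound HL cw)|apply: (causal_bound HA cw)].
  rewrite exprS mulrCA; apply: step => //.
  by rewrite !mulr_ge0// exprn_ge0.
have N0 t : delay_defect w t = 0.
  apply/enorm_eq0/ler_addgt0Pr => e e0.
  have [|k hk] := @expr_small R (rate 0) (2 * M * B) e _ e0; first by rewrite q0.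
  by rewrite add0r (le_trans (Nk k t))// ltW// hk.
move=> t; apply: enorm_eq0.
have := a_priori M0 HA al0 K0 dich hN Ni wB (lexx 0) (lexx 0) al0 (s := 0).
move=> /(_ _ t); rewrite mulr0 !mul0r; apply => u.
by rewrite N0 enorm0 mul0r.
Qed.

(** Existence for a decaying forcing, by contraction in the forcing of the
    ordinary equation: [g] is sent to [f] plus the defect of the bounded
    solution that [g] forces. *)
Lemma delay_solvable f c b s : lmeasurable f -> 0 <= c -> 0 < b -> b < al ->
  rate b < 1 -> (forall t, enorm (f t) <= c * expR (- b * `|t - s|)) ->
  exists w, global_sol Lam f w /\ forall t, enorm (w t) <=
    2 * K / (al - b) * (c / (1 - rate b)) * expR (- b * `|t - s|).
Proof.
move=> mf c0 b0 ba q1 fc.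
pose W t := expR (- b * `|t - s|).
have W0 t : 0 <= W t by exact: expR_ge0.
have W1 t : W t <= 1.
  by rewrite -expR0 ler_expR mulNr oppr_le0 mulr_ge0// ltW.
have q0 := rate_ge0 ba; set q := rate b in q0 q1 *.
have q01 : 0 <= q < 1 by rewrite q0.
pose X := [set g : R -> 'cV[R]_n | lmeasurable g /\
  exists c', 0 <= c' /\ forall t, enorm (g t) <= c' * W t].
have Xi g : X g -> integrand g.
  move=> [mg [c' [c'0 gc']]]; apply: (@bounded_integrand _ _ g c' mg) => t.
  by apply: le_trans (gc' t) _; rewrite ler_piMr.
have hGr g : exists w, X g -> global_sol LA g w /\ exists B, forall t, enorm (w t) <= B.
  have [Xg|nXg] := pselect (X g); last by exists (fun=> 0).
  have [mg [c' [c'0 gc']]] := Xg.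
  have [w [hw wb]] := ode_green M0 HA al0 K0 dich mg c'0 b0 ba gc'.
  exists w => _; split=> //; exists (2 * K * c' / (al - b)) => t.
  apply: le_trans (wb t) _; apply: ler_piMr; last exact: W1.
  by rewrite mulr_ge0 ?invr_ge0 ?subr_ge0 ?(ltW ba)// mulr_ge0// mulr_ge0// ltW.
have [Gr hGrP] := choice hGr.
pose Phi g t := f t + delay_defect (Gr g) t.
have cGr g : X g -> continuous (Gr g) by move=> /hGrP[h _]; exact: (h 0).1.
have Nb g : X g -> forall c', 0 <= c' -> (forall t, enorm (g t) <= c' * W t) ->
    forall t, enorm (delay_defect (Gr g) t) <= q * c' * W t.
  move=> Xg c' c'0 gc' t; have [hw [B hB]] := hGrP g Xg.
  exact: (delay_defect_bound t (Xi g Xg) hw hB c'0 (ltW b0) ba gc').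
have Xf : X f by split => //; exists c.
have XPhi g : X g -> X (Phi g).
  move=> Xg; have [mg [c' [c'0 gc']]] := Xg; split.
    have := lmeasurableD 1 mf (delay_defect_integrand (cGr g Xg)).1.
    by congr lmeasurable; apply/funext => t; rewrite scale1r.
  exists (c + q * c'); split; first by rewrite addr_ge0// mulr_ge0.
  move=> t; rewrite mulrDl; apply: le_trans (enormD _ _) _.
  by apply: lerD (fc t) _; exact: Nb.
have Xlim F g c' : 0 <= c' -> (forall k : nat, X (F k)) ->
    (forall k t, enorm (g t - F k t) <= c' * q ^+ k * W t) -> X g.
  move=> c'0 XF gF; split.
    apply: (lmeasurable_limit (fun k => (XF k).1)) => t.
    apply/cvg_enorm => e e0; have [k0 hk] := expr_small (c' * W t) q01 e0.
    exists k0 => // k /= kk; rewrite enormBC; apply: le_lt_trans (gF k t) _.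
    by rewrite mulrAC hk.
  have [_ [c1 [c10 hc1]]] := XF 0.
  exists (c' + c1); split; first exact: addr_ge0.
  move=> t; rewrite -[g t](subrK (F 0 t)); apply: le_trans (enormD _ _) _.
  by rewrite mulrDl; apply: lerD => //; have := gF 0 t; rewrite expr0 mulr1.
have hPhi g h c' : 0 <= c' -> X g -> X h -> (forall t, enorm (g t - h t) <= c' * W t) ->
    forall t, enorm (Phi g t - Phi h t) <= q * c' * W t.
  move=> c'0 Xg Xh gh t; have [hg [B1 hB1]] := hGrP g Xg; have [hh [B2 hB2]] := hGrP h Xh.
  rewrite /Phi opprD addrACA subrr add0r -delay_defectB; [|exact: cGr|exact: cGr].
  apply: (delay_defect_bound t _ (global_solB HA (Xi g Xg) (Xi h Xh) hg hh) (B := B1 + B2) _ c'0 (ltW b0) ba gh).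
    have := integrandD (-1) (Xi g Xg) (Xi h Xh).
    by congr integrand; apply/funext => u; rewrite scaleN1r.
  by move=> u; apply: le_trans (enormB _ _) _; exact: lerD.
have h0 t : enorm (Phi f t - f t) <= q * c * W t.
  by rewrite /Phi [X in X - _]addrC addrK; exact: Nb.
have [|g [Xg gE gf]] := weighted_fixpoint q01 _ W0 Xf XPhi Xlim hPhi h0.
  exact: mulr_ge0.
have [hw [B hB]] := hGrP g Xg.
exists (Gr g); split.
  by apply: (global_sol_delay (Xi f Xf) (Xi g Xg) _ hw) => t; rewrite -gE.
move=> t; have q10 : 0 < 1 - q by rewrite subr_gt0.
have gc u : enorm (g u) <= c / (1 - q) * W u.
  rewrite -[g u](subrK (f u)); apply: le_trans (enormD _ _) _.
  apply: le_trans (lerD (gf u) (fc u)) _; rewrite -mulrDl ler_wpM2r//.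
  by rewrite le_eqVlt; apply/orP; left; apply/eqP; field; rewrite gt_eqF.
have c10 : 0 <= c / (1 - q) by rewrite divr_ge0// ltW.
apply: le_trans (a_priori M0 HA al0 K0 dich hw (Xi g Xg) hB c10 (ltW b0) ba gc t) _.
by rewrite le_eqVlt; apply/orP; left; apply/eqP; ring.
Qed.

End delay_perturbation.

(** * Splitting a solution of the delay equation *)

Section splitting.
Context (R : realType) (n : nat) (r M : R) (r0 : 0 < r) (M0 : 0 <= M).
Context (Lam : (R -> 'cV[R]_n) -> R -> 'cV[R]_n) (HL : causal r M Lam).
Implicit Types (x y w f g : R -> 'cV[R]_n) (s t c : R).
Notation zf := (@zf R n).
Context (b C : R) (b0 : 0 < b) (C0 : 0 <= C).
Hypothesis solvable : forall f c s, lmeasurable f -> 0 <= c ->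
  (forall t, enorm (f t) <= c * expR (- b * `|t - s|)) ->
  exists w, global_sol Lam f w /\ forall t, enorm (w t) <= C * c * expR (- b * `|t - s|).

Lemma integrand_restrict g (D : set R) : measurable D -> integrand g ->
  integrand (fun t => if t \in D then g t else 0).
Proof.
move=> mD [mg bg]; split; first exact: lmeasurable_restrict.
move=> a; have [c hc] := bg a; exists c => t ta.
case: ifP => _; first exact: hc.
by rewrite enorm0; apply: le_trans (hc t ta); exact: enorm_ge0.
Qed.

(** From time [s + r] on, a solution [x] started at [s] agrees with a function
    [z] that vanishes before [s] and is affine on [[s, s + r]]. The forcing
    under which [z] solves the equation has compact support, because the
    equation at [t] only sees [[t - r, t]]. *)
Lemma truncate_history s x c : 0 <= c -> sol Lam zf s x ->
  (forall u, s - r <= u <= s + 2 * r -> enorm (x u) <= c) ->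
  exists f z, [/\ integrand f, global_sol Lam f z,
    forall t, enorm (f t) <= (r^-1 + 2 * M) * c * expR (2 * b * r) * expR (- b * `|t - s|),
    forall t, t <= s -> z t = 0 &
    (forall t, s + r <= t -> z t = x t) /\
    (forall t, t <= s + r -> enorm (z t) <= c)].
Proof.
move=> c0 hx xc; have cx := hx.1.
pose D1 : set R := `]s, (s + r)%R]%classic.
pose D2 : set R := `](s + r)%R, +oo[%classic.
pose v := r^-1 *: x (s + r).
pose g1 t := if t \in D1 then v else 0.
pose g2 t := if t \in D2 then Lam x t else 0.
(* The derivative of [z]. *)
pose zd t := g1 t + 1 *: g2 t.
have Lxi := causal_integrand HL cx.
have zdi : integrand zd.
  apply: integrandD; apply: integrand_restrict => //; try exact: measurable_itv.
  exact: integrand_cst.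
have D1E t : (t \in D1) = (s < t <= s + r).
  by apply/idP/idP => [/set_mem|h]; [|apply/mem_set]; rewrite /D1/= in_itv.
have D2E t : (t \in D2) = (s + r < t).
  apply/idP/idP => [/set_mem|h]; last apply/mem_set; rewrite /D2/= in_itv/= ?andbT//.
have zd0 t : t <= s -> zd t = 0.
  move=> ts; rewrite /zd /g1 /g2 D1E D2E !ltNge ts/= ifN ?scaler0 ?addr0//.
  by rewrite negbK; apply: le_trans ts _; rewrite lerDl ltW.
have zd1 t : s < t -> t <= s + r -> zd t = v.
  by move=> st tr; rewrite /zd /g1 /g2 D1E D2E st tr/= ltNge tr scaler0 addr0.
have zd2 t : s + r < t -> zd t = Lam x t.
  by move=> rt; rewrite /zd /g1 /g2 D1E D2E rt leNgt rt andbF add0r scale1r.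
pose z t := integ zd s (Num.max s t).
have cz : continuous z by exact: integ_continuous.
have z0 t : t <= s -> z t = 0.
  by move=> ts; rewrite /z max_l// integ_refl.
have zE t : s <= t -> z t = integ zd s t by move=> st; rewrite /z max_r.
have r0' := ltW r0.
have xr : enorm (x (s + r)) <= c by apply: xc; apply/andP; split; lra.
have vc : enorm v <= r^-1 * c.
  by rewrite enormZ ger0_norm ?invr_ge0 ?(ltW r0)// ler_wpM2l// invr_ge0 ltW.
have ssr : s <= s + r by rewrite lerDl ltW.
have zc t : t <= s + r -> enorm (z t) <= c.
  move=> tr; have [ts|/ltW st] := leP t s; first by rewrite z0// enorm0.
  rewrite zE// (eq_integ_open zdi (integrand_cst v) st); last first.
    by move=> u su ut; rewrite zd1// (le_trans ut).
  rewrite integ_cst// enormZ ger0_norm ?subr_ge0//.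
  apply: (@le_trans _ _ (r * (r^-1 * c))).
    by apply: ler_pM => //; [rewrite subr_ge0|exact: enorm_ge0|lra].
  by rewrite mulrA divff ?mul1r// gt_eqF.
have zx t : s + r <= t -> z t = x t.
  move=> rt; rewrite zE ?(le_trans ssr)// (integ_chasles zdi ssr rt).
  rewrite (eq_integ_open zdi (integrand_cst v) ssr); last by move=> u su; exact: zd1.
  rewrite integ_cst// [s + r - s]addrAC subrr add0r /v scalerA divff ?gt_eqF// scale1r.
  rewrite (_ : integ zd (s + r) t = x t - x (s + r)); first by rewrite addrC subrK.
  have hx' := solS HL (integrand0 R n) ssr hx.
  rewrite hx'.2//; apply: eq_integ_open => //.
    exact: (sol_integrand HL (integrand0 R n) cx).
  by move=> u ru _; rewrite zd2// /zf scaler0 addr0.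
pose f t := zd t + -1 *: Lam z t.
have fi : integrand f by apply: integrandD => //; exact: (causal_integrand HL cz).
have zc2 t : t <= s + 2 * r -> enorm (z t) <= c.
  move=> t2; have [/zc//|/ltW rt] := leP t (s + r).
  by rewrite zx//; apply: xc; apply/andP; split => //; lra.
have f0 t : t <= s -> f t = 0.
  move=> ts; rewrite /f zd0// add0r; apply: enorm_eq0.
  rewrite enormZ normrN normr1 mul1r -(mulr0 M); apply: (causal_bound HL cz) => // u /andP[_ ut].
  by rewrite z0 ?enorm0// (le_trans ut).
have f2 t : s + 2 * r < t -> f t = 0.
  move=> rt; rewrite /f zd2; last lra.
  rewrite scaleN1r; apply/eqP; rewrite subr_eq0; apply/eqP.
  by apply: (eq_causal HL) => // u /andP[u1 u2]; rewrite zx//; lra.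
exists f, z; split => //.
- apply: (global_sol_extend HL fi z0 f0); split=> // t st; rewrite (z0 s)// subr0 zE//.
  apply: eq_integ => //; first exact: (sol_integrand HL).
  by move=> u _; rewrite /f; vring.
- move=> t; have k0 : 0 <= (r^-1 + 2 * M) * c.
    by rewrite mulr_ge0// addr_ge0 ?mulr_ge0// invr_ge0 ltW.
  have [ts|st] := leP t s.
    by rewrite f0// enorm0 mulr_ge0 ?expR_ge0// mulr_ge0// expR_ge0.
  have [t2|rt] := leP t (s + 2 * r); last first.
    by rewrite f2// enorm0 mulr_ge0 ?expR_ge0// mulr_ge0// expR_ge0.
  apply: (@le_trans _ _ ((r^-1 + 2 * M) * c)); last first.
    rewrite -mulrA -expRD ler_peMr// -[leLHS]expR0 ler_expR ger0_norm ?subr_ge0 ?(ltW st)//.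
    have : 0 <= b * (2 * r - (t - s)) by rewrite mulr_ge0 ?(ltW b0)//; lra.
    lra.
  rewrite /f; apply: le_trans (enormD _ _) _; rewrite enormZ normrN normr1 mul1r.
  have h1 : enorm (Lam z t) <= M * c.
    by apply: (causal_bound HL cz) => // u /andP[_ ut]; apply: zc2; lra.
  have h2 : enorm (zd t) <= r^-1 * c + M * c.
    have [tr|tr] := leP t (s + r).
      by rewrite zd1//; apply: le_trans vc _; rewrite lerDl mulr_ge0.
    rewrite zd2//; apply: (@le_trans _ _ (M * c)); last first.
      by rewrite lerDr mulr_ge0// invr_ge0 ltW.
    apply: (causal_bound HL cx) => // u /andP[u1 u2]; apply: xc; apply/andP; split; lra.
  by lra.
Qed.

(** Subtracting from [z] the decaying solution [w] with the same forcing leaves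
    a homogeneous solution on the whole line; it is [- w] before [s], and it
    differs from [x] by [w] after [s + r]. *)
Lemma splitting : exists2 D : R, 0 <= D & forall s x c, 0 <= c -> sol Lam zf s x ->
  (forall u, s - r <= u <= s -> enorm (x u) <= c) ->
  exists u, [/\ global_sol Lam zf u,
    forall t, t <= s -> enorm (u t) <= D * c * expR (- b * (s - t)) &
    forall t, s - r <= t -> enorm (x t - u t) <= D * c * expR (- b * (t - s))].
Proof.
(* [G] bounds the growth of [x] over [[s, s + 2 r]], and [E] the variation of the
   weight there. *)
pose G := 3 * expR ((2 * M + 1) * (2 * r)); pose E := expR (2 * b * r).
have E1 : 1 <= E by rewrite /E -expR0 ler_expR !mulr_ge0// ltW.
have gam0 : 0 <= 2 * M + 1 by rewrite addr_ge0// mulr_ge0.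
have r0' := ltW r0.
have G1 : 1 <= G.
  have : 1 <= expR ((2 * M + 1) * (2 * r)).
    by rewrite -[leLHS]expR0 ler_expR !mulr_ge0.
  by rewrite /G; lra.
have rM0 : 0 <= r^-1 + 2 * M by rewrite addr_ge0 ?mulr_ge0// invr_ge0.
have D0 : 0 <= (C * (r^-1 + 2 * M) + 2) * G * E.
  by rewrite !mulr_ge0 ?expR_ge0// addr_ge0// mulr_ge0.
exists ((C * (r^-1 + 2 * M) + 2) * G * E) => // s x c c0 hx xc.
have Gc0 : 0 <= G * c by rewrite mulr_ge0//; lra.
have xG u : s - r <= u <= s + 2 * r -> enorm (x u) <= G * c.
  move=> /andP[u1 u2]; have [us|/ltW su] := leP u s.
    by apply: (@le_trans _ _ c); [apply: xc; rewrite u1|rewrite ler_peMl].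
  apply: le_trans (growth r0' M0 HL hx su c0 xc) _.
  rewrite (_ : G * c = 3 * c * expR ((2 * M + 1) * (2 * r))); last by rewrite /G; ring.
  rewrite ler_wpM2l ?mulr_ge0//.
  by rewrite ler_expR ler_wpM2l//; lra.
have [f [z [fi hz fb z0 [zx zc]]]] := truncate_history Gc0 hx xG.
set F := (r^-1 + 2 * M) * (G * c) * E in fb.
have F0 : 0 <= F by rewrite mulr_ge0 ?expR_ge0// mulr_ge0.
have [w [hw wb]] := solvable fi.1 F0 fb.
have CF : C * F <= (C * (r^-1 + 2 * M) + 2) * G * E * c.
  rewrite -subr_ge0 (_ : _ - _ = 2 * (G * c) * E); last by rewrite /F; ring.
  by rewrite !mulr_ge0 ?expR_ge0//; lra.
exists (fun t => z t - w t); split.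
- move=> a; apply: (eq_sol HL (f := fun t => f t - f t)); last exact: (global_solB HL fi fi hz hw a).
  + have := integrandD (-1) fi fi; congr integrand.
    by apply/funext => u; rewrite scaleN1r.
  + exact: integrand0.
  + by move=> t _; rewrite subrr.
- move=> t ts; rewrite z0// sub0r enormN; apply: le_trans (wb t) _.
  by rewrite distrC ger0_norm ?subr_ge0// ler_wpM2r// expR_ge0.
- move=> t rt; rewrite opprB addrA [x t + _]addrC -addrA; apply: le_trans (enormD _ _) _.
  have h1 : enorm (w t) <= C * F * expR (- b * (t - s)).
    apply: le_trans (wb t) _; rewrite ler_wpM2l ?(mulr_ge0 C0 F0)//.
    by rewrite ler_expR !mulNr lerN2 ler_wpM2l ?(ltW b0)// ler_norm.
  have h2 : enorm (x t - z t) <= 2 * (G * c) * E * expR (- b * (t - s)).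
    have [tr|/ltW tr] := leP t (s + r); last first.
      by rewrite zx// subrr enorm0 mulr_ge0 ?expR_ge0// mulr_ge0 ?expR_ge0// mulr_ge0.
    apply: (@le_trans _ _ (2 * (G * c))).
      apply: le_trans (enormB _ _) _; rewrite mulr_natl mulr2n.
      by apply: lerD; [apply: xG; apply/andP; split; lra|exact: zc].
    rewrite -mulrA -expRD ler_peMr// ?mulr_ge0// -[leLHS]expR0 ler_expR.
    have : 0 <= b * (2 * r - (t - s)) by rewrite mulr_ge0 ?(ltW b0)//; lra.
    lra.
  apply: le_trans (lerD h1 h2) _; rewrite -mulrDl ler_wpM2r ?expR_ge0//.
  by rewrite le_eqVlt; apply/orP; left; apply/eqP; rewrite /F; ring.
Qed.

End splitting.

(** * The evolution operator of the delay equation *)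

(** The decomposition is unique, so choosing it for every vector is linear. *)
Lemma complement_projection (R : realType) (V : lmodType R) (S W : set V) :
  (forall c u v, S u -> S v -> S (u + c *: v)) ->
  (forall c u v, W u -> W v -> W (u + c *: v)) ->
  (forall v, S v -> W v -> v = 0) -> (forall v, exists w, S w /\ W (v - w)) ->
  exists P : {linear V -> V}, forall v, S (P v) /\ W (v - P v).
Proof.
move=> SD WD SW dec; have [p hp] := choice dec.
have plin : linear p.
  move=> a u v; have [Su Wu] := hp u; have [Sv Wv] := hp v.
  have [Suv Wuv] := hp (a *: u + v).
  apply/eqP; rewrite -subr_eq0 -scaleN1r; apply/eqP; apply: SW.
    by apply: (SD) => //; rewrite [_ + p v]addrC; exact: SD.
  rewrite [X in W X](_ : _ = (v - p v + a *: (u - p u)) + -1 *: (a *: u + v - p (a *: u + v))).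
    by apply: (WD) => //; exact: WD.
  rewrite !scaleN1r scalerBr !opprB !opprD.
  move: (p (a *: u + v)) => q; rewrite [X in _ = X + _]addrACA -[- (a *: u) - v]opprD [a *: u + v]addrC [RHS]addrC addrA subrK.
  by rewrite [- p v - _]addrC.
pose P : {linear V -> V} := HB.pack p (GRing.isLinear.Build _ _ _ _ p plin).
by exists P.
Qed.

Section delay_evolution.
Context (R : realType) (r : R) (n : nat) (r0 : 0 < r) (eta : R -> R -> 'M[R]_n).
Context (M : R) (M0 : 0 <= M).
Notation C := (continuousType (delay_itv r) 'cV[R]_n).
Notation Lam := (delayLam r eta).
Context (HL : causal r M Lam).
Notation U := (@delay_evolution R r n eta).
Notation zf := (@zf R n).
Implicit Types (phi psi : C) (x y w : R -> 'cV[R]_n) (s t u c : R).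

Let r0' : 0 <= r := ltW r0.

Lemma segment_val x s t phi : segment x s = phi -> s - r <= t <= s ->
  x t = phi (delay_point r0 (t - s)).
Proof.
move=> <- ts; rewrite /segment val_delay_point; last by lra.
by congr x; lra.
Qed.

Lemma segment_inj x y s t : segment (r := r) x s = segment y s -> s - r <= t <= s ->
  x t = y t.
Proof.
move=> xy ts; have := f_equal (fun f => f (delay_point r0 (t - s))) xy.
rewrite /segment val_delay_point; last by lra.
by rewrite (_ : s + (t - s) = t)//; lra.
Qed.

Lemma segmentDZ x y c t phi psi : segment x t = phi -> segment y t = psi ->
  segment (fun v => x v + c *: y v) t = (phi + c *: psi : C) :> (delay_itv r -> _).
Proof. by move=> xp yp; apply/funext => th; transitivity (phi th + c *: psi th); first rewrite -xp -yp. Qed.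

Lemma segment_eq phi psi : phi = psi :> (delay_itv r -> 'cV[R]_n) -> phi = psi.
Proof. by move=> h; apply/continuousEP => th; rewrite h. Qed.

Lemma clamp_history s x : {within `[s - r, +oo[, continuous x} ->
  continuous (fun u => x (Num.max (s - r) u)).
Proof.
move=> /subspace_continuousP cx t.
have tm : `[s - r, +oo[%classic (Num.max (s - r) t).
  by rewrite /= in_itv/= andbT le_max lexx.
apply: (@cvg_comp _ _ _ (fun u => Num.max (s - r) u) x _ _ _ _ (cx _ tm)) => B hB.
have cm : continuous (fun u : R => Num.max (s - r) u).
  by move=> v; exact: (continuous_max (cvg_cst _) (@cvg_id _ _)).
have h : nbhs t (fun u => `[s - r, +oo[%classic (Num.max (s - r) u) ->
  B (Num.max (s - r) u)) := cm t _ hB.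
suff : nbhs t (fun u => B (Num.max (s - r) u)) by [].
apply: filterS h => u; apply.
by rewrite /= in_itv/= andbT le_max lexx.
Qed.

Lemma delay_evolutionE s t x phi : s <= t -> sol Lam zf s x -> segment x s = phi ->
  segment x t = U t s phi.
Proof.
move=> st hx xphi; have cx := hx.1; have rge0 : 0 <= r by exact: ltW.
have sx := (sol_solvesP HL s (integrand0 R n) cx).1 hx.
rewrite /delay_evolution; case: xgetP => [psi _ [y [cy yphi sy] <-]|]; last first.
  move=> /(_ (cseg r cx t)) []; exists x => //; split => //.
    exact: continuous_subspaceT.
  by apply: eq_solves_from sx => // u _; rewrite scaler0 addr0.
pose z u := y (Num.max (s - r) u).
have cz : continuous z by exact: clamp_history.
have zy u : s - r <= u -> z u = y u by move=> su; rewrite /z max_r.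
have zs u : s <= u -> segment (r := r) z u = segment y u.
  move=> su; apply/funext => th; rewrite /segment zy//.
  by have := delay_itvP th; lra.
have hz : sol Lam zf s z.
  apply/(sol_solvesP HL s (integrand0 R n) cz); apply: eq_solves_from sy => u su.
    by rewrite zy//; lra.
  by rewrite /delayLam zs// scaler0 addr0.
have xz u : s - r <= u -> x u = z u.
  move=> ru; have [us|/ltW su] := leP u s.
    by apply: (@segment_inj _ _ s); rewrite ?zs ?yphi ?ru.
  apply: (sol_unique r0' M0 HL (integrand0 R n) hx hz) => // v vs.
  by apply: (@segment_inj _ _ s); rewrite ?zs ?yphi.
rewrite -zs//; apply/funext => th; rewrite /segment xz//.
by have := delay_itvP th; lra.
Qed.

Lemma delay_ivp s phi : exists x, sol Lam zf s x /\ segment x s = phi.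
Proof.
have ch : continuous (fun u => extend r0 phi (u - s)).
  move=> u; apply: (@continuous_comp _ _ _ (fun u => u - s)).
    by apply: cvgB; [exact: cvg_id|exact: cvg_cst].
  exact: extend_continuous.
have [|x [xs hx]] := sol_exists r0' M0 HL s (integrand0 R n) ch (cf := 0).
  by move=> t; rewrite enorm0.
exists x; split=> //; apply/funext => th; rewrite /segment xs; last first.
  by have := delay_itvP th; lra.
by rewrite /extend [s + _]addrC addrK delay_pointK.
Qed.

End delay_evolution.

(** * The dichotomy of the delay equation *)

Section delay_dichotomy.
Context (R : realType) (r : R) (n : nat) (r0 : 0 < r) (eta : R -> R -> 'M[R]_n).
Context (M : R) (M0 : 0 <= M).
Notation C := (continuousType (delay_itv r) 'cV[R]_n).
Notation Lam := (delayLam r eta).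
Context (HL : causal r M Lam).
Notation U := (@delay_evolution R r n eta).
Notation zf := (@zf R n).
Implicit Types (phi psi : C) (x y w : R -> 'cV[R]_n) (s t u c : R).
Context (b D : R) (b0 : 0 < b) (D0 : 0 <= D).
Hypothesis split_sol : forall s x c, 0 <= c -> sol Lam zf s x ->
  (forall u, s - r <= u <= s -> enorm (x u) <= c) ->
  exists w, [/\ global_sol Lam zf w,
    forall t, t <= s -> enorm (w t) <= D * c * expR (- b * (s - t)) &
    forall t, s - r <= t -> enorm (x t - w t) <= D * c * expR (- b * (t - s))].
Hypothesis bounded_zero : forall w c, global_sol Lam zf w ->
  (forall t, enorm (w t) <= c) -> forall t, w t = 0.

Let r0' : 0 <= r := ltW r0.

(** The range and the kernel of the projection at time [s]: the initial functions
    whose solution is bounded on the future, and the segments of solutions on the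
    whole line that are bounded on the past. *)
Definition stable s phi := exists x,
  [/\ sol Lam zf s x, segment x s = phi & exists c, forall t, s <= t -> enorm (x t) <= c].

Definition unstable s phi := exists w,
  [/\ global_sol Lam zf w, segment w s = phi & exists c, forall t, t <= s -> enorm (w t) <= c].

Lemma boundDZ x y c c1 c2 t : enorm (x t) <= c1 -> enorm (y t) <= c2 ->
  enorm (x t + c *: y t) <= c1 + `|c| * c2.
Proof.
move=> h1 h2; apply: le_trans (enormD _ _) _; rewrite enormZ.
by apply: lerD => //; rewrite ler_wpM2l.
Qed.

Lemma stableDZ s c phi psi : stable s phi -> stable s psi -> stable s (phi + c *: psi).
Proof.
move=> [x [hx xs [c1 hc1]]] [y [hy ys [c2 hc2]]]; exists (fun t => x t + c *: y t); split.
- exact: (solDZ0 HL).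
- exact: segmentDZ.
- by exists (c1 + `|c| * c2) => t st; apply: boundDZ; [exact: hc1|exact: hc2].
Qed.

Lemma unstableDZ s c phi psi : unstable s phi -> unstable s psi -> unstable s (phi + c *: psi).
Proof.
move=> [x [hx xs [c1 hc1]]] [y [hy ys [c2 hc2]]]; exists (fun t => x t + c *: y t); split.
- by move=> a; exact: (solDZ0 HL).
- exact: segmentDZ.
- by exists (c1 + `|c| * c2) => t st; apply: boundDZ; [exact: hc1|exact: hc2].
Qed.

Lemma global_sol_zero w s c : global_sol Lam zf w -> (forall t, t <= s -> enorm (w t) <= c) ->
  (exists c, forall t, s <= t -> enorm (w t) <= c) -> forall t, w t = 0.
Proof.
move=> hw h1 [c' h2]; apply: (bounded_zero (c := `|c| + `|c'|) hw) => t.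
have [ts|/ltW st] := leP t s.
  by apply: le_trans (h1 t ts) _; rewrite (le_trans (ler_norm _))// lerDl.
by apply: le_trans (h2 t st) _; rewrite (le_trans (ler_norm _))// lerDr.
Qed.

(** The two solutions through [phi] agree after [s], so the one on the whole line
    is bounded. *)
Lemma stable_unstable s phi : stable s phi -> unstable s phi -> phi = 0.
Proof.
move=> [x [hx xs [c1 hc1]]] [w [hw ws [c2 hc2]]].
have xw : segment (r := r) x s = segment w s by rewrite xs ws.
have w0 : forall t, w t = 0.
  apply: (global_sol_zero hw hc2); exists c1 => t st.
  rewrite -(sol_unique r0' M0 HL (integrand0 R n) hx (hw s) _ st); first exact: hc1.
  by move=> u us; exact: (segment_inj r0 xw us).
by apply: segment_eq; rewrite -ws; apply/funext => th; rewrite /segment w0.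
Qed.

Lemma delay_splitting s phi : exists x w,
  [/\ sol Lam zf s x, segment x s = phi, global_sol Lam zf w,
    forall t, t <= s -> enorm (w t) <= D * supnorm phi * expR (- b * (s - t)) &
    forall t, s - r <= t -> enorm (x t - w t) <= D * supnorm phi * expR (- b * (t - s))].
Proof.
have [x [hx xs]] := delay_ivp r0 M0 HL s phi.
have [|w [hw w1 w2]] := split_sol (supnorm_ge0 r0 phi) hx.
  by move=> u us; rewrite (segment_val r0 xs us); exact: supnorm_ge.
by exists x, w.
Qed.

Lemma decay_le c t : 0 <= c -> 0 <= t -> c * expR (- b * t) <= c.
Proof.
move=> c0 t0; rewrite ler_piMr// -expR0 ler_expR mulNr oppr_le0 mulr_ge0//.
exact: ltW.
Qed.

(** The stable part of [phi] is the segment of [x - w], the unstable part that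
    of [w]. *)
Lemma splitting_projection s phi x w : sol Lam zf s x -> segment x s = phi ->
  global_sol Lam zf w ->
  (forall t, t <= s -> enorm (w t) <= D * supnorm phi * expR (- b * (s - t))) ->
  (forall t, s - r <= t -> enorm (x t - w t) <= D * supnorm phi * expR (- b * (t - s))) ->
  forall psi, segment (fun t => x t + -1 *: w t) s = psi ->
  stable s psi /\ unstable s (phi - psi).
Proof.
move=> hx xs hw w1 w2 psi hpsi.
have c0 : 0 <= D * supnorm phi by rewrite mulr_ge0// supnorm_ge0.
split.
  exists (fun t => x t + -1 *: w t); split; [exact: (solDZ0 HL _ hx (hw s))|exact: hpsi|].
  exists (D * supnorm phi) => t st; rewrite scaleN1r.
  apply: le_trans (w2 t _) _; first by rewrite lerBlDr (le_trans st)// lerDl.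
  by apply: decay_le; rewrite // subr_ge0.
exists w; split=> //; last first.
  exists (D * supnorm phi) => t ts; apply: le_trans (w1 t ts) _.
  by apply: decay_le; rewrite // subr_ge0.
rewrite -scaleN1r -(segmentDZ (-1) xs hpsi); apply/funext => th.
by rewrite /segment; vring.
Qed.

Lemma projection_exists : exists P : R -> {linear C -> C},
  forall s phi, stable s (P s phi) /\ unstable s (phi - P s phi).
Proof.
suff h s : exists P : {linear C -> C},
    forall phi, stable s (P phi) /\ unstable s (phi - P phi).
  by have [P hP] := choice h; exists P.
apply: complement_projection; [exact: stableDZ|exact: unstableDZ|exact: stable_unstable|].
move=> phi; have [x [w [hx xs hw w1 w2]]] := delay_splitting s phi.
have cx : continuous (fun t => x t + -1 *: w t).
  by apply: continuousDZ; [exact: hx.1|exact: (hw s).1].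
exists (cseg r cx s); exact: (splitting_projection hx xs hw w1 w2).
Qed.

Lemma delay_evolution_refl s phi : U s s phi = phi.
Proof.
have [x [hx xs]] := delay_ivp r0 M0 HL s phi.
by apply: segment_eq; rewrite -(delay_evolutionE r0 M0 HL (lexx s) hx xs).
Qed.

Lemma delay_evolutionDZ s t c phi psi : s <= t ->
  U t s (phi + c *: psi) = U t s phi + c *: U t s psi.
Proof.
move=> st; have [x [hx xs]] := delay_ivp r0 M0 HL s phi.
have [y [hy ys]] := delay_ivp r0 M0 HL s psi.
have hxy := solDZ0 HL c hx hy.
apply: segment_eq; rewrite -(delay_evolutionE r0 M0 HL st hxy (segmentDZ c xs ys)).
by apply: segmentDZ; exact: (delay_evolutionE r0 M0 HL st).
Qed.

Lemma stable_evolution s t phi : s <= t -> stable s phi -> stable t (U t s phi).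
Proof.
move=> st [x [hx xs [c hc]]]; exists x; split.
- exact: (solS HL (integrand0 R n) st hx).
- exact: (delay_evolutionE r0 M0 HL st hx xs).
- by exists c => u tu; apply: hc; exact: le_trans tu.
Qed.

Lemma unstable_evolution s t phi : s <= t -> unstable s phi -> unstable t (U t s phi).
Proof.
move=> st [w [hw ws [c hc]]]; exists w; split=> //.
  exact: (delay_evolutionE r0 M0 HL st (hw s) ws).
have [c' c'0 hc'] := continuous_bounded s t (hw s).1.
exists (`|c| + c') => u ut; have [us|/ltW su] := leP u s.
  by apply: le_trans (hc u us) _; rewrite (le_trans (ler_norm _))// lerDl.
by apply: le_trans (hc' u _) _; rewrite ?lerDr// su.
Qed.

Section projections.
Context (P : R -> {linear C -> C}).
Hypothesis hP : forall s phi, stable s (P s phi) /\ unstable s (phi - P s phi).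

Lemma projE s phi psi : stable s psi -> unstable s (phi - psi) -> P s phi = psi.
Proof.
move=> h1 h2; have [h3 h4] := hP s phi; apply/eqP; rewrite -subr_eq0 -scaleN1r; apply/eqP.
apply: (@stable_unstable s); first exact: stableDZ.
rewrite (_ : _ + _ = (phi - psi) + -1 *: (phi - P s phi)); first exact: unstableDZ.
by rewrite !scaleN1r opprB [RHS]addrC addrA subrK.
Qed.

Lemma ker_projE s phi : ker (P s) phi <-> unstable s phi.
Proof.
have [h1 h2] := hP s phi; split=> [p0|hphi]; first by move: h2; rewrite p0 subr0.
have S0 : stable s 0 by have [] := hP s 0; rewrite raddf0.
by apply: projE; rewrite ?subr0.
Qed.

Lemma proj_evolution s t phi : s <= t -> U t s (P s phi) = P t (U t s phi).
Proof.
move=> st; have [h1 h2] := hP s phi; symmetry; apply: projE.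
  exact: stable_evolution.
by rewrite -scaleN1r -delay_evolutionDZ// scaleN1r; exact: unstable_evolution.
Qed.

(** Two unstable functions with the same image at time [t] differ by the segment
    of a solution on the whole line that vanishes from [t - r] on; this solution
    is bounded, hence zero. *)
Lemma ker_bij s t : s <= t -> set_bij (ker (P s)) (ker (P t)) (U t s).
Proof.
move=> st; split.
- by move=> phi /= /ker_projE h; apply/ker_projE; exact: unstable_evolution.
- move=> phi psi /set_mem/ker_projE hphi /set_mem/ker_projE hpsi e.
  have [w [hw ws [c hc]]] := unstableDZ (-1) hphi hpsi.
  have wt : segment w t = (0 : C).
    by rewrite (delay_evolutionE r0 M0 HL st (hw s) ws) delay_evolutionDZ// e scaleN1r subrr.
  have w0 : forall u, w u = 0.
    apply: (global_sol_zero hw hc).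
    have [c' c'0 hc'] := continuous_bounded s t (hw s).1.
    exists c' => u su; have [ut|/ltW tu] := leP u t; first by apply: hc'; rewrite su.
    apply: le_trans c'0; have := growth r0' M0 HL (hw t) tu (lexx 0).
    rewrite mulr0 mul0r; apply => v vt.
    by rewrite (segment_val r0 wt vt) enorm0.
  apply/eqP; rewrite -subr_eq0 -scaleN1r; apply/eqP/segment_eq; rewrite -ws.
  by apply/funext => th; rewrite /segment w0.
- move=> psi /= /ker_projE[w [hw wt [c hc]]].
  exists (cseg r (hw s).1 s); last first.
    apply: segment_eq; rewrite -wt.
    by rewrite -(delay_evolutionE r0 M0 HL st (hw s) (phi := cseg r (hw s).1 s)).
  apply/ker_projE; exists w; split=> //.
  by exists c => u us; apply: hc; exact: le_trans st.
Qed.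

Lemma stable_bound s t phi : s <= t ->
  supnorm (U t s (P s phi)) <= D * expR (b * r) * expR (- b * (t - s)) * supnorm phi.
Proof.
move=> st; have [x [w [hx xs hw w1 w2]]] := delay_splitting s phi.
have cx : continuous (fun t => x t + -1 *: w t).
  by apply: continuousDZ; [exact: hx.1|exact: (hw s).1].
have [h1 h2] := splitting_projection hx xs hw w1 w2 (erefl (cseg r cx s : _ -> _)).
rewrite (projE h1 h2); apply: supnorm_le => // th.
rewrite -(delay_evolutionE r0 M0 HL st (solDZ0 HL (-1) hx (hw s)) (phi := cseg r cx s))//.
have /andP[t1 t2] := delay_itvP th.
rewrite /segment scaleN1r; apply: le_trans (w2 _ _) _; first by lra.
rewrite -[D * expR _ * _]mulrA -expRD mulrAC ler_wpM2r ?supnorm_ge0// ler_wpM2l//.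
rewrite ler_expR; have : 0 <= b * (r + \val th) by rewrite mulr_ge0 ?(ltW b0)//; lra.
by lra.
Qed.

Lemma unstable_bound s t phi : t <= s ->
  supnorm (backward U P t s (phi - P s phi)) <= D * expR (- b * (s - t)) * supnorm phi.
Proof.
move=> ts; have [x [w [hx xs hw w1 w2]]] := delay_splitting s phi.
have cx : continuous (fun t => x t + -1 *: w t).
  by apply: continuousDZ; [exact: hx.1|exact: (hw s).1].
have [h1 h2] := splitting_projection hx xs hw w1 w2 (erefl (cseg r cx s : _ -> _)).
have ws : segment w s = phi - P s phi :> (delay_itv r -> _).
  rewrite (projE h1 h2) -scaleN1r.
  rewrite -(segmentDZ (-1) xs (erefl (cseg r cx s : _ -> _))); apply/funext => th.
  by rewrite /segment; vring.
have wt : U s t (cseg r (hw t).1 t) = phi - P s phi.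
  apply: segment_eq; rewrite -ws.
  by rewrite -(delay_evolutionE r0 M0 HL ts (hw t) (phi := cseg r (hw t).1 t)).
have [_ inj _] := ker_bij ts.
have c0 : 0 <= D * supnorm phi by rewrite mulr_ge0// supnorm_ge0.
have kt : ker (P t) (cseg r (hw t).1 t).
  apply/ker_projE; exists w; split=> //; exists (D * supnorm phi) => u ut.
  have us := le_trans ut ts.
  by apply: le_trans (w1 u us) _; apply: decay_le; rewrite // subr_ge0.
rewrite -wt /backward pinvKV//; last exact/mem_set.
apply: supnorm_le => // th; have /andP[t1 t2] := delay_itvP th.
apply: le_trans (w1 _ _) _; first by lra.
rewrite mulrAC ler_wpM2r ?supnorm_ge0// ler_wpM2l// ler_expR.
have : 0 <= b * (- \val th) by rewrite mulr_ge0 ?(ltW b0)//; lra.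
lra.
Qed.

End projections.

Lemma exp_dichotomy_delay :
  exp_dichotomy (@supnorm R r n) U b (D * expR (b * r) + 1).
Proof.
have [P hP] := projection_exists.
have E0 t : 0 <= expR t :> R := expR_ge0 t.
have E1 : 1 <= expR (b * r) by rewrite -[leLHS]expR0 ler_expR mulr_ge0// ltW.
have K0 : 0 <= D * expR (b * r) by rewrite mulr_ge0.
have st_bound s t : s <= t -> (opnorm (@supnorm R r n) (@supnorm R r n)
    (fun phi => U t s (P s phi)) <= ((D * expR (b * r) + 1) * expR (- b * (t - s)))%:E)%E.
  move=> st; apply: le_opnorm => [|phi]; first by rewrite mulr_ge0// addr_ge0.
  apply: le_trans (stable_bound hP phi st) _.
  by rewrite ler_wpM2r ?supnorm_ge0// ler_wpM2r// lerDl.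
exists P; split.
- move=> t; split; last by move=> phi; have [h1 h2] := hP t phi;
    apply: (projE hP) h1 _; rewrite subrr; have [_] := hP t 0; rewrite raddf0 subr0.
  have := st_bound t t (lexx t); rewrite (_ : (fun phi => _) = P t); last first.
    by apply/funext => phi; rewrite delay_evolution_refl.
  by move=> h; apply: le_lt_trans h _; rewrite ltry.
- by move=> t s st phi; exact: (proj_evolution hP).
- by move=> t s st; exact: (ker_bij hP).
- by move=> t s st; exact: st_bound.
- move=> t s ts; apply: le_opnorm => [|phi]; first by rewrite mulr_ge0// addr_ge0.
  apply: le_trans (unstable_bound hP phi ts) _.
  rewrite ler_wpM2r ?supnorm_ge0// ler_wpM2r//.
  by apply: (@le_trans _ _ (D * expR (b * r))); [rewrite ler_peMr|rewrite lerDl].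
Qed.

End delay_dichotomy.

(** * The size of the delay *)

(** The hypothesis says that [M r expR (4 al) (4 K M + al) <= al - b]: so the
    factor [M r] of [rate b] compensates the denominator [al - b], and
    [expR (b r) <= expR (4 al)] because [b r <= al]. What remains is
    [2 K M + (al - b) < 4 K M + al]. *)
Lemma rate_lt1 (R : realType) (al K M r b : R) : 0 < al -> 0 < K -> 0 < M ->
  0 < r -> r <= 1 -> 0 <= b ->
  b <= al - M * expR (4 * al) * (4 * K * M + al) * r -> rate r M al K b < 1.
Proof.
move=> al0 K0 M0 r0 r1 b0 hb.
have E4 : 0 < expR (4 * al) by exact: expR_gt0.
pose q := 4 * K * M + al; have KM0 : 0 < K * M by rewrite mulr_gt0.
have q0 : 0 < q by rewrite /q; lra.
pose Z := M * expR (4 * al) * q; have Z0 : 0 < Z by rewrite !mulr_gt0.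
have Zr : Z * r <= al - b by rewrite /Z /q; lra.
have Zr0 : 0 < Z * r by rewrite mulr_gt0.
have ab0 : 0 < al - b by exact: lt_le_trans Zr.
have hE : expR (b * r) <= expR (4 * al).
  rewrite ler_expR; apply: (@le_trans _ _ b); last by lra.
  by rewrite ler_piMr.
have e1 : M * r * expR (4 * al) * q <= al - b by apply: le_trans Zr; rewrite /Z; lra.
apply: (@le_lt_trans _ _ (M * r * expR (4 * al) * (2 * K * M / (al - b) + 1))).
  have h0 : 0 <= 2 * K * M / (al - b) + 1.
    by rewrite addr_ge0// divr_ge0 ?(ltW ab0)//; lra.
  by rewrite /rate ler_wpM2r// ler_wpM2l// mulr_ge0// ltW.
have X0 : 0 < M * r * expR (4 * al) by rewrite !mulr_gt0.
rewrite (_ : _ * _ = M * r * expR (4 * al) * (2 * K * M + (al - b)) / (al - b)); last first.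
  by field; rewrite gt_eqF.
rewrite ltr_pdivrMr// mul1r; apply: lt_le_trans e1.
by rewrite ltr_pM2l// /q; lra.
Qed.

Theorem theorem2p3 (R : realType) (n : nat) (A : R -> 'M[R]_n)
    (alpha K M : R) (alpha_gt0 : 0 < alpha) (K_gt0 : 0 < K)
    (A_dichotomy : exp_dichotomy (@enorm R n) (ode_evolution A) alpha K)
    (M_gt0 : 0 < M) :
  let zeta := M * expR (4 * alpha) * (4 * K * M + alpha) in
  let epsilon0 := Num.min 1 (alpha / zeta) in
  0 < epsilon0 /\
  forall (r beta : R) (eta : R -> R -> 'M[R]_n),
    0 < r < epsilon0 ->
    0 < beta <= alpha - zeta * r ->
    standing_assumptions r eta ->
    (forall t theta, theta <= - r -> eta t theta = - A t) ->
    (ereal_sup (range (normL r eta)) <= M%:E)%E ->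
    exists2 K' : R, 0 < K' &
      exp_dichotomy (@supnorm R r n) (@delay_evolution R r n eta) beta K'.
Proof.
move=> zeta epsilon0.
have KM0 : 0 < K * M by rewrite mulr_gt0.
have zeta0 : 0 < zeta by rewrite !mulr_gt0 ?expR_gt0//; lra.
split; first by rewrite lt_min ltr01 divr_gt0.
move=> r beta eta /andP[r0]; rewrite lt_min => /andP[r1 ra] /andP[be0 be1].
move=> eta_std etaA normM.
have [P dich] := A_dichotomy.
have HL := delayLam_causal r0 eta_std M_gt0 normM.
have HA := ode_causal r0 eta_std M_gt0 normM etaA.
have Lc := delayLam_cst r0 eta_std etaA.
have q1 : rate r M alpha K beta < 1.
  by apply: rate_lt1 => //; exact: ltW.
have q2 : rate r M alpha K 0 < 1.
  apply: rate_lt1 => //; first exact: ltW.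
  by apply: le_trans be1; exact: ltW.
have zr : 0 < zeta * r by rewrite mulr_gt0.
have ba : beta < alpha by lra.
pose C := 2 * K / (alpha - beta) / (1 - rate r M alpha K beta).
have C0 : 0 <= C by rewrite !divr_ge0// ?subr_ge0 ?(ltW ba) ?(ltW q1)// mulr_ge0// ltW.
have solv f c s : lmeasurable f -> 0 <= c ->
    (forall t, enorm (f t) <= c * expR (- beta * `|t - s|)) ->
    exists w, global_sol (delayLam r eta) f w /\
      forall t, enorm (w t) <= C * c * expR (- beta * `|t - s|).
  move=> mf c0 fc.
  have [w [hw wb]] := delay_solvable (ltW r0) (ltW M_gt0) HA HL Lc alpha_gt0 K_gt0 dich
    mf c0 be0 ba q1 fc.
  exists w; split=> // t; apply: le_trans (wb t) _.
  rewrite le_eqVlt; apply/orP; left; apply/eqP; congr (_ * _).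
  by rewrite /C mulrA mulrAC.
have [D D0 hD] := splitting r0 (ltW M_gt0) HL be0 C0 solv.
exists (D * expR (beta * r) + 1).
  by rewrite ltr_wpDl// mulr_ge0// expR_ge0.
apply: (exp_dichotomy_delay r0 (ltW M_gt0) HL be0 D0 hD) => w c hw wc.
exact: (delay_bounded_zero (ltW r0) (ltW M_gt0) HA HL Lc alpha_gt0 K_gt0 dich q2 hw wc).
Qed.
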